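(* Let $m,n$ be positive integers, let $\mu\in\mathfrak{h}^*$ be a weight of $\mathfrak{gl}_m$ with $\mu_a-\mu_b\notin\mathbb{Z}$ whenever $a\ne b$, and let $\lambda\in\mathfrak{h}^*$ be such that all labels of $\nu=\lambda-\mu$ belong to $\{0,1,\ldots,n\}$. Then for any $\sigma\in\mathfrak{S}_m$ the vector $I_\sigma(v_\mu^\lambda)$ equals $v_{\sigma\circ\mu}^{\sigma\circ\lambda}$ times $$\prod_{\substack{1\le a<b\le m\\ \sigma(a)>\sigma(b)}}(-1)^{\nu_a\nu_b}\,\kappa_{ab},\qquad \kappa_{ab}=\begin{cases}\dfrac{\lambda_a-\lambda_b-a+b}{\mu_a-\mu_b-a+b}&\text{if }\nu_a<\nu_b,\\[8pt]1&\text{if }\nu_a\ge\nu_b.\end{cases}$$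
   Context: Everything is over $\mathbb{C}$. $\mathcal{G}(\mathbb{C}^m\otimes\mathbb{C}^n)$ is the Grassmann algebra on anticommuting variables $x_{ak}$ ($1\le a\le m$, $1\le k\le n$); $\partial_{ak}$ are the corresponding left derivations; $\mathcal{GD}(\mathbb{C}^m\otimes\mathbb{C}^n)$ is the ring of all linear endomorphisms of $\mathcal{G}(\mathbb{C}^m\otimes\mathbb{C}^n)$, generated by left multiplications $x_{ak}$ and the $\partial_{ak}$. Let $\gamma:\mathrm{U}(\mathfrak{gl}_m)\to\mathcal{GD}(\mathbb{C}^m\otimes\mathbb{C}^n)$, $\gamma(E_{ab})=\sum_{k=1}^n x_{ak}\partial_{bk}$; this defines the $\mathfrak{gl}_m$-action on $\mathcal{G}(\mathbb{C}^m\otimes\mathbb{C}^n)$. $\mathfrak{gl}_m=\mathfrak{n}\oplus\mathfrak{h}\oplus\mathfrak{n}'$, where $\mathfrak{h}$ has basis $E_{11},\ldots,E_{mm}$, $\mathfrak{n}$ is spanned by $E_{ab}$ with $a>b$, and $\mathfrak{n}'$ by $E_{ab}$ with $a<b$. A weight $\mu\in\mathfrak{h}^*$ has labels $\mu_a=\mu(E_{aa})$. $M_\mu$ is the Verma module: the quotient of $\mathrm{U}(\mathfrak{gl}_m)$ by the left ideal generated by $\mathfrak{n}'$ and all $E_{aa}-\mu_a$; $1_\mu\in M_\mu$ is the image of $1$. For a $\mathfrak{gl}_m$-module $W$ put $W_{\mathfrak{n}}=W/\mathfrak{n}\cdot W$, on which $\mathfrak{h}$ acts, and let $W_{\mathfrak{n}}^\lambda$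 be its subspace of vectors of weight $\lambda$. The tensor products $M_\mu\otimes\mathcal{G}$ carry the diagonal $\mathfrak{gl}_m$-action. The symmetric group $\mathfrak{S}_m$ acts on $\mathfrak{h}^*$ by $\sigma(\mu_1,\ldots,\mu_m)=(\mu_{\sigma^{-1}(1)},\ldots,\mu_{\sigma^{-1}(m)})$; with $\rho=(0,-1,\ldots,1-m)$, the shifted action is $\sigma\circ\mu=\sigma(\mu+\rho)-\rho$. $\sigma_c$ is the transposition of $c,c+1$; $\varepsilon_c\in\mathfrak{h}^*$ is $E_{cc}^*-E_{c+1,c+1}^*$, where $E_{11}^*,\dots,E_{mm}^*$ is the dual basis. Put $E_c=E_{c,c+1}$, $F_c=E_{c+1,c}$, $H_c=E_{cc}-E_{c+1,c+1}$. The algebra $\mathrm{A}$ is generated by $\mathrm{U}(\mathfrak{gl}_m)$ and $\mathcal{GD}(\mathbb{C}^m\otimes\mathbb{C}^n)$ with cross relations $[X,Y]=[\gamma(X),Y]$ for $X\in\mathfrak{gl}_m$, $Y\in\mathcal{GD}$; it is isomorphic to $\mathrm{U}(\mathfrak{gl}_m)\otimes\mathcal{GD}$ via $X\mapsto X\otimes1+1\otimes\gamma(X)$, $Y\mapsto1\otimes Y$. $\mathfrak{S}_m$ acts on $\mathrm{A}$ by automorphisms $E_{ab}\mapsto E_{\sigma(a)\sigma(b)}$, $x_{ak}\mapsto x_{\sigma(a)k}$, $\partial_{bk}\mapsto\partial_{\sigma(b)k}$. Let $\overline{\mathrm{U}(\mathfrak{h})}$ and $\bar{\mathrm{A}}$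 be the rings of fractions of $\mathrm{U}(\mathfrak{h})$ and $\mathrm{A}$ with respect to the denominators $E_{aa}-E_{bb}+z$ ($a\ne b$, $z\in\mathbb{Z}$); the $\mathfrak{S}_m$-action extends to $\bar{\mathrm{A}}$. Elements of $\overline{\mathrm{U}(\mathfrak{h})}$ are regarded as rational functions on $\mathfrak{h}^*$. Let $\mathrm{J}$ be the right ideal of $\mathrm{A}$ generated by $\mathfrak{n}$, and $\bar{\mathrm{J}}=\overline{\mathrm{U}(\mathfrak{h})}\,\mathrm{J}$, a right ideal of $\bar{\mathrm{A}}$. Zhelobenko operators. For $c=1,\ldots,m-1$ define $\xi_c:\mathrm{A}\to\bar{\mathrm{A}}$ by $$\xi_c(Y)=Y+\sum_{s=1}^\infty(s!\,H_c^{(s)})^{-1}E_c^s\,\widehat F_c^{\,s}(Y),\quad H_c^{(s)}=H_c(H_c-1)\cdots(H_c-s+1),\ \ \widehat F_c(Y)=[F_c,Y]$$ (a finite sum for each $Y$). Define $\bar\xi_c:\bar{\mathrm{A}}\to\bar{\mathrm{J}}\backslash\bar{\mathrm{A}}$ by $\bar\xi_c(XY)=Z\,\xi_c(Y)+\bar{\mathrm{J}}$ for $X\in\overline{\mathrm{U}(\mathfrak{h})}$, $Y\in\mathrm{A}$, where $Z(\mu)=X(\mu+\varepsilon_c)$; it is known that this is well defined and that $\sigma_c(\bar{\mathrm{J}})\subset\ker\bar\xi_c$. The Zhelobenko operator $\check\xi_c:\bar{\mathrm{J}}\backslash\bar{\mathrm{A}}\to\bar{\mathrm{J}}\backslash\bar{\mathrm{A}}$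 is induced by the composition $\bar\xi_c\,\sigma_c$. It is known that $\check\xi_1,\ldots,\check\xi_{m-1}$ satisfy the braid relations. The operators $I_c$ and $I_\sigma$. For $\mu$ with $\mu_a-\mu_b\notin\mathbb{Z}$ ($a\neq b$), let $\mathrm{I}_\mu$ be the left ideal of $\mathrm{A}$ generated by all $E_{ab}$ with $a<b$, all $E_{aa}-\mu_a$ and all $\partial_{bk}$, and $\bar{\mathrm{I}}_\mu=\overline{\mathrm{U}(\mathfrak{h})}\,\mathrm{I}_\mu$, a left ideal of $\bar{\mathrm{A}}$. Then $\bar{\mathrm{A}}/\bar{\mathrm{I}}_\mu$ is identified with $M_\mu\otimes\mathcal{G}(\mathbb{C}^m\otimes\mathbb{C}^n)$ (the class of $Y$ corresponds to $Y\cdot(1_\mu\otimes1)$), and $\bar{\mathrm{J}}\backslash\bar{\mathrm{A}}/\bar{\mathrm{I}}_\mu:=\bar{\mathrm{A}}/(\bar{\mathrm{J}}+\bar{\mathrm{I}}_\mu)$ with $(M_\mu\otimes\mathcal{G}(\mathbb{C}^m\otimes\mathbb{C}^n))_{\mathfrak{n}}$. It is known that $\check\xi_c$ induces a linear map $\bar{\mathrm{J}}\backslash\bar{\mathrm{A}}/\bar{\mathrm{I}}_\mu\to\bar{\mathrm{J}}\backslash\bar{\mathrm{A}}/\bar{\mathrm{I}}_{\sigma_c\circ\mu}$, and that under these identifications it restricts to a map of weight spaces $$I_c:\ (M_\mu\otimes\mathcal{G}(\mathbb{C}^m\otimes\mathbb{C}^n))_{\mathfrak{n}}^{\lambda}\to(M_{\sigma_c\circ\mu}\otimes\mathcal{G}(\mathbb{C}^m\otimes\mathbb{C}^n))_{\mathfrak{n}}^{\sigma_c\circ\lambda}.$$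 For a reduced decomposition $\sigma=\sigma_{c_1}\cdots\sigma_{c_K}$ in $\mathfrak{S}_m$ put $I_\sigma=I_{c_1}\cdots I_{c_K}$ (with $I_{c_K}$ applied first), a map $(M_\mu\otimes\mathcal{G})_{\mathfrak{n}}^{\lambda}\to(M_{\sigma\circ\mu}\otimes\mathcal{G})_{\mathfrak{n}}^{\sigma\circ\lambda}$; it does not depend on the reduced decomposition. The vectors $v_\mu^\lambda$. For $\nu=\lambda-\mu$ with labels $\nu_1,\ldots,\nu_m\in\{0,1,\ldots,n\}$ put $$w_\nu=(x_{11}\cdots x_{1\nu_1})\cdots(x_{m1}\cdots x_{m\nu_m})\in\mathcal{G}(\mathbb{C}^m\otimes\mathbb{C}^n),$$ and let $v_\mu^\lambda$ be the image of $1_\mu\otimes w_\nu$ in $(M_\mu\otimes\mathcal{G}(\mathbb{C}^m\otimes\mathbb{C}^n))_{\mathfrak{n}}^\lambda$. The vector $v_{\sigma\circ\mu}^{\sigma\circ\lambda}$ is defined in the same way from the weights $\sigma\circ\mu$, $\sigma\circ\lambda$, whose difference is $\sigma(\nu)$. *)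

(* Defs.v *)
From HB Require Import structures.
From mathcomp Require Import all_boot all_order all_fingroup all_algebra.
From mathcomp Require Import generic_quotient ring_quotient mpoly.
From mathcomp Require Import boolp classical_sets functions cardinality fsbigop.
From mathcomp Require Import reals complex.

Set Implicit Arguments.
Unset Strict Implicit.
Unset Printing Implicit Defensive.

Import GRing.Theory Num.Theory.
Import Quotient.

Local Open Scope ring_scope.
Local Open Scope quotient_scope.

(* Unital associative F-algebras given by generators and relations.           *)

Inductive term (F : fieldType) (I : Type) : Type :=
| Gen of I
| Cst of F
| Add of term F I & term F I
| Mul of term F I & term F I.
Arguments Gen {F I}.
Arguments Cst {F I}.

HB.instance Definition _ (F : fieldType) I := gen_eqMixin (term F I).
HB.instance Definition _ (F : fieldType) I := gen_choiceMixin (term F I).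

Definition Sub (F : fieldType) I (t u : term F I) := Add t (Mul (Cst (-1)) u).
Definition Com (F : fieldType) I (t u : term F I) := Sub (Mul t u) (Mul u t).

Fixpoint tmap (F : fieldType) I J (f : I -> J) (t : term F I) : term F J :=
  match t with
  | Gen i => Gen (f i)
  | Cst c => Cst c
  | Add t u => Add (tmap f t) (tmap f u)
  | Mul t u => Mul (tmap f t) (tmap f u)
  end.

(* The operator by which t acts on V when each generator i acts by f i.       *)
Fixpoint tact (F : fieldType) I (V : lmodType F) (f : I -> V -> V)
    (t : term F I) (v : V) : V :=
  match t with
  | Gen i => f i v
  | Cst c => c *: v
  | Add t u => tact f t v + tact f u v
  | Mul t u => tact f t (tact f u v)
  end.

Inductive cong (F : fieldType) I (rel : term F I -> term F I -> Prop) :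
    term F I -> term F I -> Prop :=
| cong_rel t u : rel t u -> cong rel t u
| cong_refl t : cong rel t t
| cong_sym t u : cong rel t u -> cong rel u t
| cong_trans u t v : cong rel t u -> cong rel u v -> cong rel t v
| congD t t' u u' :
    cong rel t t' -> cong rel u u' -> cong rel (Add t u) (Add t' u')
| congM t t' u u' :
    cong rel t t' -> cong rel u u' -> cong rel (Mul t u) (Mul t' u')
| cong_addA t u v : cong rel (Add t (Add u v)) (Add (Add t u) v)
| cong_addC t u : cong rel (Add t u) (Add u t)
| cong_add0 t : cong rel (Add (Cst 0) t) t
| cong_addN t : cong rel (Add (Mul (Cst (-1)) t) t) (Cst 0)
| cong_mulA t u v : cong rel (Mul t (Mul u v)) (Mul (Mul t u) v)
| cong_mul1l t : cong rel (Mul (Cst 1) t) t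
| cong_mul1r t : cong rel (Mul t (Cst 1)) t
| cong_mulDl t u v : cong rel (Mul (Add t u) v) (Add (Mul t v) (Mul u v))
| cong_mulDr t u v : cong rel (Mul t (Add u v)) (Add (Mul t u) (Mul t v))
| cong_cstD a b : cong rel (Add (Cst a) (Cst b)) (Cst (a + b))
| cong_cstM a b : cong rel (Mul (Cst a) (Cst b)) (Cst (a * b))
| cong_cstC a t : cong rel (Mul (Cst a) t) (Mul t (Cst a)).

Section Presented.
Variables (F : fieldType) (I : Type) (rel : term F I -> term F I -> Prop).

Definition congb (t u : term F I) : bool := `[< cong rel t u >].

Lemma congb_equiv : equiv_class_of congb.
Proof.
split=> [t|t u|u t v].
- exact/asboolP/cong_refl.
- by apply/asboolP/asboolP => /cong_sym.
- by move=> /asboolP tu /asboolP uv; apply/asboolP/(cong_trans tu).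
Qed.

Canonical congb_equiv_rel := EquivRelPack congb_equiv.
Canonical congb_encModRel := defaultEncModRel congb.

Definition presalg := {eq_quot congb}.
HB.instance Definition _ := Choice.on presalg.
HB.instance Definition _ : EqQuotient _ congb presalg := EqQuotient.on presalg.

Definition pcls (t : term F I) : presalg := \pi_presalg t.

Lemma pclsP t u : cong rel t u -> pcls t = pcls u.
Proof. by move=> tu; apply/eqmodP/asboolP. Qed.

Lemma repr_pcls t : cong rel (repr (pcls t)) t.
Proof. by have /eqmodP/asboolP := reprK (pcls t). Qed.

Lemma pclsK x : pcls (repr x) = x. Proof. exact: reprK. Qed.

Definition padd (x y : presalg) := pcls (Add (repr x) (repr y)).
Definition pmul (x y : presalg) := pcls (Mul (repr x) (repr y)).
Definition popp (x : presalg) := pcls (Mul (Cst (-1)) (repr x)).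
Definition pscale (c : F) (x : presalg) := pcls (Mul (Cst c) (repr x)).

Lemma pclsD t u : pcls (Add t u) = padd (pcls t) (pcls u).
Proof. by apply/esym/pclsP/congD; exact: repr_pcls. Qed.
Lemma pclsM t u : pcls (Mul t u) = pmul (pcls t) (pcls u).
Proof. by apply/esym/pclsP/congM; exact: repr_pcls. Qed.
Lemma popp_pcls t : popp (pcls t) = pcls (Mul (Cst (-1)) t).
Proof. by apply/pclsP/congM; [exact: cong_refl|exact: repr_pcls]. Qed.
Lemma pscale_pcls c t : pscale c (pcls t) = pcls (Mul (Cst c) t).
Proof. by apply/pclsP/congM; [exact: cong_refl|exact: repr_pcls]. Qed.

Lemma paddA : associative padd.
Proof.
move=> x y z; rewrite -(pclsK x) -(pclsK y) -(pclsK z) -!pclsD.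
exact/pclsP/cong_addA.
Qed.
Lemma paddC : commutative padd.
Proof. by move=> x y; exact/pclsP/cong_addC. Qed.
Lemma padd0 : left_id (pcls (Cst 0)) padd.
Proof. by move=> x; rewrite -(pclsK x) -pclsD; exact/pclsP/cong_add0. Qed.
Lemma paddN : left_inverse (pcls (Cst 0)) popp padd.
Proof.
by move=> x; rewrite -(pclsK x) popp_pcls -pclsD; exact/pclsP/cong_addN.
Qed.
HB.instance Definition _ :=
  GRing.isZmodule.Build presalg paddA paddC padd0 paddN.

Lemma pcls_add t u : pcls (Add t u) = pcls t + pcls u.
Proof. exact: pclsD. Qed.

Lemma pmulA : associative pmul.
Proof.
move=> x y z; rewrite -(pclsK x) -(pclsK y) -(pclsK z) -!pclsM.
exact/pclsP/cong_mulA.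
Qed.
Lemma pmul1l : left_id (pcls (Cst 1)) pmul.
Proof. by move=> x; rewrite -(pclsK x) -pclsM; exact/pclsP/cong_mul1l. Qed.
Lemma pmul1r : right_id (pcls (Cst 1)) pmul.
Proof. by move=> x; rewrite -(pclsK x) -pclsM; exact/pclsP/cong_mul1r. Qed.
Lemma pmulDl : left_distributive pmul +%R.
Proof.
move=> x y z; rewrite -(pclsK x) -(pclsK y) -(pclsK z) -pcls_add -!pclsM -pcls_add.
exact/pclsP/cong_mulDl.
Qed.
Lemma pmulDr : right_distributive pmul +%R.
Proof.
move=> x y z; rewrite -(pclsK x) -(pclsK y) -(pclsK z) -pcls_add -!pclsM -pcls_add.
exact/pclsP/cong_mulDr.
Qed.
HB.instance Definition _ :=
  GRing.Zmodule_isPzRing.Build presalg pmulA pmul1l pmul1r pmulDl pmulDr.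

Lemma pscaleA a b v : pscale a (pscale b v) = pscale (a * b) v.
Proof.
rewrite -(pclsK v) !pscale_pcls; apply/pclsP.
apply: (cong_trans (cong_mulA _ _ _ _)); apply: congM (cong_refl _ _).
exact: cong_cstM.
Qed.
Lemma pscale1 : left_id 1 pscale.
Proof. by move=> v; rewrite -(pclsK v) pscale_pcls; exact/pclsP/cong_mul1l. Qed.
Lemma pscaleDr : right_distributive pscale +%R.
Proof.
move=> a x y; rewrite -(pclsK x) -(pclsK y) -pcls_add !pscale_pcls -pcls_add.
exact/pclsP/cong_mulDr.
Qed.
Lemma pscaleDl v : {morph pscale^~ v : a b / a + b}.
Proof.
move=> a b; rewrite -(pclsK v) !pscale_pcls -pcls_add; apply/pclsP.
apply: (cong_trans _ (cong_mulDl _ _ _ _)); apply: congM (cong_refl _ _).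
exact/cong_sym/cong_cstD.
Qed.
HB.instance Definition _ :=
  GRing.Zmodule_isLmodule.Build F presalg pscaleA pscale1 pscaleDr pscaleDl.

End Presented.

Section Grassmann.
Variables (F : fieldType) (m n : nat).

Definition gidx : finType := ('I_m * 'I_n)%type.

(* f : grass is the sum of the f S e_S over S, where e_S is the product of the
   variables indexed by S in increasing order for enum_rank. *)
Definition grass := {ffun {set gidx} -> F^o}.

Definition gbase (S : {set gidx}) : grass := [ffun T => (T == S)%:R].

(* e_S e_T = gsign S T e_(S :|: T) for disjoint S and T *)
Definition gsign (S T : {set gidx}) : F :=
  (-1) ^+ #|[set p : gidx * gidx |
             [&& p.1 \in S, p.2 \in T & (enum_rank p.2 < enum_rank p.1)%N]]|.

Definition gmul (f g : grass) : grass :=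
  [ffun S : {set gidx} => \sum_(T : {set gidx} | T \subset S)
     gsign T (S :\: T) * f T * g (S :\: T)].

Definition gone : grass := gbase finset.set0.
Definition gvar (a : 'I_m) (k : 'I_n) : grass := gbase [set (a, k)].

(* Left derivation: it sends e_(i |: S) to gsign [set i] S e_S for i not in S,
   and e_S to 0. *)
Definition gder (a : 'I_m) (k : 'I_n) (f : grass) : grass :=
  [ffun S : {set gidx} => if (a, k) \in S then 0
                          else gsign [set (a, k)] S * f ((a, k) |: S)].

Inductive gdgen := GX of 'I_m & 'I_n | GD of 'I_m & 'I_n.

Definition gdgen_act (g : gdgen) : grass -> grass :=
  match g with GX a k => gmul (gvar a k) | GD a k => gder a k end.

Definition gd_act : term F gdgen -> grass -> grass := tact gdgen_act.

Definition gamma (a b : 'I_m) : term F gdgen :=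
  foldr (@Add F gdgen) (Cst 0)
    [seq Mul (Gen (GX a k)) (Gen (GD b k)) | k <- enum 'I_n].

(* (x_11 ... x_(1 nu_1)) ... (x_m1 ... x_(m nu_m)) *)
Definition wvec (nu : 'I_m -> nat) : grass :=
  foldr gmul gone
    [seq gvar a k | a <- enum 'I_m, k <- enum [pred k : 'I_n | (k < nu a)%N]].

End Grassmann.

Local Open Scope classical_set_scope.

(* Generated subgroups and submodules, and the quotients by them.             *)

Inductive gen_subgroup (V : zmodType) (S : set V) : V -> Prop :=
| gs0 : gen_subgroup S 0
| gs_mem v : S v -> gen_subgroup S v
| gsB v w : gen_subgroup S v -> gen_subgroup S w -> gen_subgroup S (v - w).

Definition zspan (V : zmodType) (S : set V) : {pred V} :=
  fun v => `[< gen_subgroup S v >].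

Lemma zspan_closed (V : zmodType) (S : set V) : zmod_closed (zspan S).
Proof.
split; first exact/asboolP/gs0.
by move=> v w /asboolP Sv /asboolP Sw; exact/asboolP/gsB.
Qed.
HB.instance Definition _ (V : zmodType) (S : set V) :=
  GRing.isZmodClosed.Build V (zspan S) (zspan_closed S).

Definition scaled (F : fieldType) (V : lmodType F) (S : set V) : set V :=
  [set v | exists c w, S w /\ v = c *: w].

Lemma zspan_scaled (F : fieldType) (V : lmodType F) (S : set V) c v :
  v \in zspan (scaled S) -> c *: v \in zspan (scaled S).
Proof.
move/asboolP; elim => [|{}v [d [w [Sw ->]]]|{}v w _ /asboolP Sv _ /asboolP Sw].
- by rewrite scaler0; exact/asboolP/gs0.
- by apply/asboolP/gs_mem; exists (c * d), w; rewrite scalerA.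
- by rewrite scalerBr; exact/asboolP/gsB.
Qed.

(* V / (submodule generated by S) *)
Definition quotmod (F : fieldType) (V : lmodType F) (S : set V) :=
  {quot zspan (scaled S)}.

Section QuotMod.
Variables (F : fieldType) (V : lmodType F) (S : set V).
Local Notation Q := (quotmod S).

HB.instance Definition _ := GRing.Zmodule.on Q.
HB.instance Definition _ : EqQuotient V (equiv (zspan (scaled S))) Q :=
  EqQuotient.on Q.

Definition qcls (v : V) : Q := \pi_Q v.

Definition qscale (c : F) (x : Q) : Q := qcls (c *: repr x).

Lemma qscale_qcls c v : qscale c (qcls v) = qcls (c *: v).
Proof.
apply/eqP; rewrite /qscale /qcls -[_ == _]idealrBE -scalerBr zspan_scaled //.
by rewrite [_ \in _]idealrBE; apply/eqP; exact: reprK.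
Qed.

Lemma qclsK x : qcls (repr x) = x. Proof. exact: reprK. Qed.

Lemma qclsD v w : qcls (v + w) = qcls v + qcls w.
Proof. exact: (raddfD \pi_({quot zspan (scaled S)})). Qed.

Lemma qscaleA a b x : qscale a (qscale b x) = qscale (a * b) x.
Proof. by rewrite -(qclsK x) !qscale_qcls scalerA. Qed.
Lemma qscale1 : left_id 1 qscale.
Proof. by move=> x; rewrite -(qclsK x) qscale_qcls scale1r. Qed.
Lemma qscaleDr : right_distributive qscale +%R.
Proof.
move=> a x y; rewrite -(qclsK x) -(qclsK y) -qclsD !qscale_qcls.
by rewrite scalerDr qclsD.
Qed.
Lemma qscaleDl x : {morph qscale^~ x : a b / a + b}.
Proof. by move=> a b; rewrite -(qclsK x) !qscale_qcls scalerDl qclsD. Qed.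
HB.instance Definition _ :=
  GRing.Zmodule_isLmodule.Build F Q qscaleA qscale1 qscaleDr qscaleDl.

End QuotMod.

(* Spanning sets of the left and right ideals generated by S.                 *)
Definition lmults (R : pzRingType) (S : set R) : set R :=
  [set y | exists r s, S s /\ y = r * s].
Definition rmults (R : pzRingType) (S : set R) : set R :=
  [set y | exists r s, S s /\ y = s * r].

(* theta : R -> Q is a (left) ring of fractions of R with denominators S.     *)
Definition ring_of_fractions (R : pzRingType) (Q : unitRingType)
    (theta : R -> Q) (S : set R) : Prop :=
  [/\ forall s, S s -> theta s \is a GRing.unit,
      forall q, exists s r, S s /\ q = (theta s)^-1 * theta r
    & forall r, theta r = 0 <-> exists s, S s /\ s * r = 0].

Section Algebras.
Variables (F : fieldType) (m n : nat).

Inductive Urel : term F ('I_m * 'I_m) -> term F ('I_m * 'I_m) -> Prop :=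
| Urel_gl a b c d :
    Urel (Com (Gen (a, b)) (Gen (c, d)))
         (Sub (Mul (Cst (b == c)%:R) (Gen (a, d)))
              (Mul (Cst (a == d)%:R) (Gen (c, b)))).

(* U(gl_m) *)
Definition Ugl := presalg Urel.
HB.instance Definition _ := GRing.Lmodule.on Ugl.
HB.instance Definition _ := GRing.PzRing.on Ugl.
Definition UE (a b : 'I_m) : Ugl := pcls Urel (Gen (a, b)).

Inductive agen := AE of 'I_m & 'I_m | AG of gdgen m n.

(* The terms in the x_ak and the partial_ak, taken up to equality of the
   operators they induce, form the algebra GD of operators generated by the
   x_ak and the partial_ak, which is the ring of all endomorphisms of the
   Grassmann algebra. *)
Inductive Arel : term F agen -> term F agen -> Prop :=
| Arel_gl a b c d :
    Arel (Com (Gen (AE a b)) (Gen (AE c d)))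
         (Sub (Mul (Cst (b == c)%:R) (Gen (AE a d)))
              (Mul (Cst (a == d)%:R) (Gen (AE c b))))
| Arel_GD t u : gd_act t =1 gd_act u -> Arel (tmap AG t) (tmap AG u)
| Arel_cross a b t :
    Arel (Com (Gen (AE a b)) (tmap AG t))
         (Com (tmap AG (gamma F n a b)) (tmap AG t)).

Definition Aalg := presalg Arel.
HB.instance Definition _ := GRing.Lmodule.on Aalg.
HB.instance Definition _ := GRing.PzRing.on Aalg.
Definition aE (a b : 'I_m) : Aalg := pcls Arel (Gen (AE a b)).
Definition aX (a : 'I_m) (k : 'I_n) : Aalg := pcls Arel (Gen (AG (GX a k))).
Definition aD (a : 'I_m) (k : 'I_n) : Aalg := pcls Arel (Gen (AG (GD a k))).

Definition agen_perm (s : 'S_m) (i : agen) : agen :=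
  match i with
  | AE a b => AE (s a) (s b)
  | AG (GX a k) => AG (GX (s a) k)
  | AG (GD a k) => AG (GD (s a) k)
  end.

(* the action of the symmetric group on A by automorphisms *)
Definition alg_perm (s : 'S_m) (Y : Aalg) : Aalg :=
  pcls Arel (tmap (agen_perm s) (repr Y)).

Definition weight := {ffun 'I_m -> F}.

Definition rho : weight := [ffun a : 'I_m => - (a : nat)%:R].
Definition wperm (s : 'S_m) (mu : weight) : weight :=
  [ffun a => mu ((s^-1)%g a)].
Definition wdot (s : 'S_m) (mu : weight) : weight := wperm s (mu + rho) - rho.

(* The simple reflections are indexed by c < m.-1; cL c and cR c are the
   indices c and c + 1. *)
Lemma cL_proof (c : 'I_m.-1) : (c < m)%N.
Proof. by have := ltn_ord c; case: m c => [|k] c //= ck; apply: ltnW. Qed.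
Lemma cR_proof (c : 'I_m.-1) : (c.+1 < m)%N.
Proof. by have := ltn_ord c; case: m c. Qed.
Definition cL (c : 'I_m.-1) : 'I_m := Ordinal (cL_proof c).
Definition cR (c : 'I_m.-1) : 'I_m := Ordinal (cR_proof c).
Definition srefl (c : 'I_m.-1) : 'S_m := tperm (cL c) (cR c).

Definition eps (c : 'I_m.-1) : weight :=
  [ffun a => (a == cL c)%:R - (a == cR c)%:R].

Definition Ec (c : 'I_m.-1) : Aalg := aE (cL c) (cR c).
Definition Fc (c : 'I_m.-1) : Aalg := aE (cR c) (cL c).
Definition Hc (c : 'I_m.-1) : Aalg := aE (cL c) (cL c) - aE (cR c) (cR c).

Definition adF (c : 'I_m.-1) (Y : Aalg) : Aalg := Fc c * Y - Y * Fc c.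

(* U(h) is the algebra of polynomial functions on h^*; 'X_a is E_aa. *)
Definition uh (p : {mpoly F[m]}) : Aalg :=
  \sum_(k <- msupp p) p@_k *: \prod_(a < m) aE a a ^+ k a.

(* X |-> X(mu + eps c) *)
Definition uh_shift (c : 'I_m.-1) (p : {mpoly F[m]}) : {mpoly F[m]} :=
  p \mPo [tuple 'X_a + (eps c a)%:MP | a < m].

(* products of the E_aa - E_bb + z with a != b and z an integer *)
Definition denoms : set {mpoly F[m]} :=
  [set p | exists l : seq ('I_m * 'I_m * int),
     all (fun i => i.1.1 != i.1.2) l /\
     p = \prod_(i <- l) ('X_(i.1.1) - 'X_(i.1.2) + (i.2%:~R)%:MP)].

Definition Jideal : set Aalg :=
  gen_subgroup (rmults [set Y | exists a b : 'I_m, (b < a)%N /\ Y = aE a b]).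

Definition Iideal (mu : weight) : set Aalg :=
  gen_subgroup (lmults
    ([set Y | exists a b : 'I_m, (a < b)%N /\ Y = aE a b] `|`
     [set Y | exists a, Y = aE a a - mu a *: (1 : Aalg)] `|`
     [set Y | exists b k, Y = aD b k])).

(* Verma modules: M_mu is U(gl_m) modulo a left ideal. *)
Definition verma (mu : weight) :=
  quotmod (lmults
    ([set u : Ugl | exists a b : 'I_m, (a < b)%N /\ u = UE a b] `|`
     [set u : Ugl | exists a, u = UE a a - mu a *: (1 : Ugl)])).
HB.instance Definition _ mu := GRing.Lmodule.on (verma mu).
Definition verma1 (mu : weight) : verma mu := qcls _ (1 : Ugl).
Definition uact (mu : weight) (u : Ugl) (x : verma mu) : verma mu :=
  qcls _ (u * repr x).

(* The tensor product of M_mu with the Grassmann algebra: f stands for the sum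
   of the f S (x) e_S over S. *)
Definition vtens (mu : weight) := {ffun {set gidx m n} -> verma mu}.
HB.instance Definition _ mu := GRing.Lmodule.on (vtens mu).
Definition tens (mu : weight) (x : verma mu) (g : grass F m n) : vtens mu :=
  [ffun S => g S *: x].

(* u (x) 1 and 1 (x) T *)
Definition tensl (mu : weight) (u : Ugl) (t : vtens mu) : vtens mu :=
  [ffun S => uact u (t S)].
Definition tensr (mu : weight) (T : grass F m n -> grass F m n)
    (t : vtens mu) : vtens mu :=
  \sum_(S : {set gidx m n}) tens (t S) (T (gbase F S)).

(* E_ab acts diagonally, as E_ab (x) 1 + 1 (x) gamma(E_ab). *)
Definition agen_act (mu : weight) (i : agen) (t : vtens mu) : vtens mu :=
  match i with
  | AE a b => tensl (UE a b) t + tensr (gd_act (gamma F n a b)) t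
  | AG g => tensr (gdgen_act g) t
  end.

Definition aact (mu : weight) (Y : Aalg) : vtens mu -> vtens mu :=
  tact (@agen_act mu) (repr Y).

(* (M_mu (x) G)_n *)
Definition coinv (mu : weight) :=
  quotmod [set t : vtens mu |
    exists (a b : 'I_m) t', (b < a)%N /\ t = agen_act (AE a b) t'].

HB.instance Definition _ mu := GRing.Lmodule.on (coinv mu).

(* the class of Y (1_mu (x) 1) *)
Definition coinv_of (mu : weight) (Y : Aalg) : coinv mu :=
  qcls _ (aact Y (tens (verma1 mu) (gone F m n))).

(* the natural number k such that z = k *)
Definition nat_label (z : F) : nat := xget 0%N [set k | z = k%:R].

Definition vvec (mu lambda : weight) : coinv mu :=
  qcls _ (tens (verma1 mu)
               (wvec F n (fun a => nat_label (lambda a - mu a)))).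

Section Zhelobenko.
Variables (Abar : unitRingType) (theta : {rmorphism Aalg -> Abar}).

(* p / s as an element of the ring of fractions of U(h) *)
Definition ufrac (p s : {mpoly F[m]}) : Abar :=
  (theta (uh s))^-1 * theta (uh p).

Definition ufracs (B : set Aalg) : set Abar :=
  [set y | exists p s b, [/\ denoms s, B b & y = ufrac p s * theta b]].

Definition Jbar : set Abar := gen_subgroup (ufracs Jideal).
Definition Ibar (mu : weight) : set Abar := gen_subgroup (ufracs (Iideal mu)).

(* Jbar \ Abar and Jbar \ Abar / Ibar_mu *)
Definition JA := {quot zspan Jbar}.
Definition JAI (mu : weight) := {quot zspan (Jbar `|` Ibar mu)}.

(* A map that is determined by its values on fractions, or that is induced on a
   quotient, is defined below by evaluation at a chosen fraction or
   representative; the choice is known not to matter. *)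

(* the extension to Abar of the action on A *)
Definition abar_perm (s : 'S_m) (y : Abar) : Abar :=
  xget 0 [set z | exists d Y, [/\ denoms d,
    y = (theta (uh d))^-1 * theta Y
    & z = (theta (alg_perm s (uh d)))^-1 * theta (alg_perm s Y)]].

(* The sum over s has finitely many nonzero terms. *)
Definition xi (c : 'I_m.-1) (Y : Aalg) : Abar :=
  theta Y + \sum_(s \in [set s | (1 <= s)%N])
    (theta ((s`!)%:R * \prod_(0 <= j < s) (Hc c - j%:R)))^-1
      * theta (Ec c ^+ s * iter s (adF c) Y).

(* XY |-> Z xi_c(Y) + Jbar, where Z(mu) = X(mu + eps c) *)
Definition xibar (c : 'I_m.-1) (y : Abar) : JA :=
  xget 0 [set w | exists p s Y, [/\ denoms s, y = ufrac p s * theta Y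
    & w = \pi_JA (ufrac (uh_shift c p) (uh_shift c s) * xi c Y)]].

Definition xicheck (c : 'I_m.-1) (u : JA) : JA :=
  xibar c (abar_perm (srefl c) (repr u)).

(* the map that xicheck c induces on double cosets *)
Definition xidouble (c : 'I_m.-1) (mu : weight) (u : JAI mu) :
    JAI (wdot (srefl c) mu) :=
  \pi_(JAI (wdot (srefl c) mu)) (repr (xicheck c (\pi_JA (repr u)))).

(* The identification of Jbar \ Abar / Ibar_mu with (M_mu (x) G)_n, in both
   directions: the class of Y in A corresponds to that of Y (1_mu (x) 1). *)
Definition to_double (mu : weight) (u : coinv mu) : JAI mu :=
  \pi_(JAI mu) (theta (xget 0 [set Y | coinv_of mu Y = u])).
Definition of_double (mu : weight) (w : JAI mu) : coinv mu :=
  coinv_of mu (xget 0 [set Y | \pi_(JAI mu) (theta Y) = w]).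

Definition Iop (c : 'I_m.-1) (mu : weight) (u : coinv mu) :
    coinv (wdot (srefl c) mu) :=
  of_double (xidouble c (to_double u)).

(* I_c1 ... I_cK, acting on the disjoint union of the spaces (M_mu (x) G)_n *)
Definition Iword (cs : seq 'I_m.-1) (u : {mu : weight & coinv mu}) :
    {mu : weight & coinv mu} :=
  foldr (fun c v => Tagged coinv (Iop c (tagged v))) u cs.

End Zhelobenko.

(* The composite srefl c1 \o ... \o srefl cK; products of permutations in the
   library compose from left to right. *)
Definition word_perm (cs : seq 'I_m.-1) : 'S_m :=
  (\prod_(c <- rev cs) srefl c)%g.

Definition reduced_decomposition (cs : seq 'I_m.-1) (s : 'S_m) : Prop :=
  word_perm cs = s /\
  forall cs', word_perm cs' = s -> (size cs <= size cs')%N.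

Definition kappa (mu lambda : weight) (a b : 'I_m) : F :=
  if (nat_label (lambda a - mu a) < nat_label (lambda b - mu b))%N then
    (lambda a - lambda b - (a : nat)%:R + (b : nat)%:R) /
    (mu a - mu b - (a : nat)%:R + (b : nat)%:R)
  else 1.

End Algebras.

Arguments coinv {F m} n mu.
Arguments vvec {F m} n mu lambda.
Arguments uh {F m} n p.

(* Main.v *)
(* M_mu (x) G is A / I_mu through Y |-> Y (1_mu (x) 1), and on weight vectors a
   denominator of U(h) acts by nonzero scalars because mu is generic; so
   (M_mu (x) G)_n is the double coset space, and I_c applied to the class of Y is
   the class of xi_c (sigma_c Y) modulo Jbar + Ibar.  That xi_c respects these
   ideals is an sl_2 computation: multiplying the series by H, E or F on either
   side produces telescoping sums.
   For one reflection, sigma_c permutes the blocks of w_nu up to the sign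
   (-1)^(nu_c nu_(c+1)).  If nu_c >= nu_(c+1), ad F_c kills the permuted vector
   and the series reduces to its first term.  Otherwise ad E_c kills it, so it is
   a highest weight vector of weight d = nu_(c+1) - nu_c for sl_2, the s-th term
   becomes a scalar, and the series sums to
     sum_s prod_(j < s) (d - j) / (h - j) = (h + 1) / (h - d + 1),
   which is kappa_(c,c+1).  Along a reduced word each letter adds exactly one
   inversion (a, b), and the factor for the weights reached so far is the one
   attached to (a, b) in the original weights. *)

Require Import Defs.
From HB Require Import structures.
From mathcomp Require Import all_boot all_order all_fingroup all_algebra.
From mathcomp Require Import generic_quotient ring_quotient ring zify.
From mathcomp Require Import mpoly.
From mathcomp Require Import boolp classical_sets cardinality fsbigop reals complex.
Import GRing.Theory Num.Theory.
Local Open Scope ring_scope.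
Local Open Scope classical_set_scope.

Set Implicit Arguments.
Unset Strict Implicit.
Unset Printing Implicit Defensive.

(** * Algebras given by generators and relations, and their actions *)

Section Presented.
Variables (F : fieldType) (I : Type) (rel : term F I -> term F I -> Prop).

(** The operators of the statement are evaluated at chosen fractions and representatives, so each
    computation must hold for every choice. [Iop_coinv_of] absorbs the choices: to know I_c on the
    class of Y, it suffices to find Z in A with xi_c(sigma_c Y) congruent to Z modulo Jbar + Ibar
    ([JIbar]). The obstacle is that this sum of a right and a left ideal is only a subgroup, stable
    under left multiplication by fractions of U(h). Hence fractions are compared by multiplying by
    denominators until the relation lies in A, applying sigma_c and xi_c there, and cancelling the
    shifted denominators, which are again units. Back in (M_mu (x) G)_n a denominator is cancelled
    by genericity. That A / I_mu embeds in M_mu (x) G is shown by a left inverse, built from the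
    homomorphism E_ab -> E_ab - gamma(E_ab) of U(gl_m) to A, whose image commutes with GD. The sl_2
    sums are computed for abstract e, f, h and coefficients modulo a subgroup, so that the same
    lemmas serve Jbar and Jbar + Ibar. All rest on one congruence: a_(s+1) e^(s+1) f z is a_s e^s z
    modulo terms with f on the left. *)

Lemma tact_linear (V : lmodType F) (f : I -> V -> V) :
  (forall i, linear (f i)) -> forall t, linear (tact f t).
Proof.
move=> lf; elim=> [i|c|t IHt u IHu|t IHt u IHu] a v w /=.
- exact: lf.
- by rewrite scalerDr !scalerA mulrC.
- by rewrite IHt IHu scalerDr addrACA.
- by rewrite IHu IHt.
Qed.

Section LinearFun.
Variables (V W : lmodType F) (f : V -> W).
Hypothesis lf : linear f.
Lemma linear_fun0 : f 0 = 0.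
Proof.
have := lf (-1) 0 0; rewrite scaler0 addr0 scaleN1r addrC => /eqP.
by rewrite subrr => /eqP.
Qed.
Lemma linear_funD v w : f (v + w) = f v + f w.
Proof. by have := lf 1 v w; rewrite !scale1r. Qed.
Lemma linear_funZ c v : f (c *: v) = c *: f v.
Proof. by have := lf c v 0; rewrite linear_fun0 !addr0. Qed.
Lemma linear_funN v : f (- v) = - f v.
Proof. by rewrite -scaleN1r linear_funZ scaleN1r. Qed.
Lemma linear_funB v w : f (v - w) = f v - f w.
Proof. by rewrite linear_funD linear_funN. Qed.
Lemma linear_fun_sum J (r : seq J) P (g : J -> V) :
  f (\sum_(i <- r | P i) g i) = \sum_(i <- r | P i) f (g i).
Proof. by apply: (big_morph f); [exact: linear_funD|exact: linear_fun0]. Qed.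
End LinearFun.

Lemma tact_sub (V : lmodType F) (f : I -> V -> V) t u v :
  tact f (Defs.Sub t u) v = tact f t v - tact f u v.
Proof. by rewrite /= scaleN1r. Qed.

Lemma tact_com (V : lmodType F) (f : I -> V -> V) t u v :
  tact f (Com t u) v = tact f t (tact f u v) - tact f u (tact f t v).
Proof. by rewrite tact_sub. Qed.

(** Universal property of the presentation: the algebra axioms among the rules of [cong] hold for
    linear operators, so only [rel] has to be checked. *)
Lemma tact_cong (V : lmodType F) (f : I -> V -> V) :
  (forall i, linear (f i)) ->
  (forall t u, rel t u -> tact f t =1 tact f u) ->
  forall t u, cong rel t u -> tact f t =1 tact f u.
Proof.
move=> lf frel t u; elim=> {t u} //=.
- by move=> t u _ IH v; rewrite IH.
- by move=> u t v _ IH _ IH' w; rewrite IH IH'.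
- by move=> t t' u u' _ IH _ IH' v; rewrite IH IH'.
- by move=> t t' u u' _ IH _ IH' v; rewrite IH' IH.
- by move=> t u v w; rewrite addrA.
- by move=> t u w; rewrite addrC.
- by move=> t v; rewrite scale0r add0r.
- by move=> t v; rewrite scaleN1r addNr scale0r.
- by move=> t v; rewrite scale1r.
- by move=> t v; rewrite scale1r.
- by move=> t u v w; rewrite (linear_funD (tact_linear lf t)).
- by move=> a b v; rewrite scalerDl.
- by move=> a b v; rewrite scalerA.
- by move=> a t v; rewrite (linear_funZ (tact_linear lf t)).
Qed.

(** Actions of a presented algebra are defined through [repr]; this allows computing them on any
    term of the class. *)
Lemma tact_pcls (V : lmodType F) (f : I -> V -> V) :
  (forall i, linear (f i)) ->
  (forall t u, rel t u -> tact f t =1 tact f u) ->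
  forall t, tact f (repr (pcls rel t)) =1 tact f t.
Proof. by move=> lf frel t; apply/(tact_cong lf frel)/repr_pcls. Qed.

Lemma pcls_mul t u : pcls rel (Mul t u) = pcls rel t * pcls rel u.
Proof. exact: pclsM. Qed.

Lemma pcls1 : pcls rel (Cst 1) = 1.
Proof. by []. Qed.

Lemma pcls_scale c t : c *: pcls rel t = pcls rel (Mul (Cst c) t).
Proof. exact: pscale_pcls. Qed.

Lemma pcls_cst c : pcls rel (Cst c) = c *: (1 : presalg rel).
Proof. by rewrite -pcls1 pcls_scale; apply/pclsP/cong_sym/cong_mul1r. Qed.

Lemma presalg_scaleAl c (x y : presalg rel) : c *: (x * y) = (c *: x) * y.
Proof.
rewrite -(pclsK x) -(pclsK y) -pcls_mul !pcls_scale -pcls_mul.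
exact/pclsP/cong_mulA.
Qed.

Lemma presalg_scaleAr c (x y : presalg rel) : c *: (x * y) = x * (c *: y).
Proof.
rewrite -(pclsK x) -(pclsK y) -pcls_mul !pcls_scale -pcls_mul; apply/pclsP.
apply: (cong_trans (cong_mulA _ _ _ _)).
apply: (cong_trans (congM (cong_cstC _ _ _) (cong_refl _ _))).
exact/cong_sym/cong_mulA.
Qed.

Lemma pcls_sub t u : pcls rel (Defs.Sub t u) = pcls rel t - pcls rel u.
Proof. by rewrite pcls_add -pcls_scale scaleN1r. Qed.

Lemma pcls_com t u :
  pcls rel (Com t u) = pcls rel t * pcls rel u - pcls rel u * pcls rel t.
Proof. by rewrite pcls_sub !pcls_mul. Qed.

Lemma pcls_foldr_add (ts : seq (term F I)) :
  pcls rel (foldr (@Add F I) (Cst 0) ts) = \sum_(t <- ts) pcls rel t.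
Proof.
elim: ts => [|t ts IH] /=; first by rewrite big_nil pcls_cst scale0r.
by rewrite big_cons pcls_add IH.
Qed.

End Presented.

(** * Operators on the Grassmann algebra *)

Section Grassmann.
Variables (F : fieldType) (m n : nat).
Local Notation gidx := (gidx m n).
Local Notation grass := (grass F m n).
Implicit Types (i j p q : gidx) (S T : {set gidx}) (f g : grass).

(** The sign of moving x_i past x_q if they stand in the wrong order, so that [setsign i S] sorts
    x_i into e_S. Written as a product over S instead of a power of a cardinality, the sign is
    multiplicative when an element is added or removed. *)
Definition ordsign i q : F := if (enum_rank q < enum_rank i)%N then -1 else 1.
Definition setsign i S : F := \prod_(q in S) ordsign i q.

Lemma gsign1 i S : gsign F [set i] S = setsign i S.
Proof.
rewrite /gsign /setsign (bigID (fun q => (enum_rank q < enum_rank i)%N)) /=.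
rewrite [X in _ = _ * X]big1 ?mulr1; last first.
  by move=> q /andP[_ qi]; rewrite /ordsign (negbTE qi).
under eq_bigr => q /andP[_ qi] do rewrite /ordsign qi.
rewrite prodr_const; congr (_ ^+ _).
rewrite -[RHS](@card_imset _ _ (pair i)); last by move=> ? ? [].
apply: eq_card => -[p q]; rewrite !inE /=; apply/idP/imsetP.
  by case/and3P => /eqP-> qS qi; exists q => //; rewrite unfold_in qS.
by case=> q' /andP[q'S q'i] [-> ->]; rewrite eqxx q'S.
Qed.

Lemma ordsignC i j : i != j -> ordsign i j = - ordsign j i.
Proof.
rewrite /ordsign -(inj_eq enum_rank_inj) -val_eqE /=.
by case: ltngtP; rewrite ?opprK.
Qed.

Lemma ordsign_sq i j : ordsign i j * ordsign i j = 1.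
Proof. by rewrite /ordsign; case: ifP; rewrite ?mulrNN ?mulr1. Qed.

Lemma setsign_sq i S : setsign i S * setsign i S = 1.
Proof. by rewrite -big_split big1 // => j _; exact: ordsign_sq. Qed.

Lemma setsignD1 i j S : j \in S -> setsign i S = ordsign i j * setsign i (S :\ j).
Proof. by move=> jS; rewrite /setsign (big_setD1 j). Qed.

Lemma setsignU1 i j S : j \notin S ->
  setsign i (j |: S) = ordsign i j * setsign i S.
Proof. by move=> jS; rewrite /setsign big_setU1. Qed.

Definition xop i f : grass := gmul (gvar F i.1 i.2) f.
Definition dop i f : grass := gder i.1 i.2 f.

Lemma grassD f g S : (f + g) S = f S + g S.
Proof. by rewrite ffunE. Qed.
Lemma grassN f S : (- f) S = - f S.
Proof. by rewrite ffunE. Qed.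
Lemma grassZ c f S : (c *: f) S = c * f S.
Proof. by rewrite ffunE. Qed.
Definition grassE := (grassD, grassN, grassZ).

Lemma xopE i f S :
  xop i f S = if i \in S then setsign i (S :\ i) * f (S :\ i) else 0.
Proof.
rewrite /xop ffunE; case: ifP => iS; last first.
  apply: big1 => T TS; rewrite !ffunE -surjective_pairing.
  case: eqP TS => [->|_ _]; last by rewrite mulr0 mul0r.
  by rewrite finset.sub1set iS.
rewrite (bigD1 [set i]%SET) ?finset.sub1set //= big1 ?addr0.
  by rewrite !ffunE -surjective_pairing eqxx mulr1 gsign1.
move=> T /andP[_ /negbTE Ti]; rewrite !ffunE -surjective_pairing.
by rewrite Ti mulr0 mul0r.
Qed.

Lemma dopE i f S :
  dop i f S = if i \in S then 0 else setsign i S * f (i |: S).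
Proof. by rewrite /dop ffunE -surjective_pairing gsign1. Qed.

Lemma xop_linear i : linear (xop i).
Proof.
move=> c f g; apply/ffunP => S; rewrite !(grassE, xopE).
by case: ifP => _; rewrite ?mulr0 ?addr0 // mulrDr mulrCA.
Qed.

Lemma dop_linear i : linear (dop i).
Proof.
move=> c f g; apply/ffunP => S; rewrite !(grassE, dopE).
by case: ifP => _; rewrite ?mulr0 ?addr0 // mulrDr mulrCA.
Qed.

(** Both sides sort i and j into the same remaining set and differ only in the comparison of i with
    j, made once as [ordsign i j] and once as [ordsign j i], which are opposite. The next two lemmas
    use the same comparison. *)
Lemma xop_anti i j f : xop i (xop j f) = - xop j (xop i f).
Proof.
apply/ffunP => S; rewrite !(grassE, xopE) !inE.
have [->|ij] := eqVneq i j.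
  by rewrite /= mulr0 if_same oppr0.
case: (boolP (i \in S)) => iS; case: (boolP (j \in S)) => jS;
  rewrite ?andbF ?mulr0 ?oppr0 //=.
rewrite (@setsignD1 i j (S :\ i)) ?inE 1?eq_sym ?ij //.
rewrite (@setsignD1 j i (S :\ j)) ?inE ?ij ?iS //.
have -> : S :\ j :\ i = S :\ i :\ j by rewrite !finset.setDDl finset.setUC.
by rewrite (ordsignC ij); ring.
Qed.

Lemma dop_anti i j f : dop i (dop j f) = - dop j (dop i f).
Proof.
apply/ffunP => S; rewrite !(grassE, dopE) !inE.
have [->|ij] := eqVneq i j.
  by rewrite /= mulr0 if_same oppr0.
case: (boolP (i \in S)) => iS; case: (boolP (j \in S)) => jS;
  rewrite ?orbT ?mulr0 ?oppr0 //=.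
rewrite !setsignU1 //.
by rewrite (ordsignC ij) finset.setUCA; ring.
Qed.

Lemma dop_xop i j f : dop i (xop j f) = (i == j)%:R *: f - xop j (dop i f).
Proof.
apply/ffunP => S; rewrite !(grassE, dopE, xopE) !inE.
have [->|ij] := eqVneq i j.
  rewrite mul1r /=; case: ifP => jS.
    by rewrite mulrA setsign_sq mul1r finset.setD1K // subrr.
  by rewrite finset.setU1K ?jS // mulrA setsign_sq mul1r subr0.
rewrite mul0r add0r /=.
case: (boolP (i \in S)) => iS; case: (boolP (j \in S)) => jS;
  rewrite ?mulr0 ?oppr0 //=.
have -> : (i |: S) :\ j = i |: (S :\ j).
  apply/setP => q; rewrite !inE; case: (eqVneq q i) => [->|_] //=.
  by rewrite ij.
rewrite (@setsignD1 i j S) // setsignU1 ?inE ?(negbTE iS) ?andbF //.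
by rewrite (ordsignC ij); ring: (ordsign_sq j i).
Qed.

Lemma gdgen_act_linear (g : gdgen m n) : linear (@gdgen_act F m n g).
Proof. by case: g => a k; [exact: (xop_linear (a, k))|exact: (dop_linear (a, k))]. Qed.

Lemma gd_act_linear t : linear (@gd_act F m n t).
Proof. exact/tact_linear/gdgen_act_linear. Qed.

Lemma grass_sum f : f = \sum_S f S *: gbase F S.
Proof.
apply/ffunP => T; rewrite sum_ffunE (bigD1 T) //= big1 ?addr0.
  by rewrite grassZ ffunE eqxx mulr1.
by move=> S ST; rewrite grassZ ffunE eq_sym (negbTE ST) mulr0.
Qed.

Section Permutation.
Variable s : 'S_m.

Definition idxperm i : gidx := (s i.1, i.2).
Definition idxperm_inv i : gidx := ((s^-1)%g i.1, i.2).

Lemma idxpermK : cancel idxperm idxperm_inv.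
Proof. by case=> a k; rewrite /idxperm /idxperm_inv /= permK. Qed.
Lemma idxperm_invK : cancel idxperm_inv idxperm.
Proof. by case=> a k; rewrite /idxperm /idxperm_inv /= permKV. Qed.

Definition setperm_inv S : {set gidx} := [set i | idxperm i \in S].

Definition pairsign p q := ordsign p q * ordsign (idxperm_inv p) (idxperm_inv q).

(* The sign of sorting the factors of s(e_T), where S = s(T). *)
Definition permsign S : F :=
  \prod_(p in S) \prod_(q in S | (enum_rank q < enum_rank p)%N) pairsign p q.

Lemma pairsign_sq p q : pairsign p q * pairsign p q = 1.
Proof. by rewrite mulrACA !ordsign_sq mulr1. Qed.

Lemma pairsignC p q : p != q -> pairsign p q = pairsign q p.
Proof.
move=> pq; rewrite /pairsign (ordsignC pq) (@ordsignC (idxperm_inv p)) ?mulrNN //.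
by rewrite (can_eq idxperm_invK).
Qed.

Lemma permsign_sq S : permsign S * permsign S = 1.
Proof.
rewrite -big_split big1 // => p _; rewrite -big_split big1 // => q _.
exact: pairsign_sq.
Qed.

(** [permsign] is a product over unordered pairs. As [pairsign] is symmetric, the pairs containing j
    give one factor for each q in S, on whichever side of j it lies. *)
Lemma permsignU1 j S : j \notin S ->
  permsign (j |: S) = permsign S * \prod_(q in S) pairsign j q.
Proof.
move=> jS; rewrite /permsign big_setU1 //=.
have neqj q : q \in S -> q != j by apply: contraTneq => ->.
have -> : \prod_(q in j |: S | (enum_rank q < enum_rank j)%N) pairsign j q =
          \prod_(q in S | (enum_rank q < enum_rank j)%N) pairsign j q.
  apply: eq_bigl => q; rewrite !inE; case: eqVneq => [->|//].
  by rewrite ltnn !andbF.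
have -> : \prod_(p in S) \prod_(q in j |: S | (enum_rank q < enum_rank p)%N)
              pairsign p q =
          \prod_(p in S) ((if (enum_rank j < enum_rank p)%N then pairsign j p else 1) *
            \prod_(q in S | (enum_rank q < enum_rank p)%N) pairsign p q).
  apply: eq_bigr => p pS; rewrite big_mkcondr big_setU1 //= -big_mkcondr /=.
  by rewrite pairsignC // neqj.
rewrite [X in _ * X]big_split /= mulrA mulrC; congr (_ * _).
rewrite -big_mkcondr /= [RHS](bigID (fun q => (enum_rank q < enum_rank j)%N)) /=.
congr (_ * _); apply: eq_bigl => q; case: (boolP (q \in S)) => //= qS.
rewrite -leqNgt ltn_neqAle -[X in X && _]negbK.
by rewrite val_eqE (inj_eq enum_rank_inj) eq_sym neqj.
Qed.

(** The automorphism of the Grassmann algebra induced by s, in coordinates. It is constructed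
    because [Arel_GD] identifies terms by the operators they induce: relabelling of generators has
    to be realised as conjugation by an invertible operator. *)
Definition gperm f : grass := [ffun S => permsign S * f (setperm_inv S)].

Lemma gpermE f S : gperm f S = permsign S * f (setperm_inv S).
Proof. by rewrite ffunE. Qed.

Lemma setperm_invU1 i S : setperm_inv (idxperm i |: S) = i |: setperm_inv S.
Proof. by apply/setP => j; rewrite !inE (can_eq idxpermK). Qed.

Lemma setperm_invD1 i S : setperm_inv (S :\ idxperm i) = setperm_inv S :\ i.
Proof. by apply/setP => j; rewrite !inE (can_eq idxpermK). Qed.

Lemma setsign_perm i S : idxperm i \notin S ->
  permsign (idxperm i |: S) * setsign i (setperm_inv S) =
  permsign S * setsign (idxperm i) S.
Proof.
move=> iS; rewrite permsignU1 // -mulrA; congr (_ * _).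
rewrite /setsign [X in _ * X](reindex_inj (can_inj (idxperm_invK))) /=.
under [X in _ * X]eq_bigl => q do rewrite !inE idxperm_invK.
rewrite -big_split; apply: eq_bigr => q _ /=.
by rewrite /pairsign idxpermK -mulrA ordsign_sq mulr1.
Qed.

Lemma gperm_xop i f : gperm (xop i f) = xop (idxperm i) (gperm f).
Proof.
apply/ffunP => S; rewrite !(xopE, gpermE) inE; case: ifP => iS; last by rewrite mulr0.
rewrite -[in permsign S](finset.setD1K iS) -setperm_invD1 mulrA setsign_perm ?inE ?eqxx //.
by rewrite mulrAC [RHS]mulrA [_ * permsign _]mulrC mulrAC.
Qed.

Lemma gperm_dop i f : gperm (dop i f) = dop (idxperm i) (gperm f).
Proof.
apply/ffunP => S; rewrite !(dopE, gpermE) inE; case: ifP => iS; first by rewrite mulr0.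
rewrite setperm_invU1 mulrA [RHS]mulrA; congr (_ * _).
rewrite (_ : permsign (idxperm i |: S) =
  permsign S * setsign (idxperm i) S * setsign i (setperm_inv S)).
  by ring: (setsign_sq (idxperm i) S).
by rewrite -setsign_perm ?iS // -mulrA setsign_sq mulr1.
Qed.

Lemma gperm_linear : linear gperm.
Proof. by move=> c f g; apply/ffunP => S; rewrite !(grassE, gpermE); ring. Qed.

Lemma gperm_surj f : exists g, gperm g = f.
Proof.
exists [ffun S : {set gidx} => permsign [set i | idxperm_inv i \in S]%SET *
                 f [set i | idxperm_inv i \in S]%SET].
apply/ffunP => S; rewrite gpermE ffunE.
have -> : [set i | idxperm_inv i \in setperm_inv S]%SET = S.
  by apply/setP => i; rewrite !inE idxperm_invK.
by rewrite mulrA permsign_sq mul1r.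
Qed.

Definition gdgen_perm (g : gdgen m n) : gdgen m n :=
  match g with GX a k => GX (s a) k | GD a k => GD (s a) k end.

Lemma gd_act_perm t f : gd_act (tmap gdgen_perm t) (gperm f) = gperm (gd_act t f).
Proof.
rewrite /gd_act; elim: t f => [[a k|a k]|c|t IHt u IHu|t IHt u IHu] f /=.
- by rewrite -[gmul _ _]/(xop (idxperm (a, k)) _) -gperm_xop.
- by rewrite -[gder _ _ _]/(dop (idxperm (a, k)) _) -gperm_dop.
- by rewrite (linear_funZ gperm_linear).
- by rewrite (linear_funD gperm_linear) IHt IHu.
- by rewrite IHu IHt.
Qed.

Lemma gd_act_perm_eq t u : gd_act t =1 @gd_act F m n u ->
  gd_act (tmap gdgen_perm t) =1 gd_act (tmap gdgen_perm u).
Proof.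
by move=> tu f; have [g <-] := gperm_surj f; rewrite !gd_act_perm tu.
Qed.

End Permutation.

(* The composite of the projections [dop i \o xop i] is the projection onto the
   vacuum; it lets any grass vector be represented by one operator. *)
Definition vacuum_term : term F (gdgen m n) :=
  foldr (@Mul F _) (Cst 1)
    [seq Mul (Gen (GD i.1 i.2)) (Gen (GX i.1 i.2)) | i <- enum [set: gidx]].

Lemma gd_act_vacuum f : gd_act vacuum_term f = f finset.set0 *: gone F m n.
Proof.
have vac (r : seq gidx) : gd_act (foldr (@Mul F _) (Cst 1)
    [seq Mul (Gen (GD i.1 i.2)) (Gen (GX i.1 i.2)) | i <- r]) f =
    [ffun S : {set gidx} => if all (fun i => i \notin S) r then f S else 0].
  rewrite /gd_act; elim: r => [|i r IH] /=.
    by rewrite scale1r; apply/ffunP => S; rewrite ffunE.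
  rewrite IH; apply/ffunP => S; rewrite -[gder _ _ _]/(dop i (xop i _)).
  rewrite !(dopE, xopE, ffunE) finset.setU11; case: ifP => //= iS.
  rewrite finset.setU1K ?iS // mulrA setsign_sq mul1r.
  by [].
rewrite /vacuum_term vac; apply/ffunP => S; rewrite grassZ !ffunE.
case: ifP => [/allP S0|/negbT/allPn[i _]].
  have -> : S = finset.set0.
    by apply/setP => i; rewrite inE; apply/negbTE/S0; rewrite mem_enum inE.
  by rewrite eqxx mulr1.
by rewrite negbK; case: eqVneq => [->|_ _]; rewrite ?inE ?mulr0.
Qed.

Lemma gd_act_gone_surj g : exists t, gd_act t (gone F m n) = g.
Proof.
rewrite (grass_sum g); apply: (big_ind (fun g => exists t, gd_act t (gone F m n) = g)).
- by exists (Cst 0); rewrite /gd_act /= scale0r.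
- by move=> ? ? [t <-] [u <-]; exists (Add t u).
move=> S _; suff [t tS] : exists t, gd_act t (gone F m n) = gbase F S.
  by exists (Mul (Cst (g S : F)) t); rewrite /gd_act /= -/(gd_act t _) tS.
have [k] := ubnP #|S|; elim: k S => // k IH S.
have [->|[i iS]] := finset.set_0Vmem S; first by exists (Cst 1); rewrite /gd_act /= scale1r.
rewrite (cardsD1 i) iS add1n ltnS => /IH[t tS].
exists (Mul (Cst (setsign i (S :\ i))) (Mul (Gen (GX i.1 i.2)) t)).
rewrite /gd_act /= -/(gd_act t _) tS -/(xop i _); apply/ffunP => T.
rewrite grassZ xopE !ffunE; case: ifP => iT; last first.
  by rewrite mulr0; case: eqVneq => // TS; rewrite TS iS in iT.
have -> : (T :\ i == S :\ i) = (T == S).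
  by apply/eqP/eqP => [E|->//]; rewrite -(finset.setD1K iT) E finset.setD1K.
case: eqVneq => [->|_]; last by rewrite !mulr0.
by rewrite mulr1 setsign_sq.
Qed.

(** Project onto the vacuum, then create g from it. The resulting operator depends on g alone, which
    makes g -> [gvec g] linear later on. *)
Lemma exists_ghat g :
  exists t, forall f, gd_act t f = f finset.set0 *: (g : grass).
Proof.
have [t tg] := gd_act_gone_surj g; exists (Mul t vacuum_term) => f.
rewrite /gd_act /= -!/(gd_act _ _) gd_act_vacuum.
by rewrite (linear_funZ (gd_act_linear t)) tg.
Qed.

Definition ghat g : term F (gdgen m n) := projT1 (cid (exists_ghat g)).

Lemma gd_act_ghat g f : gd_act (ghat g) f = f finset.set0 *: g.
Proof. by rewrite /ghat; case: cid. Qed.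

End Grassmann.

(** * The algebra A *)

Section Commutator.
Variable R : pzRingType.
Implicit Types x y z : R.
Definition lie x y := x * y - y * x.
Lemma lieMr x y z : lie x (y * z) = lie x y * z + y * lie x z.
Proof. by rewrite /lie mulrBl mulrBr !mulrA addrA subrK. Qed.
Lemma lieMl x y z : lie (x * y) z = lie x z * y + x * lie y z.
Proof. by rewrite /lie mulrBl mulrBr !mulrA [RHS]addrC addrA subrK. Qed.
Lemma lieDr x y z : lie x (y + z) = lie x y + lie x z.
Proof. by rewrite /lie mulrDl mulrDr opprD addrACA. Qed.
Lemma lieNr x y : lie x (- y) = - lie x y.
Proof. by rewrite /lie mulrN mulNr opprD. Qed.
Lemma lieBr x y z : lie x (y - z) = lie x y - lie x z.
Proof. by rewrite lieDr lieNr. Qed.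
Lemma lieC x y : lie x y = - lie y x.
Proof. by rewrite /lie opprB. Qed.
Lemma lieDl x y z : lie (x + y) z = lie x z + lie y z.
Proof. by rewrite lieC lieDr opprD !(lieC z) !opprK. Qed.
Lemma lieBl x y z : lie (x - y) z = lie x z - lie y z.
Proof. by rewrite lieC lieBr opprB !(lieC z) opprK addrC. Qed.
Lemma lie0r x : lie x 0 = 0.
Proof. by rewrite /lie mulr0 mul0r subr0. Qed.
Lemma lie1r x : lie x 1 = 0.
Proof. by rewrite /lie mulr1 mul1r subrr. Qed.
Lemma lie_sumr I (r : seq I) P x (f : I -> R) :
  lie x (\sum_(i <- r | P i) f i) = \sum_(i <- r | P i) lie x (f i).
Proof. exact: (big_morph (lie x) (lieDr x) (lie0r x)). Qed.
Lemma lie_suml I (r : seq I) P x (f : I -> R) :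
  lie (\sum_(i <- r | P i) f i) x = \sum_(i <- r | P i) lie (f i) x.
Proof.
by rewrite lieC lie_sumr -sumrN; apply: eq_bigr => i _; rewrite -lieC.
Qed.
End Commutator.

(** * Quadratic elements in the Clifford relations *)

Section Clifford.
Variables (R : pzRingType) (m n : nat) (X D : 'I_m -> 'I_n -> R).
Hypothesis XX : forall a b k l, X a k * X b l = - (X b l * X a k).
Hypothesis DD : forall a b k l, D a k * D b l = - (D b l * D a k).
Hypothesis DX : forall a b k l,
  D a k * X b l = ((a == b) && (k == l))%:R - X b l * D a k.

(** Kept abstract in X and D because the computation is used twice: for operators on the Grassmann
    algebra and inside A. *)
Definition clifgamma a b := \sum_k X a k * D b k.

Lemma clifgammaX a b c l : lie (clifgamma a b) (X c l) = X a l *+ (b == c).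
Proof.
rewrite lie_suml (bigD1 l) //= big1 ?addr0 => [|k kl];
  rewrite /lie mulrA XX mulNr opprK -mulrA DX mulrBr -mulrA subrK.
  by rewrite eqxx andbT mulr_natr.
by rewrite (negbTE kl) andbF mulr0.
Qed.

Lemma clifgammaD a b c l : lie (clifgamma a b) (D c l) = - (D b l *+ (a == c)).
Proof.
have E k : lie (X a k * D b k) (D c l) = - (D b k *+ ((c == a) && (l == k))).
  rewrite /lie mulrA DX mulrBl -!mulrA (DD b) mulrN opprB addKr.
  by rewrite mulr_natl.
rewrite lie_suml (bigD1 l) //= big1 ?addr0 => [|k kl]; rewrite E.
  by rewrite eqxx andbT eq_sym.
by rewrite (eq_sym l) (negbTE kl) andbF oppr0.
Qed.

Lemma clifgamma_com a b c d : lie (clifgamma a b) (clifgamma c d) =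
  clifgamma a d *+ (b == c) - clifgamma c b *+ (a == d).
Proof.
rewrite lie_sumr -!sumrMnl -sumrB; apply: eq_bigr => k _.
by rewrite lieMr clifgammaX clifgammaD mulrnAl mulrN mulrnAr.
Qed.

End Clifford.

(** * The ring of operators GD as a presented algebra *)

Section OperatorAlgebra.
Variables (F : fieldType) (m n : nat).

(** Every true identity between operators is taken as a relation, so that such identities become
    ring identities, to which the Clifford computation applies. *)
Definition GDrel (t u : term F (gdgen m n)) : Prop := gd_act t =1 gd_act u.

Lemma GD_pcls_eq t u : pcls GDrel t = pcls GDrel u <-> gd_act t =1 gd_act u.
Proof.
split=> [E f|tu]; last exact/pclsP/cong_rel.
have K v : gd_act (repr (pcls GDrel v)) f = gd_act v f.
  by apply: tact_pcls => //; exact: gdgen_act_linear.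
by rewrite -K E K.
Qed.

Local Notation X a k := (Gen (GX a k) : term F (gdgen m n)).
Local Notation D a k := (Gen (GD a k) : term F (gdgen m n)).

Lemma gd_act_com t u f :
  gd_act (Com t u) f = gd_act t (gd_act u f) - @gd_act F m n u (gd_act t f).
Proof. exact: tact_com. Qed.

Lemma gd_act_sub t u f :
  gd_act (Defs.Sub t u) f = gd_act t f - @gd_act F m n u f.
Proof. exact: tact_sub. Qed.

Lemma gd_XX a b k l : gd_act (Mul (X a k) (X b l)) =1
  gd_act (Mul (Cst (-1)) (Mul (X b l) (X a k))).
Proof. by move=> f; rewrite /gd_act /= scaleN1r; exact: (xop_anti (a, k) (b, l)). Qed.

Lemma gd_DD a b k l : gd_act (Mul (D a k) (D b l)) =1
  gd_act (Mul (Cst (-1)) (Mul (D b l) (D a k))).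
Proof. by move=> f; rewrite /gd_act /= scaleN1r; exact: (dop_anti (a, k) (b, l)). Qed.

Lemma gd_DX a b k l : gd_act (Mul (D a k) (X b l)) =1
  gd_act (Defs.Sub (Cst ((a == b) && (k == l))%:R) (Mul (X b l) (D a k))).
Proof. by move=> f; rewrite gd_act_sub /gd_act /=; exact: (dop_xop (a, k) (b, l)). Qed.

Section Represented.
Variables (I : Type) (rel : term F I -> term F I -> Prop).
Variable g : gdgen m n -> I.
Hypothesis relgd : forall t u : term F (gdgen m n),
  gd_act t =1 gd_act u -> pcls rel (tmap g t) = pcls rel (tmap g u).
Local Notation x a k := (pcls rel (Gen (g (GX a k)))).
Local Notation d a k := (pcls rel (Gen (g (GD a k)))).

Lemma pcls_XX a b k l : x a k * x b l = - (x b l * x a k).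
Proof. by have := relgd (gd_XX a b k l); rewrite /= !pcls_mul pcls_cst -presalg_scaleAl mul1r scaleN1r. Qed.
Lemma pcls_DD a b k l : d a k * d b l = - (d b l * d a k).
Proof. by have := relgd (gd_DD a b k l); rewrite /= !pcls_mul pcls_cst -presalg_scaleAl mul1r scaleN1r. Qed.
Lemma pcls_DX a b k l : d a k * x b l = ((a == b) && (k == l))%:R - x b l * d a k.
Proof.
have := relgd (gd_DX a b k l).
by rewrite /= pcls_add !pcls_mul !pcls_cst -presalg_scaleAl mul1r scaleN1r scaler_nat.
Qed.

Lemma pcls_gamma a b : pcls rel (tmap g (gamma F n a b)) =
  clifgamma (fun a k => x a k) (fun a k => d a k) a b.
Proof.
have -> : tmap g (gamma F n a b) = foldr (@Add F I) (Cst 0)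
    [seq Mul (Gen (g (GX a k))) (Gen (g (GD b k))) | k <- enum 'I_n].
  by rewrite /gamma; elim: (enum 'I_n) => //= k r ->.
rewrite pcls_foldr_add big_map /clifgamma big_enum /=.
by apply: eq_bigr => k _; rewrite pcls_mul.
Qed.
End Represented.

Lemma tmap_id I (t : term F I) : tmap id t = t.
Proof. by elim: t => [//|//|t IHt u IHu|t IHt u IHu] /=; rewrite IHt IHu. Qed.

Lemma tmap_comp I J K (g : J -> K) (f : I -> J) (t : term F I) :
  tmap g (tmap f t) = tmap (g \o f) t.
Proof. by elim: t => [//|//|t IHt u IHu|t IHt u IHu] /=; rewrite IHt IHu. Qed.

Lemma gd_act_gamma_com (a b c d : 'I_m) :
  gd_act (Com (gamma F n a b) (gamma F n c d)) =1
  gd_act (Defs.Sub (Mul (Cst (b == c)%:R) (gamma F n a d))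
                   (Mul (Cst (a == d)%:R) (gamma F n c b))).
Proof.
have R t u : gd_act t =1 gd_act u ->
    pcls GDrel (tmap id t) = pcls GDrel (tmap id u).
  by rewrite !tmap_id => tu; apply/GD_pcls_eq.
apply/GD_pcls_eq; rewrite pcls_com pcls_sub !pcls_mul.
have G a' b' : pcls GDrel (gamma F n a' b') =
    clifgamma (fun a k => pcls GDrel (X a k)) (fun a k => pcls GDrel (D a k)) a' b'.
  by rewrite -(pcls_gamma GDrel id) tmap_id.
rewrite !G.
rewrite -[LHS]/(lie _ _) (clifgamma_com (pcls_XX R) (pcls_DD R) (pcls_DX R)).
by rewrite !pcls_cst -!presalg_scaleAl !mul1r !scaler_nat.
Qed.

End OperatorAlgebra.

(** * Commutation relations of A and the action of the symmetric group *)

Section Aalgebra.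
Variables (F : fieldType) (m n : nat).
Local Notation A := (Aalg F m n).
Local Notation Arel := (@Arel F m n).
Implicit Types Y Z : A.

Definition acls (t : term F (agen m n)) : A := pcls Arel t.

Lemma acls_surj Y : exists t, Y = acls t.
Proof. by exists (repr Y); rewrite /acls pclsK. Qed.
Lemma acls_add t u : acls (Add t u) = acls t + acls u.
Proof. exact: pcls_add. Qed.
Lemma acls_mul t u : acls (Mul t u) = acls t * acls u.
Proof. exact: pcls_mul. Qed.
Lemma acls_cst (c : F) : acls (Cst c) = c *: (1 : A).
Proof. exact: pcls_cst. Qed.
Lemma acls_sub t u : acls (Defs.Sub t u) = acls t - acls u.
Proof. exact: pcls_sub. Qed.
Lemma acls_com t u : acls (Com t u) = lie (acls t) (acls u).
Proof. exact: pcls_com. Qed.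
Lemma acls_rel t u : Arel t u -> acls t = acls u.
Proof. by move=> tu; apply/pclsP/cong_rel. Qed.
Lemma ascaleAl (c : F) Y Z : (c *: Y) * Z = c *: (Y * Z).
Proof. by rewrite [RHS](@presalg_scaleAl _ _ Arel). Qed.
Lemma ascaleAr (c : F) Y Z : Y * (c *: Z) = c *: (Y * Z).
Proof. by rewrite [RHS](@presalg_scaleAr _ _ Arel). Qed.

Definition gdA (t : term F (gdgen m n)) : A := acls (tmap (@AG m n) t).

Lemma gdA_eq t u : gd_act t =1 gd_act u -> gdA t = gdA u.
Proof. by move=> tu; apply/acls_rel/Arel_GD. Qed.

Local Notation aE a b := (@aE F m n a b).
Local Notation aX a k := (@aX F m n a k).
Local Notation aD a k := (@aD F m n a k).

Lemma aXX a b k l : aX a k * aX b l = - (aX b l * aX a k).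
Proof. exact: (pcls_XX (@gdA_eq)). Qed.
Lemma aDD a b k l : aD a k * aD b l = - (aD b l * aD a k).
Proof. exact: (pcls_DD (@gdA_eq)). Qed.
Lemma aDX a b k l : aD a k * aX b l = ((a == b) && (k == l))%:R - aX b l * aD a k.
Proof. exact: (pcls_DX (@gdA_eq)). Qed.

Definition agamma a b : A := \sum_k aX a k * aD b k.

Lemma agammaE a b : gdA (gamma F n a b) = agamma a b.
Proof. exact: pcls_gamma. Qed.

Lemma aE_com a b c d :
  lie (aE a b) (aE c d) = aE a d *+ (b == c) - aE c b *+ (a == d).
Proof.
have := acls_rel (Arel_gl F n a b c d); rewrite acls_com => ->.
by rewrite acls_sub !acls_mul !acls_cst !ascaleAl !mul1r !scaler_nat.
Qed.

Lemma aE_gd a b t : lie (aE a b) (gdA t) = lie (agamma a b) (gdA t).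
Proof.
by have := acls_rel (Arel_cross a b t); rewrite !acls_com -!/(gdA _) agammaE.
Qed.

Lemma aE_X a b c k : lie (aE a b) (aX c k) = aX a k *+ (b == c).
Proof.
by rewrite (aE_gd a b (Gen (GX c k))) (clifgammaX aXX aDX).
Qed.

Lemma aE_D a b c k : lie (aE a b) (aD c k) = - (aD b k *+ (a == c)).
Proof.
by rewrite (aE_gd a b (Gen (GD c k))) (clifgammaD aDD aDX).
Qed.

Lemma agamma_com a b c d : lie (agamma a b) (agamma c d) =
  agamma a d *+ (b == c) - agamma c b *+ (a == d).
Proof. exact: (clifgamma_com aXX aDD aDX). Qed.

Section Permutation.
Variable s : 'S_m.
Local Notation sact := (@alg_perm F m n s).

Lemma tmap_perm_AG t :
  tmap (agen_perm s) (tmap (@AG m n) t) = tmap (@AG m n) (tmap (@gdgen_perm m n s) t) :> term F _.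
Proof.
rewrite !tmap_comp; congr (tmap _ t).
by apply: funext => -[].
Qed.

Lemma tmap_perm_gamma a b :
  tmap (@gdgen_perm m n s) (gamma F n a b) = gamma F n (s a) (s b).
Proof. by rewrite /gamma; elim: (enum 'I_n) => //= k r ->. Qed.

Lemma cong_perm t u : cong Arel t u ->
  cong Arel (tmap (agen_perm s) t) (tmap (agen_perm s) u).
Proof.
elim=> {t u} /=; try by [constructor | move=> t u _; apply: cong_sym].
- move=> t u [a b c d|{}t {}u tu|a b {}t]; apply: cong_rel.
  + rewrite /= -[b == c](inj_eq (@perm_inj _ s)) -[a == d](inj_eq (@perm_inj _ s)).
    exact: Arel_gl.
  + by rewrite !tmap_perm_AG; apply/Arel_GD/gd_act_perm_eq.
  + rewrite /= !tmap_perm_AG tmap_perm_gamma; exact: Arel_cross.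
- by move=> u t v _ IH _; apply: cong_trans IH.
Qed.

Lemma alg_perm_cls t : sact (acls t) = acls (tmap (agen_perm s) t).
Proof. by apply/pclsP/cong_perm/repr_pcls. Qed.

Lemma alg_permD Y Z : sact (Y + Z) = sact Y + sact Z.
Proof.
have [t ->] := acls_surj Y; have [u ->] := acls_surj Z.
by rewrite -acls_add !alg_perm_cls /= acls_add.
Qed.
Lemma alg_permM Y Z : sact (Y * Z) = sact Y * sact Z.
Proof.
have [t ->] := acls_surj Y; have [u ->] := acls_surj Z.
by rewrite -acls_mul !alg_perm_cls /= acls_mul.
Qed.
Lemma alg_permC (c : F) : sact (c *: (1 : A)) = c *: (1 : A).
Proof. by rewrite -acls_cst alg_perm_cls. Qed.
Lemma alg_perm1 : sact 1 = 1.
Proof. by have := alg_permC 1; rewrite scale1r. Qed.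
Lemma alg_permZ (c : F) Y : sact (c *: Y) = c *: sact Y.
Proof. by rewrite -[in LHS](mul1r Y) -ascaleAl alg_permM alg_permC ascaleAl mul1r. Qed.
Lemma alg_perm0 : sact 0 = 0.
Proof. by have := alg_permZ 0 0; rewrite !scale0r. Qed.
Lemma alg_permN Y : sact (- Y) = - sact Y.
Proof. by rewrite -scaleN1r alg_permZ scaleN1r. Qed.
Lemma alg_permB Y Z : sact (Y - Z) = sact Y - sact Z.
Proof. by rewrite alg_permD alg_permN. Qed.
Lemma alg_perm_aE a b : sact (aE a b) = aE (s a) (s b).
Proof. by rewrite -[LHS]/(sact (acls _)) alg_perm_cls. Qed.
Lemma alg_perm_aX a k : sact (aX a k) = aX (s a) k.
Proof. by rewrite -[LHS]/(sact (acls _)) alg_perm_cls. Qed.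
Lemma alg_perm_aD a k : sact (aD a k) = aD (s a) k.
Proof. by rewrite -[LHS]/(sact (acls _)) alg_perm_cls. Qed.
Lemma alg_perm_prod I (r : seq I) (f : I -> A) :
  sact (\prod_(i <- r) f i) = \prod_(i <- r) sact (f i).
Proof. exact: (big_morph sact alg_permM alg_perm1). Qed.
End Permutation.

End Aalgebra.

(** * Verma modules and tensor products *)

Section Span.
Import Quotient.
Local Open Scope quotient_scope.
Variables (V : zmodType) (S : set V).
Implicit Types v w : V.

Lemma gsN v : gen_subgroup S v -> gen_subgroup S (- v).
Proof. by move=> Sv; rewrite -sub0r; apply: gsB => //; exact: gs0. Qed.
Lemma gsD v w : gen_subgroup S v -> gen_subgroup S w -> gen_subgroup S (v + w).
Proof. by move=> Sv Sw; rewrite -(opprK w); apply: gsB => //; exact: gsN. Qed.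
Lemma gs_sum I (r : seq I) (P : pred I) (f : I -> V) :
  (forall i, P i -> gen_subgroup S (f i)) -> gen_subgroup S (\sum_(i <- r | P i) f i).
Proof. by move=> Sf; apply: big_ind => //; [exact: gs0|exact: gsD]. Qed.
Lemma gsMn v k : gen_subgroup S v -> gen_subgroup S (v *+ k).
Proof. by move=> Sv; elim: k => [|k IH]; rewrite ?mulr0n ?mulrS; [exact: gs0|exact: gsD]. Qed.
Definition qz v : {quot zspan S} := \pi_({quot zspan S}) v.

Lemma qz_eq v w : qz v = qz w <-> gen_subgroup S (v - w).
Proof.
split=> [|H].
  by move=> /eqP; rewrite -[_ == _]idealrBE => /asboolP.
by apply/eqP; rewrite -[_ == _]idealrBE; apply/asboolP.
Qed.
Lemma qz_repr v : gen_subgroup S (repr (qz v) - v).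
Proof. by apply/qz_eq; exact: reprK. Qed.

Lemma qcls_eq (F : fieldType) (W : lmodType F) (S' : set W) (v w : W) :
  qcls S' v = qcls S' w <-> gen_subgroup (scaled S') (v - w).
Proof.
split=> [|H].
  by move=> /eqP; rewrite -[_ == _]idealrBE => /asboolP.
by apply/eqP; rewrite -[_ == _]idealrBE; apply/asboolP.
Qed.
End Span.

Lemma gs_morph (V W : zmodType) (S : set V) (T : set W) (f : V -> W) :
  f 0 = 0 -> (forall v w, f (v - w) = f v - f w) ->
  (forall v, S v -> gen_subgroup T (f v)) ->
  forall v, gen_subgroup S v -> gen_subgroup T (f v).
Proof.
move=> f0 fB fS v; elim=> [|{}v|{}v w _ IHv _ IHw]; first by rewrite f0; exact: gs0.
  exact: fS.
by rewrite fB; exact: gsB.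
Qed.

Lemma gs_sub (V : zmodType) (S T : set V) :
  (forall v, S v -> gen_subgroup T v) ->
  forall v, gen_subgroup S v -> gen_subgroup T v.
Proof. exact: (gs_morph (f := id)). Qed.

Lemma qclsZ (F : fieldType) (V : lmodType F) (S : set V) c v :
  qcls S (c *: v) = c *: qcls S v.
Proof. by rewrite -qscale_qcls. Qed.

Lemma qcls_linear (F : fieldType) (V : lmodType F) (S : set V) : linear (qcls S).
Proof. by move=> c v w; rewrite qclsD qclsZ. Qed.

(** * Quotients of presented algebras by left ideals *)

Section LeftQuotient.
Variables (F : fieldType) (I : Type) (rel : term F I -> term F I -> Prop).
Local Notation B := (presalg rel).
Variable G : set B.
Local Notation M := (quotmod (lmults G)).
Implicit Types (r s : B) (x y : M).

(** A scalar can be absorbed into the left factor of a multiple, so a left ideal is already a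
    subspace. *)
Lemma scaled_lmults r : gen_subgroup (scaled (lmults G)) r <-> gen_subgroup (lmults G) r.
Proof.
split; apply: gs_sub => {}r.
  case=> c [w [[s [g [Gg ->]]] ->]]; apply: gs_mem; exists (c *: s), g.
  by split=> //; rewrite presalg_scaleAl.
by move=> Gr; apply: gs_mem; exists 1, r; rewrite scale1r.
Qed.

Lemma lideal_mul r s : gen_subgroup (lmults G) s -> gen_subgroup (lmults G) (r * s).
Proof.
apply: (gs_morph (f := fun s => r * s)); [exact: mulr0|exact: mulrBr|].
move=> _ [t [g [Gg ->]]]; apply: gs_mem; exists (r * t), g.
by rewrite mulrA.
Qed.

Definition lact r x : M := qcls (lmults G) (r * repr x).

Lemma lact_cls r s : lact r (qcls (lmults G) s) = qcls (lmults G) (r * s).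
Proof.
apply/qcls_eq; rewrite -mulrBr; apply/scaled_lmults/lideal_mul/scaled_lmults.
by apply/qcls_eq; rewrite qclsK.
Qed.

Lemma lact_linear r : linear (lact r).
Proof.
move=> c x y; rewrite -(qclsK x) -(qclsK y) -qclsZ -qclsD !lact_cls.
by rewrite mulrDr -presalg_scaleAr qclsD qclsZ.
Qed.

Lemma lactD r s x : lact (r + s) x = lact r x + lact s x.
Proof. by rewrite -(qclsK x) !lact_cls mulrDl qclsD. Qed.
Lemma lactM r s x : lact (r * s) x = lact r (lact s x).
Proof. by rewrite -(qclsK x) !lact_cls mulrA. Qed.
Lemma lactZ c r x : lact (c *: r) x = c *: lact r x.
Proof. by rewrite -(qclsK x) !lact_cls -presalg_scaleAl qclsZ. Qed.
Lemma lactB r s x : lact (r - s) x = lact r x - lact s x.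
Proof. by rewrite lactD -scaleN1r lactZ scaleN1r. Qed.
Lemma lact1 x : lact 1 x = x.
Proof. by rewrite -(qclsK x) lact_cls mul1r. Qed.
Lemma lact_gen r g : G g -> qcls (lmults G) (r * g) = 0.
Proof.
move=> Gg; rewrite -(linear_fun0 (@qcls_linear _ _ (lmults G))); apply/qcls_eq/scaled_lmults.
by rewrite subr0; apply: gs_mem; exists r, g.
Qed.
End LeftQuotient.

(** * The action of A on the tensor product of a Verma module with G *)

Section VermaTensor.
Variables (F : fieldType) (m n : nat) (mu : weight F m).
Local Notation A := (Aalg F m n).
Local Notation U := (Ugl F m).
Local Notation M := (verma mu).
Local Notation T := (vtens n mu).
Local Notation grass := (grass F m n).
Implicit Types (t v : T) (x : M).

Lemma uactE (u : U) x : uact u x = lact (rel := @Urel F m) u x.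
Proof. by []. Qed.

Lemma uact_linear (u : U) : linear (uact u : M -> M).
Proof. exact: lact_linear. Qed.
Lemma uactB (u v : U) x : uact (u - v) x = uact u x - uact v x.
Proof. exact: lactB. Qed.
Lemma uactM (u v : U) x : uact (u * v) x = uact u (uact v x).
Proof. exact: lactM. Qed.
Lemma uactZ c (u : U) x : uact (c *: u) x = c *: uact u x.
Proof. exact: lactZ. Qed.

Lemma UE_com (a b c d : 'I_m) : lie (UE F a b) (UE F c d) =
  (b == c)%:R *: UE F a d - (a == d)%:R *: UE F c b.
Proof.
have := pclsP (cong_rel (Urel_gl F a b c d)); rewrite pcls_com => E.
rewrite [LHS]E pcls_sub !pcls_mul !pcls_cst -!presalg_scaleAl !mul1r.
by [].
Qed.

Lemma tensl_linear (u : U) : linear (@tensl F m n mu u).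
Proof.
move=> c t v; apply/ffunP => S; rewrite !ffunE.
exact: uact_linear.
Qed.

Lemma tensrE (f : grass -> grass) t S :
  tensr f t S = \sum_(S' : {set gidx m n}) (f (gbase F S') S : F) *: t S'.
Proof. by rewrite /tensr sum_ffunE; apply: eq_bigr => S' _; rewrite ffunE. Qed.

Lemma tensr_linear f : linear (@tensr F m n mu f).
Proof.
move=> c t v; apply/ffunP => S; rewrite ffunE [(_ *: _ : T) S]ffunE !tensrE.
rewrite scaler_sumr -big_split; apply: eq_bigr => S' _ /=.
by rewrite !ffunE scalerDr !scalerA mulrC.
Qed.

Lemma tensr_comp (f g : grass -> grass) t : linear f ->
  tensr f (tensr g t) = tensr (f \o g) t :> T.
Proof.
move=> lf; apply/ffunP => S; rewrite !tensrE.
under eq_bigr => S' _ do rewrite tensrE scaler_sumr.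
rewrite exchange_big /=; apply: eq_bigr => S' _.
under eq_bigr => S'' _ do rewrite scalerA.
rewrite -scaler_suml; congr (_ *: _).
rewrite [g _ in RHS]grass_sum (linear_fun_sum lf) sum_ffunE; apply: eq_bigr => S'' _.
by rewrite (linear_funZ lf) grassZ mulrC.
Qed.

Lemma tensrD (f g : grass -> grass) t :
  tensr (fun h => f h + g h) t = tensr f t + tensr g t :> T.
Proof.
apply/ffunP => S; rewrite ffunE !tensrE -big_split; apply: eq_bigr => S' _.
by rewrite grassD scalerDl.
Qed.

Lemma tensrZ c t : tensr (fun h : grass => c *: h) t = c *: t :> T.
Proof.
apply/ffunP => S; rewrite tensrE ffunE (bigD1 S) //= big1 ?addr0.
  by rewrite grassZ ffunE eqxx mulr1.
by move=> S' S'S; rewrite grassZ ffunE eq_sym (negbTE S'S) mulr0 scale0r.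
Qed.

Lemma tensl_tensr u f t : tensl u (tensr f t) = tensr f (tensl u t) :> T.
Proof.
apply/ffunP => S; rewrite ffunE !tensrE (linear_fun_sum (uact_linear u)).
by apply: eq_bigr => S' _; rewrite (linear_funZ (uact_linear u)) ffunE.
Qed.

Lemma tens_tensr f x g : linear f -> tensr f (tens x g) = tens x (f g) :> T.
Proof.
move=> lf; apply/ffunP => S; rewrite tensrE ffunE.
under eq_bigr => S' _ do rewrite ffunE scalerA mulrC.
rewrite -scaler_suml [g in RHS]grass_sum (linear_fun_sum lf) sum_ffunE; congr (_ *: _).
by apply: eq_bigr => S' _; rewrite (linear_funZ lf) grassZ.
Qed.

Lemma tensl_tens u x g : tensl u (tens x g) = tens (uact u x) g :> T.
Proof. by apply/ffunP => S; rewrite !ffunE (linear_funZ (uact_linear u)). Qed.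

Lemma agen_act_linear i : linear (@agen_act F m n mu i).
Proof.
case: i => [a b|g] c t v /=; last exact: tensr_linear.
by rewrite tensl_linear tensr_linear scalerDr addrACA.
Qed.

Lemma tact_AG s t :
  tact (@agen_act F m n mu) (tmap (@AG m n) s) t = tensr (gd_act s) t.
Proof.
elim: s t => [g|c|s IHs u IHu|s IHs u IHu] t /=.
- by congr (tensr _ t).
- by rewrite -tensrZ; congr (tensr _ t).
- by rewrite IHs IHu -tensrD; congr (tensr _ t).
- rewrite IHs IHu tensr_comp; first by congr (tensr _ t).
  exact: gd_act_linear.
Qed.

Lemma eq_tensr f g t : f =1 g -> tensr f t = tensr g t :> T.
Proof. by move=> fg; congr (tensr _ t); apply: funext. Qed.

Lemma tensrN (f : grass -> grass) t : tensr (fun h => - f h) t = - tensr f t :> T.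
Proof.
apply/ffunP => S; rewrite ffunE !tensrE -sumrN; apply: eq_bigr => S' _.
by rewrite grassN scaleNr.
Qed.

Lemma tensrZf c (f : grass -> grass) t : tensr (fun h => c *: f h) t = c *: tensr f t :> T.
Proof.
apply/ffunP => S; rewrite ffunE !tensrE scaler_sumr; apply: eq_bigr => S' _.
by rewrite grassZ scalerA.
Qed.

Lemma tensl_com (u v : U) t : tensl (lie u v) t = tensl u (tensl v t) - tensl v (tensl u t) :> T.
Proof. by apply/ffunP => S; rewrite !ffunE uactB !uactM. Qed.

Lemma tensr_com s u t : tensr (gd_act (Com s u)) t =
  tensr (gd_act s) (tensr (gd_act u) t) - tensr (gd_act u) (tensr (gd_act s) t) :> T.
Proof.
rewrite !tensr_comp; try exact: gd_act_linear.
by rewrite -tensrN -tensrD; apply: eq_tensr => f; rewrite gd_act_com.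
Qed.

Lemma agen_act_gl a b c d t :
  tact (@agen_act F m n mu) (Com (Gen (AE n a b)) (Gen (AE n c d))) t =
  tact (@agen_act F m n mu)
    (Defs.Sub (Mul (Cst (b == c)%:R) (Gen (AE n a d)))
              (Mul (Cst (a == d)%:R) (Gen (AE n c b)))) t.
Proof.
(* The mixed products of a left and a right factor occur in both orders and cancel, because [tensl]
   and [tensr] commute. *)
have com (ll p q rr ll' rr' : T) :
    ll + p + (q + rr) - (ll' + q + (p + rr')) = ll - ll' + (rr - rr').
  rewrite [ll + p + _]addrACA opprD [LHS]addrACA; congr (_ + _).
    by rewrite opprD addrACA subrr addr0.
  by rewrite opprD addrACA subrr add0r.
have lD f : linear (@tensr F m n mu f) by exact: tensr_linear.
have lL u : linear (@tensl F m n mu u) by exact: tensl_linear.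
rewrite tact_com tact_sub /= !(linear_funD (lD _)) !(linear_funD (lL _)).
rewrite !tensl_tensr com -tensl_com -tensr_com UE_com.
rewrite (eq_tensr _ (gd_act_gamma_com a b c d)) /gd_act /Defs.Sub /= -/(gd_act _).
rewrite (tensrD (fun f => (b == c)%:R *: gd_act _ f)).
rewrite (tensrZf _ (gd_act _)) (tensrZf (-1) (fun f => (a == d)%:R *: gd_act _ f)).
rewrite (tensrZf _ (gd_act _)) scaleN1r !scalerDr opprD addrACA; congr (_ + _).
apply/ffunP => S; rewrite !ffunE uactB !uactZ.
by [].
Qed.

(** The cross relation holds because the part of E_ab acting on the Verma factor commutes with GD,
    so only gamma(E_ab) contributes to the bracket. *)
Lemma agen_act_rel s u : @Arel F m n s u ->
  tact (@agen_act F m n mu) s =1 tact (@agen_act F m n mu) u.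
Proof.
case=> {s u} [a b c d|s u su|a b s] t; first exact: agen_act_gl.
  by rewrite !tact_AG; apply: eq_tensr.
rewrite !tact_com /= !tact_AG (linear_funD (tensr_linear _)) -tensl_tensr.
by rewrite opprD addrACA subrr add0r.
Qed.

Local Notation one := (tens (verma1 mu) (gone F m n) : T).

Lemma aact_cls s t : aact (acls s) t = tact (@agen_act F m n mu) s t.
Proof. exact: (tact_pcls agen_act_linear agen_act_rel). Qed.

Lemma aact_linear (Y : A) : linear (@aact F m n mu Y).
Proof. exact: tact_linear agen_act_linear _. Qed.
Lemma aactD (Y Z : A) t : aact (Y + Z) t = aact Y t + aact Z t.
Proof.
have [s ->] := acls_surj Y; have [u ->] := acls_surj Z.
by rewrite -acls_add !aact_cls.
Qed.
Lemma aactM (Y Z : A) t : aact (Y * Z) t = aact Y (aact Z t).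
Proof.
have [s ->] := acls_surj Y; have [u ->] := acls_surj Z.
by rewrite -acls_mul !aact_cls.
Qed.
Lemma aactC (c : F) t : aact (c *: (1 : A)) t = c *: t.
Proof. by rewrite -acls_cst aact_cls. Qed.
Lemma aactZ (c : F) (Y : A) t : aact (c *: Y) t = c *: aact Y t.
Proof. by rewrite -[in LHS](mul1r Y) -ascaleAl aactM aactC. Qed.
Lemma aactB (Y Z : A) t : aact (Y - Z) t = aact Y t - aact Z t.
Proof. by rewrite aactD -scaleN1r aactZ scaleN1r. Qed.
Lemma aact0 t : aact (0 : A) t = 0.
Proof. by rewrite -(scale0r 0) aactZ scale0r. Qed.

Lemma aact_gone s : aact (gdA s) one = tens (verma1 mu) (gd_act s (gone F m n)).
Proof.
by rewrite /gdA aact_cls tact_AG tens_tensr //; exact: gd_act_linear.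
Qed.

Lemma dop_gone b k : gder b k (gone F m n) = 0.
Proof.
rewrite -[LHS]/(dop (b, k) _); apply/ffunP => S; rewrite dopE !ffunE.
case: ifP => // _; case: eqP => [/setP/(_ (b, k))|_]; last by rewrite mulr0.
by rewrite !inE eqxx.
Qed.

Lemma tens0 x : tens x 0 = 0 :> T.
Proof. by apply/ffunP => S; rewrite !ffunE scale0r. Qed.

Lemma aact_aD_one b k : aact (aD F b k) one = 0.
Proof. by rewrite (aact_gone (Gen (GD b k))) /gd_act /= dop_gone tens0. Qed.

Lemma aact_agamma_one a b : aact (agamma F n a b) one = 0.
Proof.
rewrite /agamma; apply: (big_ind (fun Y => aact Y one = 0)); first exact: aact0.
  by move=> Y Z; rewrite aactD => -> ->; rewrite addr0.
by move=> k _; rewrite aactM aact_aD_one (linear_fun0 (aact_linear _)).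
Qed.

Lemma aact_aE_one a b :
  aact (aE F n a b) one = tens (uact (UE F a b) (verma1 mu)) (gone F m n).
Proof.
rewrite (aact_cls (Gen (AE n a b))) /= tensl_tens -[RHS]addr0; congr (_ + _).
by rewrite -tact_AG -aact_cls -/(gdA _) agammaE aact_agamma_one.
Qed.

Definition verma_gens : set U :=
  [set u : U | exists a b : 'I_m, (a < b)%N /\ u = UE F a b] `|`
  [set u : U | exists a, u = UE F a a - mu a *: (1 : U)].

Definition Igens : set A :=
  [set Y | exists a b : 'I_m, (a < b)%N /\ Y = aE F n a b] `|`
  [set Y | exists a, Y = aE F n a a - mu a *: (1 : A)] `|`
  [set Y | exists b k, Y = aD F b k].

Lemma uact_verma1 (u : U) : uact u (verma1 mu) = qcls (lmults verma_gens) u.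
Proof. by rewrite uactE (lact_cls (rel := @Urel F m)) mulr1. Qed.

Lemma uact_gens (u : U) : verma_gens u -> uact u (verma1 mu) = 0.
Proof. by move=> Gu; rewrite uact_verma1 -[u]mul1r; exact: (lact_gen (rel := @Urel F m)). Qed.

Lemma tens0l g : tens 0 g = 0 :> T.
Proof. by apply/ffunP => S; rewrite !ffunE scaler0. Qed.

Lemma aact_Igens Y : Igens Y -> aact Y one = 0.
Proof.
case=> [[[a [b [ab ->]]]|[a ->]]|[b [k ->]]]; last exact: aact_aD_one.
  by rewrite aact_aE_one uact_gens ?tens0l //; left; exists a, b.
rewrite aactB aactC aact_aE_one.
have := @uact_gens (UE F a a - mu a *: (1 : U)); rewrite uactB uactZ => E.
have -> : uact (UE F a a) (verma1 mu) = mu a *: verma1 mu.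
  apply/eqP; rewrite -subr_eq0 -[X in _ - _ *: X](lact1 (rel := @Urel F m)).
  by apply/eqP/E; right; exists a.
by apply/ffunP => S; rewrite !ffunE !scalerA mulrC subrr.
Qed.

Lemma aact_Iideal Y : Iideal mu Y -> aact Y one = 0.
Proof.
elim=> [|{}Y [Z [W [GW ->]]]|{}Y Z _ IHY _ IHZ]; first exact: aact0.
  by rewrite aactM aact_Igens // (linear_fun0 (aact_linear _)).
by rewrite aactB IHY IHZ subr0.
Qed.

Definition nspan : set T :=
  [set t : T | exists (a b : 'I_m) t', (b < a)%N /\ t = agen_act (AE n a b) t'].

Lemma aact_Jideal (Y : A) v : Jideal Y -> gen_subgroup (scaled nspan) (aact Y v).
Proof.
elim=> [|{}Y [Z [W [[a [b [ab ->]]] ->]]]|{}Y Z _ IHY _ IHZ].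
- by rewrite aact0; exact: gs0.
- apply: gs_mem; exists 1, (aact (aE F n a b * Z) v); rewrite scale1r; split=> //.
  by exists a, b, (aact Z v); split=> //; rewrite aactM (aact_cls (Gen (AE n a b))).
- by rewrite aactB; exact: gsB.
Qed.

End VermaTensor.

(** * The embedding of A / I_mu in the tensor product, and the kernel on coinvariants *)

Section Identification.
Variables (F : fieldType) (m n : nat) (mu : weight F m).
Local Notation A := (Aalg F m n).
Local Notation U := (Ugl F m).
Local Notation M := (verma mu).
Local Notation T := (vtens n mu).
Local Notation aE a b := (@aE F m n a b).
Local Notation aX a k := (@aX F m n a k).
Local Notation aD a k := (@aD F m n a k).
Local Notation agamma a b := (@agamma F m n a b).

(* The embedding iota of U(gl_m) in A that sends E_ab to E_ab - gamma(E_ab); its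
   image commutes with GD. *)
Definition iotagen (p : 'I_m * 'I_m) (y : A) : A :=
  (aE p.1 p.2 - agamma p.1 p.2) * y.
Definition iota (u : U) : A := tact iotagen (repr u) 1.

Lemma iotagen_linear p : linear (iotagen p).
Proof. by move=> c y z; rewrite /iotagen mulrDr ascaleAr. Qed.

Lemma iota_com a b c d :
  lie (aE a b - agamma a b) (aE c d - agamma c d) =
  (aE a d - agamma a d) *+ (b == c) - (aE c b - agamma c b) *+ (a == d).
Proof.
rewrite lieBl !lieBr -!agammaE !aE_gd !agammaE.
have -> : lie (agamma a b) (aE c d) = lie (agamma a b) (agamma c d).
  by rewrite lieC -[agamma a b]agammaE aE_gd agammaE -lieC.
rewrite subrr subr0 aE_com agamma_com !mulrnBl !opprB.
by rewrite addrACA [RHS]addrACA; congr (_ + _); rewrite addrC.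
Qed.

Lemma iota_rel t u : @Urel F m t u -> tact iotagen t =1 tact iotagen u.
Proof.
case=> {t u} a b c d y; rewrite tact_com tact_sub /= /iotagen /= !mulrA -mulrBl.
rewrite -/(lie _ _) iota_com mulrBl !scaler_nat.
by rewrite -!mulrnAl.
Qed.

Lemma tact_iota t y : tact iotagen (repr (pcls (@Urel F m) t)) y = tact iotagen t y.
Proof. exact: (tact_pcls iotagen_linear iota_rel). Qed.

Lemma tact_iotaM t y z : tact iotagen t (y * z) = tact iotagen t y * z.
Proof.
elim: t y => [p|c|t IHt u IHu|t IHt u IHu] y /=.
- by rewrite /iotagen mulrA.
- by rewrite ascaleAl.
- by rewrite IHt IHu mulrDl.
- by rewrite IHu IHt.
Qed.

Lemma iota_cls t : iota (pcls (@Urel F m) t) = tact iotagen t 1.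
Proof. exact: tact_iota. Qed.

Lemma iotaD u v : iota (u + v) = iota u + iota v.
Proof. by rewrite -(pclsK u) -(pclsK v) -pcls_add !iota_cls. Qed.
Lemma iotaM u v : iota (u * v) = iota u * iota v.
Proof.
have -> : u * v = pcls (@Urel F m) (Mul (repr u) (repr v)).
  by rewrite [RHS]pcls_mul !pclsK.
by rewrite iota_cls /iota -tact_iotaM mul1r.
Qed.
Lemma iotaZ c u : iota (c *: u) = c *: iota u.
Proof.
have -> : c *: u = pcls (@Urel F m) (Mul (Cst c) (repr u)).
  by rewrite -[RHS]pcls_scale pclsK.
by rewrite iota_cls.
Qed.
Lemma iota_linear : linear iota.
Proof. by move=> c u v; rewrite iotaD iotaZ. Qed.
Lemma iota1 : iota 1 = 1.
Proof. by rewrite -(pcls1 (@Urel F m)) iota_cls /= scale1r. Qed.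
Lemma iota_UE a b : iota (UE F a b) = aE a b - agamma a b.
Proof. by rewrite iota_cls /= /iotagen mulr1. Qed.

Lemma lie_iota_gdA u s : lie (iota u) (gdA s) = 0.
Proof.
rewrite -(pclsK u) iota_cls; elim: (repr u) => [[a b]|c|t IHt v IHv|t IHt v IHv] /=.
- by rewrite /iotagen mulr1 lieBl aE_gd subrr.
- by rewrite /lie ascaleAl ascaleAr mul1r mulr1 subrr.
- by rewrite lieDl IHt IHv addr0.
- have -> : tact iotagen t (tact iotagen v 1) = tact iotagen t 1 * tact iotagen v 1.
    by rewrite -tact_iotaM mul1r.
  by rewrite lieMl IHt IHv mulr0 mul0r addr0.
Qed.

Lemma iota_gdA u s : iota u * gdA s = gdA s * iota u.
Proof. by apply/eqP; rewrite -subr_eq0; apply/eqP; exact: lie_iota_gdA. Qed.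

(** Applied to 1_mu (x) 1 this gives 1_mu (x) g, so it represents that vector in A / I_mu. *)
Definition gvec (g : grass F m n) : A := gdA (ghat g).

Lemma gvec_linear : linear gvec.
Proof.
move=> c g h; rewrite /gvec.
have <- : gdA (Add (Mul (Cst c) (ghat g)) (ghat h)) = gdA (ghat (c *: g + h)).
  apply: gdA_eq => f; rewrite /gd_act /= -!/(gd_act _ _) !gd_act_ghat.
  by rewrite scalerDr !scalerA mulrC.
by rewrite /gdA /= acls_add acls_mul acls_cst ascaleAl mul1r.
Qed.

Lemma gdA_gvec s g : gdA s * gvec g = gvec (gd_act s g).
Proof.
rewrite /gvec -[LHS]acls_mul -[Mul _ _]/(tmap (@AG m n) (Mul s (ghat g))).
apply: gdA_eq => f; rewrite /gd_act /= -!/(gd_act _ _) !gd_act_ghat.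
by rewrite (linear_funZ (gd_act_linear _)).
Qed.

Local Notation I := (@Igens F m n mu).
Local Notation Q := (quotmod (lmults I)).
Local Notation qI := (qcls (lmults I) : A -> Q).
Local Notation qact := (lact (rel := @Arel F m n) (G := I)).

Lemma qact_cls r s : qact r (qI s) = qI (r * s).
Proof. exact: lact_cls. Qed.

Lemma qI_gens r g : I g -> qI (r * g) = 0.
Proof. exact: lact_gen. Qed.

Lemma qI_aD r b k : qI (r * aD b k) = 0.
Proof. by apply: qI_gens; right; exists b, k. Qed.

Lemma qI_agamma r a b : qI (r * agamma a b) = 0.
Proof.
rewrite -[agamma a b]/(\sum_k aX a k * aD b k) mulr_sumr (linear_fun_sum (@qcls_linear _ _ _)) big1 // => k _.
by rewrite mulrA qI_aD.
Qed.

(** Modulo the left ideal each factor d x = 1 - x d of the vacuum projection reduces to 1, starting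
    from the rightmost one. *)
Lemma gvec_gone : qI (gvec (gone F m n)) = qI 1.
Proof.
have -> : gvec (gone F m n) = gdA (vacuum_term F m n).
  by apply: gdA_eq => f; rewrite gd_act_vacuum gd_act_ghat.
rewrite /vacuum_term; elim: (enum _) => [|i r IH] /=; first by rewrite [gdA _]acls_cst scale1r.
rewrite [gdA _]acls_mul -qact_cls IH qact_cls mulr1 [acls _]acls_mul.
rewrite -[acls _ * _]/(aD i.1 i.2 * aX i.1 i.2) aDX !eqxx.
by rewrite qclsD (linear_funN (@qcls_linear _ _ _)) qI_aD subr0.
Qed.

Lemma iota_vgens u g : verma_gens mu g -> qI (iota (u * g) * gvec (gone F m n)) = 0.
Proof.
move=> Gg; rewrite -qact_cls gvec_gone qact_cls mulr1 iotaM.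
case: Gg => [[a [b [ab ->]]]|[a ->]].
  rewrite iota_UE mulrBr (linear_funB (@qcls_linear _ _ _)) qI_agamma subr0.
  by apply: qI_gens; left; left; exists a, b.
rewrite (linear_funB iota_linear) iotaZ iota1 iota_UE addrAC mulrBr.
rewrite (linear_funB (@qcls_linear _ _ _)) qI_agamma subr0.
by apply: qI_gens; left; right; exists a.
Qed.

Lemma gvec_surj g : exists s, gvec g = gdA s * gvec (gone F m n).
Proof. by have [s <-] := gd_act_gone_surj g; exists s; rewrite gdA_gvec. Qed.

(** Well-definedness on the Verma module: [iota u] commutes with the operator creating g, so the
    generators of the Verma ideal can be moved next to the vacuum, where they fall into I_mu. *)
Lemma iota_gvec_eq (u v : U) g : qcls (lmults (verma_gens mu)) u = qcls _ v ->
  qI (iota u * gvec g) = qI (iota v * gvec g).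
Proof.
move=> /qcls_eq uv; apply/eqP; rewrite -subr_eq0; apply/eqP.
rewrite -(linear_funB (@qcls_linear _ _ _)) -mulrBl -(linear_funB iota_linear).
have [s ->] := gvec_surj g; rewrite mulrA iota_gdA -mulrA -qact_cls.
suff -> : qI (iota (u - v) * gvec (gone F m n)) = 0 by exact: (linear_fun0 (lact_linear _)).
elim: uv => [|_ [c [_ [[w [h [Gh ->]]] ->]]]|x y _ IHx _ IHy].
- by rewrite (linear_fun0 iota_linear) mul0r (linear_fun0 (@qcls_linear _ _ _)).
- by rewrite iotaZ ascaleAl qclsZ iota_vgens ?scaler0.
- by rewrite (linear_funB iota_linear) mulrBl (linear_funB (@qcls_linear _ _ _)) IHx IHy subr0.
Qed.

Definition vtens_comp (S : {set gidx m n}) (x : M) : Q := qI (iota (repr x) * gvec (gbase F S)).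

Lemma vtens_comp_cls S u : vtens_comp S (qcls _ u) = qI (iota u * gvec (gbase F S)).
Proof. by apply: iota_gvec_eq; exact: qclsK. Qed.

Lemma vtens_comp_linear S : linear (vtens_comp S).
Proof.
move=> c x y; rewrite -(qclsK x) -(qclsK y) -[_ + _]qcls_linear !vtens_comp_cls.
by rewrite iota_linear mulrDl ascaleAl qclsD qclsZ.
Qed.

Lemma vtens_comp_uact S u x : vtens_comp S (uact u x) = qact (iota u) (vtens_comp S x).
Proof.
rewrite -(qclsK x) uactE (lact_cls (rel := @Urel F m)) !vtens_comp_cls.
by rewrite iotaM qact_cls mulrA.
Qed.

Lemma sum_vtens_comp (g : grass F m n) x :
  \sum_S (g S : F) *: vtens_comp S x = qI (iota (repr x) * gvec g).
Proof.
rewrite [g in RHS]grass_sum (linear_fun_sum gvec_linear) mulr_sumr.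
rewrite (linear_fun_sum (@qcls_linear _ _ _)); apply: eq_bigr => S _.
by rewrite (linear_funZ gvec_linear) ascaleAr qclsZ.
Qed.

(* The inverse of the identification of A / I_mu with the tensor product. *)
Definition vtens_to (t : T) : Q := \sum_S vtens_comp S (t S).

Lemma vtens_to_linear : linear vtens_to.
Proof.
move=> c t v; rewrite /vtens_to scaler_sumr -big_split; apply: eq_bigr => S _ /=.
by rewrite !ffunE vtens_comp_linear.
Qed.

Lemma vtens_to_tensl u t : vtens_to (tensl u t) = qact (iota u) (vtens_to t).
Proof.
rewrite /vtens_to (linear_fun_sum (lact_linear _)); apply: eq_bigr => S _.
by rewrite ffunE vtens_comp_uact.
Qed.

Lemma vtens_to_tensr s t : vtens_to (tensr (gd_act s) t) = qact (gdA s) (vtens_to t).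
Proof.
rewrite /vtens_to (linear_fun_sum (lact_linear _)).
under eq_bigr => S _ do rewrite tensrE (linear_fun_sum (vtens_comp_linear S)).
rewrite exchange_big; apply: eq_bigr => S _ /=.
under eq_bigr => S' _ do rewrite (linear_funZ (vtens_comp_linear S')).
by rewrite sum_vtens_comp qact_cls -gdA_gvec !mulrA iota_gdA.
Qed.

Lemma vtens_to_act s t : vtens_to (tact (@agen_act F m n mu) s t) = qact (acls s) (vtens_to t).
Proof.
elim: s t => [[a b|g]|c|s IHs u IHu|s IHs u IHu] t /=.
- rewrite (linear_funD vtens_to_linear) vtens_to_tensl vtens_to_tensr.
  by rewrite iota_UE agammaE -lactD subrK.
- exact: (vtens_to_tensr (Gen g)).
- by rewrite acls_cst (linear_funZ vtens_to_linear) lactZ lact1.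
- by rewrite (linear_funD vtens_to_linear) IHs IHu acls_add lactD.
- by rewrite IHs IHu acls_mul lactM.
Qed.

Local Notation one := (tens (verma1 mu) (gone F m n) : T).

(** This is the injectivity of A / I_mu -> M_mu (x) G: an element acting by zero on 1_mu (x) 1 has
    class zero. *)
Lemma vtens_to_aact Y : vtens_to (aact Y one) = qI Y.
Proof.
have [s ->] := acls_surj Y; rewrite aact_cls vtens_to_act -[acls s in RHS]mulr1.
rewrite -qact_cls; congr (qact _ _).
rewrite /vtens_to; under eq_bigr => S _ do rewrite ffunE (linear_funZ (vtens_comp_linear S)).
rewrite sum_vtens_comp (@iota_gvec_eq _ 1) ?iota1 ?mul1r ?gvec_gone //.
exact: qclsK.
Qed.

Lemma vtens_to_nspan t : gen_subgroup (scaled (@nspan F m n mu)) t ->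
  exists2 Y : A, Jideal Y & vtens_to t = qI Y.
Proof.
elim=> [|_ [c [_ [[a [b [t' [ab ->]]]] ->]]]|x y _ [Y JY xY] _ [Z JZ yZ]].
- exists 0; first exact: gs0.
  by rewrite (linear_fun0 vtens_to_linear) (linear_fun0 (@qcls_linear _ _ _)).
- exists (aE a b * (c *: repr (vtens_to t'))).
    by apply: gs_mem; exists (c *: repr (vtens_to t')), (aE a b); split=> //; exists a, b.
  rewrite (linear_funZ vtens_to_linear) (vtens_to_act (Gen (AE n a b))).
  by rewrite ascaleAr qclsZ.
- exists (Y - Z); first exact: gsB.
  by rewrite (linear_funB vtens_to_linear) xY yZ (linear_funB (@qcls_linear _ _ _)).
Qed.

Lemma coinv_ofE Y : coinv_of mu Y = qcls (@nspan F m n mu) (aact Y one).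
Proof. by []. Qed.

Lemma coinv_of_linear : linear (@coinv_of F m n mu).
Proof. by move=> c Y Z; rewrite !coinv_ofE aactD aactZ qclsD qclsZ. Qed.

(** The left inverse carries the image of n into the classes of J; subtracting such an element
    leaves something in I_mu. *)
Lemma coinv_of_eq0 Y : coinv_of mu Y = 0 ->
  exists j i : A, [/\ Jideal j, Iideal mu i & Y = j + i].
Proof.
rewrite coinv_ofE -(linear_fun0 (@qcls_linear _ _ (@nspan F m n mu))).
move=> /qcls_eq; rewrite subr0 => /vtens_to_nspan[j Jj].
rewrite vtens_to_aact => /qcls_eq/(scaled_lmults (rel := @Arel F m n)) H.
by exists j, (Y - j); split=> //; rewrite addrC subrK.
Qed.

End Identification.

(** * Weights and denominators *)

Lemma mpoly_ring_ind (F : fieldType) (m : nat) (P : {mpoly F[m]} -> Prop) :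
  (forall c, P c%:MP) -> (forall p q, P p -> P q -> P (p + q)) ->
  (forall a p, P p -> P ('X_a * p)) -> forall p, P p.
Proof.
move=> PC PD PX; apply: mpolyind => [|c k p _ _ Pp]; first by rewrite -mpolyC0.
apply: PD => //; rewrite -mul_mpolyC mulrC.
suff Q : forall q, P q -> P ('X_[k] * q) by exact/Q/PC.
rewrite mpolyXE_id; apply: (big_ind (fun r => forall q, P q -> P (r * q))).
- by move=> q; rewrite mul1r.
- by move=> r s Pr Ps q Pq; rewrite -mulrA; exact/Pr/Ps.
move=> a _; elim: (k a) => [|j IH] q Pq; first by rewrite expr0 mul1r.
by rewrite exprS -mulrA; exact/PX/IH.
Qed.

Lemma prodrM_commute (R : pzRingType) (I : Type) (r : seq I) (f g : I -> R) :
  (forall i j, g i * f j = f j * g i) ->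
  \prod_(i <- r) (f i * g i) = (\prod_(i <- r) f i) * \prod_(i <- r) g i.
Proof.
move=> gf; elim: r => [|i r IH]; first by rewrite !big_nil mulr1.
rewrite !big_cons IH -!mulrA; congr (_ * _); rewrite !mulrA; congr (_ * _).
elim: r {IH} => [|j r IH]; first by rewrite big_nil mulr1 mul1r.
by rewrite big_cons mulrA gf -mulrA IH mulrA.
Qed.

Lemma lie_eq (R : pzRingType) (x y z : R) : lie x y = z -> x * y = y * x + z.
Proof. by move=> <-; rewrite /lie addrC subrK. Qed.

Lemma commute_expr (R : pzRingType) (x y : R) k l :
  x * y = y * x -> x ^+ k * y ^+ l = y ^+ l * x ^+ k.
Proof.
move=> xy; have xyl j : x * y ^+ j = y ^+ j * x.
  elim: j => [|j IH]; first by rewrite expr0 mulr1 mul1r.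
  by rewrite exprS mulrA xy -mulrA IH mulrA.
elim: k => [|k IH]; first by rewrite expr0 mulr1 mul1r.
by rewrite exprS -mulrA IH mulrA xyl mulrA.
Qed.

(** * U(h) inside A, and the denominators *)

Section Cartan.
Variables (F : fieldType) (m n : nat).
Local Notation A := (Aalg F m n).
Local Notation aE a b := (@aE F m n a b).
Local Notation uh := (@uh F m n).
Implicit Types (p q : {mpoly F[m]}).

Lemma aE_cartan_commute a b : aE a a * aE b b = aE b b * aE a a.
Proof.
apply/eqP; rewrite -subr_eq0 -/(lie _ _) aE_com.
by case: (eqVneq a b) => [->|_]; rewrite ?subrr ?subr0.
Qed.

Lemma lie_cartan c a b : lie (aE c c) (aE a b) = aE a b *+ (c == a) - aE a b *+ (c == b).
Proof.
by rewrite aE_com; case: eqVneq => [->|_]; case: eqVneq => [->|_].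
Qed.

Definition hmon (k : 'X_{1..m}) : A := \prod_(a < m) aE a a ^+ k a.

(** The sum defining [uh p] runs over a support that depends on p; monomials of bounded degree give
    a common index set, as linearity requires. *)
Lemma uhwE d p : (msize p <= d)%N ->
  uh p = \sum_(k : 'X_{1..m < d}) p@_k *: hmon k.
Proof.
move=> pd; pose I : subFinType _ := 'X_{1..m < d}.
rewrite /Defs.uh (ssrcomplements.big_mksub I) //=; first last.
- by move=> k /msize_mdeg_lt /leq_trans; apply.
- by rewrite msupp_uniq.
by rewrite big_rmcond //= => i /memN_msupp_eq0 ->; rewrite scale0r.
Qed.

Lemma uh_linear : linear uh.
Proof.
move=> c p q; pose d := maxn (msize (c *: p + q)) (maxn (msize p) (msize q)).
rewrite !(@uhwE d) ?leq_maxl // /d; try by rewrite !leq_max leqnn ?orbT.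
rewrite scaler_sumr -big_split; apply: eq_bigr => k _ /=.
by rewrite mcoeffD mcoeffZ scalerDl scalerA.
Qed.

Lemma uhD p q : uh (p + q) = uh p + uh q. Proof. exact: linear_funD uh_linear _ _. Qed.
Lemma uhB p q : uh (p - q) = uh p - uh q. Proof. exact: linear_funB uh_linear _ _. Qed.
Lemma uhZ c p : uh (c *: p) = c *: uh p. Proof. exact: linear_funZ uh_linear _ _. Qed.

Lemma uhXm k : uh 'X_[k] = hmon k.
Proof. by rewrite /Defs.uh msuppX big_seq1 mcoeffX eqxx scale1r. Qed.

Lemma uh1 : uh 1 = 1.
Proof.
rewrite -mpolyX0 uhXm /hmon big1 // => a _.
by rewrite mnm0E expr0.
Qed.

Lemma uhC c : uh c%:MP = c *: (1 : A).
Proof. by rewrite -uh1 -uhZ -mul_mpolyC mulr1. Qed.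

Lemma hmonU a k : hmon (U_(a) + k) = aE a a * hmon k.
Proof.
rewrite /hmon; under eq_bigr => b _ do rewrite mnmDE mnm1E exprD.
rewrite prodrM_commute; last first.
  by move=> b c; apply: commute_expr; exact: aE_cartan_commute.
congr (_ * _).
rewrite -[RHS](big_pred1_eq *%R a (fun b => aE b b)) [RHS]big_mkcond /=.
by apply: eq_bigr => b _; rewrite eq_sym; case: eqVneq.
Qed.

Lemma uhXM a p : uh ('X_a * p) = aE a a * uh p.
Proof.
elim/mpolyind: p => [|c k p _ _ IH].
  by rewrite mulr0 (linear_fun0 uh_linear) mulr0.
rewrite mulrDr uhD IH [uh (_ + p)]uhD mulrDr; congr (_ + _).
by rewrite -scalerAr -mpolyXD !uhZ !uhXm hmonU ascaleAr.
Qed.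

Lemma uhX a : uh 'X_a = aE a a.
Proof. by rewrite -[X in uh X]mulr1 uhXM uh1 mulr1. Qed.

Lemma uhM p q : uh (p * q) = uh p * uh q.
Proof.
elim/mpoly_ring_ind: p => [c|p p' IH IH'|a p IH].
- by rewrite mul_mpolyC uhZ uhC ascaleAl mul1r.
- by rewrite mulrDl !uhD IH IH' mulrDl.
- by rewrite -mulrA !uhXM IH mulrA.
Qed.

Lemma uh_commute p q : uh p * uh q = uh q * uh p.
Proof. by rewrite -!uhM mulrC. Qed.

Definition hperm (s : 'S_m) p : {mpoly F[m]} := p \mPo [tuple 'X_(s a) | a < m].

Lemma alg_perm_uh s p : alg_perm s (uh p) = uh (hperm s p).
Proof.
rewrite /hperm; elim/mpoly_ring_ind: p => [c|p p' IH IH'|a p IH].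
- by rewrite comp_mpolyC !uhC alg_permC.
- by rewrite comp_mpolyD !uhD alg_permD IH IH'.
- rewrite rmorphM /= comp_mpolyXU -tnth_nth tnth_mktuple !uhXM alg_permM IH.
  by rewrite alg_perm_aE.
Qed.

Lemma denoms1 : @denoms F m 1.
Proof. by exists [::]; rewrite big_nil. Qed.

Lemma denomsM p q : @denoms F m p -> @denoms F m q -> @denoms F m (p * q).
Proof.
move=> [r [rd ->]] [s [sd ->]]; exists (r ++ s).
by rewrite all_cat rd sd big_cat.
Qed.

(** Permutations of the variables ([z] zero) and the shift by eps_c ([f] the identity) are both
    substitutions of this form. *)
Lemma denoms_comp (lq : m.-tuple {mpoly F[m]}) (f : 'I_m -> 'I_m) (z : 'I_m -> int) :
  injective f -> (forall a, tnth lq a = 'X_(f a) + (z a)%:~R%:MP) ->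
  forall p, @denoms F m p -> @denoms F m (p \mPo lq).
Proof.
move=> f_inj lqE p [r [rd ->]].
exists [seq (f i.1.1, f i.1.2, i.2 + z i.1.1 - z i.1.2) | i <- r]; split.
  by rewrite all_map; apply: sub_all rd => i /=; rewrite (inj_eq f_inj).
rewrite big_map rmorph_prod; apply: eq_bigr => i _ /=.
rewrite rmorphD rmorphB /= !comp_mpolyXU -!tnth_nth !lqE comp_mpolyC.
rewrite !rmorphD !rmorphN /=; ring.
Qed.

Lemma denoms_hperm s p : @denoms F m p -> @denoms F m (hperm s p).
Proof.
apply: (denoms_comp (f := s) (z := fun=> 0)); first exact: perm_inj.
by move=> a; rewrite tnth_mktuple addr0.
Qed.

Lemma denoms_shift c p : @denoms F m p -> @denoms F m (uh_shift c p).
Proof.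
apply: (denoms_comp (f := id) (z := fun a => (a == cL c)%:R - (a == cR c)%:R)) => // a.
rewrite tnth_mktuple ffunE; congr (_ + _%:MP).
by case: (a == cL c); case: (a == cR c); rewrite ?subrr ?subr0 ?sub0r.
Qed.

Lemma uh_shiftX c a : uh_shift c ('X_a : {mpoly F[m]}) = 'X_a + (eps F c a)%:MP.
Proof. by rewrite /uh_shift comp_mpolyXU -tnth_nth tnth_mktuple. Qed.

Lemma uh_shiftM c p q : uh_shift c (p * q) = uh_shift c p * uh_shift c q.
Proof. by rewrite /uh_shift rmorphM. Qed.

(** J is generated as a right ideal, but h normalizes n, so it absorbs U(h) on the left as well.
    This allows denominators to be cleared in Jbar. *)
Lemma uh_Jideal p (Y : A) : Jideal Y -> Jideal (uh p * Y).
Proof.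
elim/mpoly_ring_ind: p Y => [c|p q IHp IHq|a p IH] Y JY.
- rewrite uhC ascaleAl mul1r.
  move: Y JY; apply: gs_morph => [|Y Z|_ [Y [X [X_gen ->]]]]; first exact: scaler0.
    exact: scalerBr.
  by apply: gs_mem; exists (c *: Y), X; rewrite ascaleAr.
- by rewrite uhD mulrDl; apply: gsD; [exact: IHp|exact: IHq].
- rewrite uhXM -mulrA; move: (uh p * Y) (IH Y JY) => {JY}Y.
  move: Y; apply: gs_morph => [|Y Z|_ [Y [_ [[b [c [cb ->]]] ->]]]].
  + exact: mulr0.
  + exact: mulrBr.
  rewrite mulrA (lie_eq (lie_cartan a b c)) mulrDl -mulrA.
  have gen Z : Jideal (aE b c * Z).
    by apply: gs_mem; exists Z, (aE b c); split=> //; exists b, c.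
  apply: gsD; first exact: gen.
  by rewrite mulrBl !mulrnAl; apply: gsB; apply: gsMn; exact: gen.
Qed.

Lemma Iideal_mul mu (X Y : A) : Iideal mu Y -> Iideal mu (X * Y).
Proof. exact: (lideal_mul (rel := @Arel F m n)). Qed.

End Cartan.

Definition generic_weight (F : fieldType) (m : nat) (mu : weight F m) :=
  forall a b : 'I_m, a != b -> forall z : int, mu a - mu b <> z%:~R.

(** * Weight vectors and cancellation of denominators on coinvariants *)

Section Weights.
Variables (F : fieldType) (m n : nat) (mu : weight F m).
Hypothesis mu_generic : generic_weight mu.
Local Notation A := (Aalg F m n).
Local Notation T := (vtens n mu).
Local Notation aE a b := (@aE F m n a b).
Local Notation uh := (@uh F m n).
Local Notation one := (tens (verma1 mu) (gone F m n) : T).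
Implicit Types (t : T) (w : weight F m).

(** Each generator of A shifts weights by integers, so starting from 1_mu (x) 1 only weights in mu +
    Z^m occur; on these the genericity of mu keeps denominators from vanishing. *)
Definition weight_vectors : set T := [set t | exists w,
  (forall a, exists z : int, w a = mu a + z%:~R) /\
  forall a, aact (aE a a) t = w a *: t].

Lemma weight_vector_lie (Y : A) (z : 'I_m -> int) t :
  (forall a, lie (aE a a) Y = Y *~ z a) ->
  weight_vectors t -> weight_vectors (aact Y t).
Proof.
move=> Yz [w [wz tw]]; exists [ffun a => w a + (z a)%:~R]; split=> a.
  have [k wk] := wz a; exists (k + z a).
  by rewrite ffunE wk rmorphD /= addrA.
rewrite -aactM (lie_eq (Yz a)) aactD aactM tw (linear_funZ (aact_linear _)) ffunE.
by rewrite -scaler_int aactZ scalerDl.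
Qed.

Lemma aact_weight_vectors (Y : A) t :
  gen_subgroup weight_vectors t -> gen_subgroup weight_vectors (aact Y t).
Proof.
have [s ->] := acls_surj Y.
have morph (Z : A) : (forall t, weight_vectors t -> weight_vectors (aact Z t)) ->
    forall t, gen_subgroup weight_vectors t -> gen_subgroup weight_vectors (aact Z t).
  move=> H; apply: gs_morph; first exact: linear_fun0 (aact_linear _).
    by move=> v w; rewrite (linear_funB (aact_linear _)).
  by move=> v /H; apply: gs_mem.
elim: s t => [[a b|[a k|b k]]|c|s IHs u IHu|s IHs u IHu] t.
- apply: morph => v; apply: (@weight_vector_lie _ (fun d => (d == a)%:R - (d == b)%:R)) => d.
  rewrite -[acls _]/(aE a b) lie_cartan mulrzBr.
  by case: (d == a); case: (d == b); rewrite ?mulr1z ?mulr0z ?mulr1n ?mulr0n.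
- apply: morph => v; apply: (@weight_vector_lie _ (fun d => (d == a)%:R)) => d.
  rewrite -[acls _]/(aX F a k) aE_X.
  by case: eqVneq => [->|_].
- apply: morph => v; apply: (@weight_vector_lie _ (fun d => - (d == b)%:R)) => d.
  rewrite -[acls _]/(aD F b k) aE_D mulrNz.
  by case: eqVneq => [->|_].
- rewrite acls_cst; apply: morph => v [w [wz vw]]; exists w; split=> // a.
  by rewrite aactC (linear_funZ (aact_linear _)) vw !scalerA mulrC.
- by move=> tw; rewrite acls_add aactD; apply: gsD; [exact: IHs|exact: IHu].
- by move=> tw; rewrite acls_mul aactM; apply/IHs/IHu.
Qed.

Lemma one_weight a : aact (aE a a) one = mu a *: one.
Proof.
apply/eqP; rewrite -subr_eq0 -aactC -aactB; apply/eqP/aact_Igens.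
by left; right; exists a.
Qed.

Lemma aact_uh_weight w t p : (forall a, aact (aE a a) t = w a *: t) ->
  aact (uh p) t = p.@[w] *: t.
Proof.
move=> tw; elim/mpoly_ring_ind: p => [c|p q IHp IHq|a p IH].
- by rewrite uhC aactC mevalC.
- by rewrite uhD aactD IHp IHq mevalD scalerDl.
- rewrite uhXM aactM IH (linear_funZ (aact_linear _)) tw mevalM mevalXU.
  by rewrite scalerA mulrC.
Qed.

Lemma denoms_eval_neq0 w d : (forall a, exists z : int, w a = mu a + z%:~R) ->
  @denoms F m d -> d.@[w] != 0.
Proof.
move=> wz [r [/allP rd ->]]; rewrite rmorph_prod prodf_seq_neq0.
apply/allP => -[[a b] z] /rd /= ab.
rewrite mevalD mevalB !mevalXU mevalC; apply/eqP.
have [k ->] := wz a; have [l ->] := wz b => E.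
apply: (mu_generic ab (z := l - k - z)).
rewrite !rmorphB /=; apply/eqP; rewrite -subr_eq0 -[X in _ == X]E; apply/eqP.
ring.
Qed.

Lemma weight_vectors_killed d t : @denoms F m d -> gen_subgroup weight_vectors t ->
  exists2 cs : seq F, all (fun c => c != 0) cs &
    aact (uh (\prod_(c <- cs) (d - c%:MP))) t = 0.
Proof.
move=> dd; elim=> [|{}t [w [wz tw]]|{}t v _ [cs csn0 IHt] _ [ds dsn0 IHv]].
- by exists [::] => //; rewrite (linear_fun0 (aact_linear _)).
- exists [:: d.@[w]]; first by rewrite /= denoms_eval_neq0.
  by rewrite big_seq1 (aact_uh_weight _ tw) mevalB mevalC subrr scale0r.
- exists (cs ++ ds); first by rewrite all_cat csn0.
  rewrite big_cat (linear_funB (aact_linear _)) [X in aact (uh X) t]mulrC /= !uhM.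
  by rewrite !aactM IHt IHv !(linear_fun0 (aact_linear _)) subrr.
Qed.

Local Notation N := (gen_subgroup (scaled (@nspan F m n mu))).

Lemma nspan_scale c t : N t -> N (c *: t).
Proof. by move=> Nt; apply/asboolP/zspan_scaled/asboolP. Qed.

Lemma nspan_uh p t : N t -> N (aact (uh p) t).
Proof.
elim/mpoly_ring_ind: p t => [c|p q IHp IHq|a p IH] t Nt.
- by rewrite uhC aactC; exact: nspan_scale.
- by rewrite uhD aactD; apply: gsD; [exact: IHp|exact: IHq].
- rewrite uhXM aactM; move: (aact (uh p) t) (IH t Nt) => {Nt}t.
  move: t; apply: gs_morph => [|t v|_ [k [_ [[b [c [t [cb ->]]]] ->]]]].
  + exact: linear_fun0 (aact_linear _).
  + exact: linear_funB (aact_linear _) _ _.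
  rewrite (linear_funZ (aact_linear _)); apply: nspan_scale.
  have -> v : agen_act (AE n b c) v = aact (aE b c) v :> T.
    by rewrite (aact_cls (Gen (AE n b c))).
  rewrite -aactM (lie_eq (lie_cartan F n a b c)) aactD aactM.
  have gen v : N (aact (aE b c) v).
    apply: gs_mem; exists 1, (aact (aE b c) v); rewrite scale1r; split=> //.
    by exists b, c, v; split=> //; rewrite (aact_cls (Gen (AE n b c))).
  apply: gsD; first exact: gen.
  rewrite aactB -!scaler_nat !aactZ.
  by apply: gsB; apply: nspan_scale; exact: gen.
Qed.

(** One factor is removed at a time: the induction hypothesis applies to (d - c) t, and d t - (d -
    c) t = c t with c invertible. *)
Lemma nspan_uh_cancel d cs t : all (fun c => c != 0) cs ->
  aact (uh (\prod_(c <- cs) (d - c%:MP))) t = 0 -> N (aact (uh d) t) -> N t.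
Proof.
elim: cs t => [|c cs IH] t /=.
  by move=> _; rewrite big_nil uh1 -[X in aact X](scale1r (1 : A)) aactC scale1r => -> _; exact: gs0.
case/andP=> c0 csn0; rewrite big_cons mulrC uhM aactM => kt Ndt.
have : N (aact (uh (d - c%:MP)) t).
  by apply: IH => //; rewrite -aactM uh_commute aactM; exact: nspan_uh.
rewrite uhB aactB uhC aactC => Nt.
rewrite -[t]scale1r -(mulVf c0) -scalerA; apply: nspan_scale.
have -> : c *: t = aact (uh d) t - (aact (uh d) t - c *: t).
  by rewrite opprB addrC subrK.
exact: gsB.
Qed.

(* Y (1_mu (x) 1) is a sum of weight vectors, on which d has nonzero eigenvalues
   c_i; hence prod_i (d - c_i) kills it, and modulo the image of n, where d kills
   it as well, prod_i (- c_i) does. *)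
Lemma coinv_of_denom_eq0 d (Y : A) : @denoms F m d ->
  (exists j i : A, [/\ Jideal j, Iideal mu i & uh d * Y = j + i]) ->
  coinv_of mu Y = 0.
Proof.
move=> dd [j [i [Jj Ii E]]]; rewrite coinv_ofE.
rewrite -(linear_fun0 (@qcls_linear _ _ (@nspan F m n mu))).
apply/qcls_eq; rewrite subr0.
have wv : gen_subgroup weight_vectors (aact Y one).
  apply/aact_weight_vectors/gs_mem; exists mu; split=> a; last exact: one_weight.
  by exists 0; rewrite addr0.
have [cs csn0 kt] := weight_vectors_killed dd wv.
apply: (nspan_uh_cancel csn0 kt); rewrite -aactM E aactD (aact_Iideal Ii) addr0.
exact: aact_Jideal.
Qed.

End Weights.

(** * Zhelobenko operators *)

(* In the application a s is the coefficient (s! H^(s))^-1 of xi_c, and y s is the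
   s-th iterate of ad F_c on a given element. *)
Section Telescoping.
Variables (R : pzRingType) (e f h : R) (a : nat -> R).
Variables (D : R -> Prop) (J : set R).
Hypothesis aS : forall s, (a s.+1 * (h - s%:R)) *+ s.+1 = a s.
Hypothesis eh : e * h - h * e = - (e *+ 2).
Hypothesis ef : e * f - f * e = h.
Hypothesis De : forall z, D z -> D (e * z).
Hypothesis Jf : forall s z, D z -> gen_subgroup J (a s * (f * z)).
Local Notation K := (gen_subgroup J).

Lemma expe_weight g k s z : (forall x, k * x = x * k) -> e * g - g * e = - (k * e) ->
  e ^+ s * (g * z) = g * (e ^+ s * z) - k * (e ^+ s * z) *+ s.
Proof.
move=> kC eg; have eg' x : e * (g * x) = g * (e * x) - k * (e * x).
  by rewrite !mulrA -[in RHS]mulNr -mulrDl -eg addrC subrK.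
elim: s => [|s IH]; first by rewrite !expr0 !mul1r subr0.
rewrite exprS -!mulrA IH mulrBr eg' mulrnAr [e * (k * _)]mulrA -kC -mulrA.
by rewrite -addrA -opprD -mulrS.
Qed.

Lemma expe_h s z : e ^+ s * (h * z) = h * (e ^+ s * z) - (e ^+ s * z) *+ (2 * s).
Proof.
rewrite (@expe_weight h 2%:R); last by rewrite eh mulr_natl.
  by rewrite mulr_natl -mulrnA.
by move=> x; rewrite mulr_natl mulr_natr.
Qed.

(** The sl_2 identity [e^(s+1), f] = (s+1)(h - s) e^s. The factor h - s is the one by which H^(s+1)
    exceeds H^(s). *)
Lemma expe_f s z : e ^+ s.+1 * (f * z) =
  f * (e ^+ s.+1 * z) + (h * (e ^+ s * z) - (e ^+ s * z) *+ s) *+ s.+1.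
Proof.
have ef' x : e * (f * x) = f * (e * x) + h * x.
  by rewrite !mulrA -[in RHS]mulrDl -ef addrC subrK.
elim: s => [|s IH]; first by rewrite !expr1 expr0 !mul1r subr0 ef'.
rewrite exprS -!mulrA IH mulrDr ef' -addrA; congr (_ + _).
rewrite mulrnAr mulrBr mulrnAr.
have -> : e * (h * (e ^+ s * z)) = h * (e * (e ^+ s * z)) - (e * (e ^+ s * z)) *+ 2.
  by have := expe_h 1 (e ^+ s * z); rewrite expr1.
rewrite ![e * (e ^+ s * z)]mulrA -exprS -addrA -opprD -mulrnDr !mulrnBl addrA -mulrS.
by rewrite -!mulrnA add2n mulnC.
Qed.

Lemma a_hB s x : (a s.+1 * (h * x - x *+ s)) *+ s.+1 = a s * x.
Proof. by rewrite -[in RHS]aS mulrnAl -mulrA mulrBl mulr_natl. Qed.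

(** The recursion [aS] cancels (s+1)(h - s) in the bracket of e^(s+1) with f: modulo K, a right
    factor f lowers s by one, and every telescoping sum below uses this. [Jf] is assumed on [D]
    only, in the application the image of A, where membership in Jbar is available. *)
Lemma K_ef s z : D z -> K (a s.+1 * (e ^+ s.+1 * (f * z)) - a s * (e ^+ s * z)).
Proof.
move=> Dz; rewrite expe_f mulrDr mulrnAr a_hB addrK.
apply: Jf; elim: s.+1 => [|k IH]; first by rewrite mul1r.
by rewrite exprS -mulrA; exact: De.
Qed.

Lemma a_eh s z : (a s.+1 * (e ^+ s.+1 * (h * z))) *+ s.+1 =
  a s * (e ^+ s.+1 * z) - (a s.+1 * (e ^+ s.+1 * z)) *+ (s.+2 * s.+1).
Proof.
rewrite expe_h -[a s * _]a_hB !mulrBr !mulrnBl -[in RHS]addrA -opprD !mulrnAr -!mulrnA -mulrnDr.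
by congr (_ - _ *+ _); ring.
Qed.

Lemma K_telescope (t V : nat -> R) N : K (t 0 - V 0) ->
  (forall s, K (t s.+1 - (V s.+1 - V s))) -> K (\sum_(s < N.+1) t s - V N).
Proof.
move=> K0 KS; elim: N => [|N IH]; first by rewrite big_ord1.
rewrite big_ord_recr /=; set S := \sum_(s < N.+1) t s in IH *.
have -> : S + t N.+1 - V N.+1 = S - V N + (t N.+1 - (V N.+1 - V N)).
  by rewrite opprB [t _ + (_ - _)]addrCA [RHS]addrA subrK addrA.
exact: gsD.
Qed.

Lemma K_telescope0 (t V : nat -> R) N : V N = 0 -> K (t 0 - V 0) ->
  (forall s, K (t s.+1 - (V s.+1 - V s))) -> K (\sum_(s < N.+1) t s).
Proof. by move=> VN K0 KS; have := K_telescope N K0 KS; rewrite VN subr0. Qed.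

Variables (y : nat -> R).
Hypothesis Dy : forall s, D (y s).
Local Notation T s := (a s * (e ^+ s * y s)).

Section Weight.
Variables (N : nat) (k : R).
Hypothesis kC : forall z, k * z = z * k.
Hypothesis Kk : forall z, K z -> K (k * z).
Hypothesis yN : y N = 0.

Lemma ae_k s z : a s * (e ^+ s * (k * z)) = k * (a s * (e ^+ s * z)).
Proof. by rewrite [e ^+ _ * (k * _)]mulrA -kC -mulrA [a _ * (k * _)]mulrA -kC -mulrA. Qed.

(** With T_s = a_s e^s y_s: moving g left past e^s costs s k T_s, while the f-term gives back s k
    T_(s-1) by [K_ef]. Collecting the coefficient of T_s leaves g + k, the origin of the shift by
    eps_c. [V] is the partial sum with the boundary term at s. *)
Lemma sum_left_weight g :
  e * g - g * e = - (k * e) -> (forall s, a s * g = g * a s) ->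
  K (\sum_(s < N.+1) a s * (e ^+ s * (g * y s + (k * (f * y s.-1)) *+ s)) -
     (g + k) * \sum_(s < N) T s).
Proof.
move=> eg ag.
have term s : a s * (e ^+ s * (g * y s + (k * (f * y s.-1)) *+ s)) =
    (g * T s - k * T s *+ s) + k * (a s * (e ^+ s * (f * y s.-1))) *+ s.
  rewrite mulrDr mulrDr (expe_weight _ _ kC eg) mulrBr mulrA ag -mulrA.
  rewrite !mulrnAr ae_k; congr (_ - _ *+ _ + _).
  by rewrite mulrA -kC -mulrA.
pose V s := (g + k) * (\sum_(j < s) T j) + (g * T s - k * T s *+ s).
have -> : (g + k) * (\sum_(s < N) T s) = V N.
  by rewrite /V yN !mulr0 mul0rn subr0 addr0.
apply: (K_telescope (t := fun s => a s * (e ^+ s * (g * y s + (k * (f * y s.-1)) *+ s)))) => [|s].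
  by rewrite term /V big_ord0 /= !mulr0n mulr0 addr0 add0r subrr; exact: gs0.
have -> : V s.+1 - V s = g * T s.+1 - k * T s.+1 *+ s.+1 + k * T s *+ s.+1.
  rewrite /V big_ord_recr /= mulrDr -[_ + _ + (_ - _)]addrA opprD addrACA subrr add0r.
  rewrite opprB [(g + k) * T s]mulrDl addrC -[g * T s + _ + _]addrA subrKA.
  by rewrite addrA addrC -mulrSr.
rewrite term opprD addrACA subrr add0r -mulrnBl -mulrBr.
exact/gsMn/Kk/K_ef/Dy.
Qed.

(** The terms with y_s x lie in K by assumption. In the others y_(s-1) f = f y_(s-1) - y_s leads to
    s k T_(s-1) - (s+1) k T_s modulo K, which telescopes. *)
Lemma sum_right_weight x : (forall s, y s * f = f * y s - y s.+1) ->
  (forall s, K (a s * (e ^+ s * (y s * x)))) ->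
  K (\sum_(s < N.+1) a s * (e ^+ s * (y s * x - k * y s + (k * (y s.-1 * f)) *+ s))).
Proof.
move=> yf Kx; pose V s := - (k * T s *+ s.+1).
apply: (K_telescope0 (V := V) (t := fun s =>
  a s * (e ^+ s * (y s * x - k * y s + (k * (y s.-1 * f)) *+ s)))) => [||s].
  by rewrite /V yN !mulr0 mul0rn oppr0.
  by rewrite /V mulr0n addr0 mulr1n opprK 2!mulrBr ae_k subrK; exact: Kx.
have -> : a s.+1 * (e ^+ s.+1 * (y s.+1 * x - k * y s.+1 + k * (y s * f) *+ s.+1)) =
  a s.+1 * (e ^+ s.+1 * (y s.+1 * x)) +
  k * (a s.+1 * (e ^+ s.+1 * (f * y s))) *+ s.+1 - k * T s.+1 *+ s.+2.
  rewrite !(mulrDr, mulrN) !mulrnAr !ae_k yf !(mulrDr, mulrN) mulrnDl mulNrn addrACA.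
  by rewrite -opprD -mulrS.
rewrite /V opprK [- _ + _]addrC opprB subrKA -addrA -mulrnBl -mulrBr.
by apply: gsD => //; exact/gsMn/Kk/K_ef/Dy.
Qed.
End Weight.

(** Writing y_s f as f y_s - y_(s+1), the first part becomes a_(s-1) e^(s-1) y_s by [K_ef] and
    cancels the second part of the preceding term. *)
Lemma sum_right_f N : y N.+1 = 0 -> (forall s, y s * f = f * y s - y s.+1) ->
  K (\sum_(s < N.+1) a s * (e ^+ s * (y s * f))).
Proof.
move=> yN yf; pose V s := - (a s * (e ^+ s * y s.+1)).
apply: (K_telescope0 (V := V) (t := fun s => a s * (e ^+ s * (y s * f)))) => [||s].
  by rewrite /V yN !mulr0 oppr0.
  by rewrite /V !expr0 !mul1r opprK yf mulrBr subrK; exact: Jf.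
by rewrite /V yf !mulrBr opprK opprD opprK addrA subrK; exact: K_ef.
Qed.

(** By [a_eh] the h-term splits into a_(s-1) e^s y_(s-1), which telescopes with the e-term, and a
    multiple (s+1)s of a_s e^s y_(s-1), which telescopes with the f-term through [K_ef]. [V] adds
    the two potentials. *)
Lemma sum_left_e N : y N = 0 -> y N.-1 = 0 ->
  K (\sum_(s < N.+1) a s * (e ^+ s *
       (e * y s - (h * y s.-1) *+ s - (f * y s.-2) *+ (s * s.-1)))).
Proof.
move=> yN yN1; pose S s := a s * (e ^+ s.+1 * y s).
pose V s := S s + a s * (e ^+ s * y s.-1) *+ (s.+1 * s).
apply: (K_telescope0 (V := V) (t := fun s => a s * (e ^+ s *
  (e * y s - (h * y s.-1) *+ s - (f * y s.-2) *+ (s * s.-1))))) => [||s].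
  by rewrite /V /S yN yN1 !mulr0 mul0rn addr0.
  by rewrite /V /S /= !mulr0n !subr0 addr0 expr0 expr1 mul1r subrr; exact: gs0.
rewrite /= !mulrBr !mulrnAr a_eh [e ^+ _ * (e * _)]mulrA -exprSr -/(S s.+1) -/(S s).
rewrite /V /=; set X := a s.+1 * (e ^+ s.+1 * y s) *+ _.
rewrite opprB [S _ + (_ - _)]addrA; set B := S s.+1 + X; rewrite opprB.
set P := a s * _ *+ _; set Q := a s.+1 * _ *+ _.
have -> : B - S s - Q + (S s + P - B) = - (Q - P).
  by rewrite addrC -[B - S s - _]addrA subrKA [S s + _]addrC -addrA addNKr opprB.
rewrite /P /Q -mulrnBl.
exact/gsN/gsMn/K_ef.
Qed.

End Telescoping.

(** * Iterates of ad F_c: local nilpotency and Leibniz formulas *)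

Section LocallyNilpotent.
Variables (F : fieldType) (m n : nat) (c : 'I_m.-1).
Local Notation A := (Aalg F m n).
Local Notation E := (Ec F n c).
Local Notation Fm := (Fc F n c).
Local Notation H := (Hc F n c).
Local Notation L := (cL c).
Local Notation R := (cR c).
Local Notation aE a b := (@aE F m n a b).
Local Notation ad := (@adF F m n c).
Local Notation ep := (eps F c).
Implicit Types Y Z : A.

Lemma neq_cLR : (L == R) = false.
Proof. by apply/negbTE; rewrite -val_eqE /= neq_ltn ltnSn. Qed.

Lemma adFE Y : ad Y = lie Fm Y. Proof. by []. Qed.

Lemma adFD Y Z : ad (Y + Z) = ad Y + ad Z. Proof. exact: lieDr. Qed.
Lemma adFB Y Z : ad (Y - Z) = ad Y - ad Z. Proof. exact: lieBr. Qed.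
Lemma adF0 : ad 0 = 0. Proof. exact: lie0r. Qed.
Lemma adFM Y Z : ad (Y * Z) = ad Y * Z + Y * ad Z. Proof. exact: lieMr. Qed.
Lemma adFZ (k : F) Y : ad (k *: Y) = k *: ad Y.
Proof. by rewrite /adF ascaleAl ascaleAr scalerBr. Qed.
Lemma adFMn Y k : ad (Y *+ k) = ad Y *+ k.
Proof. by rewrite -!scaler_nat adFZ. Qed.

Lemma adF_aE a b : ad (aE a b) = aE R b *+ (L == a) - aE a L *+ (R == b).
Proof. exact: aE_com. Qed.
Lemma adF_aX a k : ad (aX F a k) = aX F R k *+ (L == a).
Proof. exact: aE_X. Qed.
Lemma adF_aD a k : ad (aD F a k) = - (aD F L k *+ (R == a)).
Proof. exact: aE_D. Qed.
Lemma adF_Fc : ad Fm = 0.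
Proof. exact: subrr. Qed.

Lemma iter_adFD s Y Z : iter s ad (Y + Z) = iter s ad Y + iter s ad Z.
Proof. by elim: s => //= s ->; rewrite adFD. Qed.
Lemma iter_adFB s Y Z : iter s ad (Y - Z) = iter s ad Y - iter s ad Z.
Proof. by elim: s => //= s ->; rewrite adFB. Qed.
Lemma iter_adF0 s : iter s ad 0 = 0.
Proof. by elim: s => //= s ->; rewrite adF0. Qed.

Lemma iter_adF_le N s Y : (N <= s)%N -> iter N ad Y = 0 -> iter s ad Y = 0.
Proof. by move=> Ns YN; rewrite -(subnK Ns) iterD YN iter_adF0. Qed.

Lemma iter_adFM N M Y Z :
  iter N ad Y = 0 -> iter M ad Z = 0 -> iter (N + M) ad (Y * Z) = 0.
Proof.
have [k] := ubnP (N + M); elim: k N M Y Z => // k IH [|N] M Y Z.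
  by move=> _ /= -> _; rewrite mul0r iter_adF0.
case: M => [|M]; first by move=> _ _ Z0; rewrite [Z]Z0 mulr0 iter_adF0.
rewrite addSn ltnS => NMk YN ZM; rewrite iterSr adFM iter_adFD.
rewrite IH -?iterSr // add0r addnS -addSn.
by rewrite IH -?iterSr // addSn -addnS.
Qed.

(** This makes the series of xi_c finite. Three steps kill E_ab, two kill x_ak and d_ak, and the
    Leibniz rule extends nilpotency to products. *)
Lemma adF_nilpotent Y : exists N, iter N ad Y = 0.
Proof.
have [t ->] := acls_surj Y; elim: t => [[a b|[a k|a k]]|k|t [N tN] u [M uM]|t [N tN] u [M uM]].
- exists 3; rewrite /= -[acls _]/(aE a b) adF_aE.
  have adR x : ad (aE R x) = - (Fm *+ (R == x)) by rewrite adF_aE neq_cLR sub0r.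
  have adL x : ad (aE x L) = Fm *+ (L == x).
    by rewrite adF_aE (eq_sym R) neq_cLR subr0.
  rewrite (adFB (aE R b *+ _) (aE a L *+ _)) !adFMn adR adL mulNrn -opprD.
  rewrite -[- _]sub0r (adFB 0) adF0 (adFD (Fm *+ _ *+ _)) !adFMn adF_Fc.
  by rewrite !mul0rn addr0 subr0.
- exists 2; rewrite /= -[acls _]/(aX F a k) adF_aX adFMn adF_aX.
  by rewrite neq_cLR mul0rn.
- exists 2; rewrite /= -[acls _]/(aD F a k) adF_aD -[- (_ *+ _)]sub0r [ad (_ - _)]adFB adFMn adF_aD.
  by rewrite adF0 (eq_sym R L) neq_cLR mulr0n oppr0 mul0rn subr0.
- by exists 1; rewrite /= acls_cst adFE /lie ascaleAl ascaleAr mul1r mulr1 subrr.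
- exists (N + M)%N; rewrite acls_add iter_adFD.
  by rewrite (iter_adF_le _ tN) ?leq_addr // (iter_adF_le _ uM) ?leq_addl ?addr0.
- by exists (N + M)%N; rewrite acls_mul iter_adFM.
Qed.

Lemma epsE a : ep a = (L == a)%:R - (a == R)%:R.
Proof. by rewrite ffunE (eq_sym L). Qed.

Lemma lie_Fc_cartan a : lie Fm (aE a a) = ep a *: Fm.
Proof.
rewrite aE_com epsE scalerBl !scaler_nat.
rewrite (eq_sym L) (eq_sym R); case: (eqVneq a L) => [->|_].
  by rewrite neq_cLR !mulr0n.
by case: (eqVneq a R) => [->|_]; rewrite !mulr0n.
Qed.

Lemma lie_Ec_cartan a : lie E (aE a a) = - (ep a *: E).
Proof.
rewrite aE_com epsE scalerBl !scaler_nat opprB (eq_sym R).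
rewrite (eq_sym L); case: (eqVneq a L) => [->|_].
  by rewrite neq_cLR !mulr0n.
by case: (eqVneq a R) => [->|_]; rewrite !mulr0n.
Qed.

Lemma lie_Ec_Fc : lie E Fm = H.
Proof. by rewrite aE_com !eqxx. Qed.

Lemma lie_Ec_Hc : lie E H = - (E *+ 2).
Proof.
rewrite lieBr !lie_Ec_cartan !epsE !eqxx !neq_cLR.
by rewrite subr0 sub0r scale1r scaleN1r opprK -opprD.
Qed.

Lemma lie_Fc_Hc : lie Fm H = Fm *+ 2.
Proof.
rewrite lieBr !lie_Fc_cartan !epsE !eqxx !neq_cLR.
by rewrite subr0 sub0r scale1r scaleN1r opprK.
Qed.

(** ad F_c sends g to a multiple of F_c and F_c to 0, so Leibniz stops after two terms. At s = 0 the
    convention [0.-1 = 0] is harmless, as the multiplicity is s. *)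
Lemma iter_adF_left_weight s (k : F) g Y : lie Fm g = k *: Fm ->
  iter s ad (g * Y) = g * iter s ad Y + (k *: (Fm * iter s.-1 ad Y)) *+ s.
Proof.
move=> Fg; elim: s => [|s IH]; first by rewrite mulr0n addr0.
rewrite iterS IH adFD adFM [ad g]Fg ascaleAl adFMn adFZ adFM adF_Fc.
rewrite mul0r add0r -addrA addrCA; congr (_ + _).
by rewrite [in RHS]mulrS; congr (_ + _); case: s {IH}.
Qed.

Lemma iter_adF_right_weight s (k : F) g Y : lie Fm g = k *: Fm ->
  iter s ad (Y * g) = iter s ad Y * g + (k *: (iter s.-1 ad Y * Fm)) *+ s.
Proof.
move=> Fg; elim: s => [|s IH]; first by rewrite mulr0n addr0.
rewrite iterS IH adFD adFM [ad g]Fg ascaleAr adFMn adFZ adFM adF_Fc.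
rewrite mulr0 addr0 -addrA; congr (_ + _).
by rewrite [in RHS]mulrS; congr (_ + _); case: s {IH}.
Qed.

Lemma iter_adF_right_f s Y : iter s ad (Y * Fm) = iter s ad Y * Fm.
Proof.
by elim: s => //= s ->; rewrite adFM adF_Fc mulr0 addr0.
Qed.

(** ad F_c sends E_c to -H_c, H_c to 2 F_c and F_c to 0. Leibniz leaves three terms, and the
    binomial coefficient s(s-1)/2 meets the 2 of 2 F_c. *)
Lemma iter_adF_left_e s Y : iter s ad (E * Y) = E * iter s ad Y -
  (H * iter s.-1 ad Y) *+ s - (Fm * iter s.-2 ad Y) *+ (s * s.-1).
Proof.
elim: s => [|s IH]; first by rewrite !mulr0n !subr0.
have adE : ad E = - H by rewrite -lie_Ec_Fc -lieC.
rewrite iterS IH ![ad (_ - _)]adFB !adFMn !adFM adE [ad H]lie_Fc_Hc adF_Fc mul0r add0r mulNr.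
have -> : (Fm *+ 2 * iter s.-1 ad Y + H * ad (iter s.-1 ad Y)) *+ s =
    (Fm *+ 2 * iter s.-1 ad Y + H * iter s ad Y) *+ s by case: s {IH}.
have -> : (Fm * ad (iter s.-2 ad Y)) *+ (s * s.-1) = (Fm * iter s.-1 ad Y) *+ (s * s.-1).
  by case: s {IH} => [|[|s]].
rewrite /= [- _ + _]addrC -!addrA; congr (_ + _); rewrite -!opprD; congr (- _).
rewrite mulrnDl mulrnAl [_ *+ 2 *+ s + _]addrC -!addrA [LHS]addrA -mulrS -mulrnA -mulrnDr.
by congr (_ + _ *+ _); case: s {IH} => //= s; ring.
Qed.

End LocallyNilpotent.

(** * The ring of fractions, the subgroups Jbar and Ibar, and the series xi_c *)

Section Fractions.
Variables (F : numFieldType) (m n : nat).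
Variables (Abar : unitRingType) (theta : {rmorphism Aalg F m n -> Abar}).
Hypothesis fractions : ring_of_fractions theta (uh n @` @denoms F m).
Local Notation A := (Aalg F m n).
Local Notation uh := (@uh F m n).
Local Notation denoms := (@denoms F m).
Implicit Types (p q d : {mpoly F[m]}) (Y Z : A) (w : Abar).

Definition Uf p : Abar := theta (uh p).

Lemma UfM p q : Uf (p * q) = Uf p * Uf q.
Proof. by rewrite /Uf uhM rmorphM. Qed.
Lemma UfD p q : Uf (p + q) = Uf p + Uf q.
Proof. by rewrite /Uf uhD rmorphD. Qed.
Lemma UfX k : Uf 'X_k = theta (aE F n k k).
Proof. by rewrite /Uf uhX. Qed.
Lemma Uf1 : Uf 1 = 1.
Proof. by rewrite /Uf uh1 rmorph1. Qed.
Lemma Uf_commute p q : Uf p * Uf q = Uf q * Uf p.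
Proof. by rewrite -!UfM mulrC. Qed.
Lemma theta_scale (k : F) Y : theta (k *: Y) = Uf k%:MP * theta Y.
Proof. by rewrite /Uf uhC -rmorphM ascaleAl mul1r. Qed.

Lemma Uf_unit d : denoms d -> Uf d \is a GRing.unit.
Proof. by case: fractions => unit _ _ dd; apply: unit; exists d. Qed.

Lemma fracP w : exists d Y, denoms d /\ w = (Uf d)^-1 * theta Y.
Proof.
by case: fractions => _ /(_ w)[_ [Y [[d dd <-] ->]]] _; exists d, Y.
Qed.

Lemma theta_eq0 Y : theta Y = 0 -> exists2 d, denoms d & uh d * Y = 0.
Proof. by case: fractions => _ _ /(_ Y)[+ _] => /[apply] -[_ [[d dd <-] dY]]; exists d. Qed.

(** [Abar] carries only a ring structure; scalars of F enter as [Uf k%:MP], which commutes with A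
    and hence with the inverses of denominators. *)
Lemma Uf_central (k : F) w : Uf k%:MP * w = w * Uf k%:MP.
Proof.
have kA Y : Uf k%:MP * theta Y = theta Y * Uf k%:MP.
  by rewrite /Uf -!rmorphM uhC ascaleAl ascaleAr mul1r mulr1.
have [d [Y [dd ->]]] := fracP w.
rewrite -[RHS]mulrA -kA !mulrA; congr (_ * _).
by apply: commrV; rewrite /GRing.comm Uf_commute.
Qed.

Lemma Uf_const_unit (k : F) : k != 0 -> Uf k%:MP \is a GRing.unit.
Proof.
move=> k0; apply/unitrP; exists (Uf k^-1%:MP).
by rewrite -!UfM -!mpolyCM mulVf // mulfV // mpolyC1 Uf1.
Qed.

Lemma Uf_invC p q : Uf p \is a GRing.unit -> (Uf p)^-1 * Uf q = Uf q * (Uf p)^-1.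
Proof. by move=> _; apply/esym/commrV; rewrite /GRing.comm Uf_commute. Qed.

Lemma Uf_invM p q : Uf p \is a GRing.unit -> Uf q \is a GRing.unit ->
  (Uf (p * q))^-1 = (Uf p)^-1 * (Uf q)^-1.
Proof. by move=> pu qu; rewrite mulrC UfM invrM. Qed.

Section BarIdeal.
Variable B : set A.
Hypothesis B0 : B 0.
Hypothesis BB : forall Y Z, B Y -> B Z -> B (Y - Z).
Hypothesis Bu : forall p Y, B Y -> B (uh p * Y).
Local Notation bar := (gen_subgroup (ufracs theta B)).

Lemma bar_theta Y : B Y -> bar (theta Y).
Proof.
move=> BY; apply: gs_mem; exists 1, 1, Y; split=> //; first exact: denoms1.
by rewrite /ufrac -/(Uf _) Uf1 invr1 !mul1r.
Qed.

Lemma bar_Uf p w : bar w -> bar (Uf p * w).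
Proof.
move: w; apply: (gs_morph (f := fun w => Uf p * w)).
- exact: mulr0.
- exact: mulrBr.
move=> _ [q [d [b [dd Bb ->]]]]; apply: gs_mem; exists (p * q), d, b; split=> //.
rewrite /ufrac -!/(Uf _) UfM !mulrA; congr (_ * _ * _).
by rewrite Uf_invC ?Uf_unit.
Qed.

Lemma bar_inv d w : denoms d -> bar w -> bar ((Uf d)^-1 * w).
Proof.
move=> dd; move: w; apply: (gs_morph (f := fun w => (Uf d)^-1 * w)).
- exact: mulr0.
- exact: mulrBr.
move=> _ [q [d' [b [dd' Bb ->]]]]; apply: gs_mem; exists q, (d * d'), b; split=> //.
  exact: denomsM.
by rewrite /ufrac -!/(Uf _) Uf_invM ?Uf_unit // !mulrA.
Qed.

(** Denominators stand on the left and commute with one another, so a finite sum has a common one;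
    [Bu] lets B absorb the cofactors. *)
Lemma bar_clear w : bar w -> exists d b, [/\ denoms d, B b & Uf d * w = theta b].
Proof.
elim=> [|_ [q [d [b [dd Bb ->]]]]|x y _ [d [b [dd Bb E]]] _ [d' [b' [dd' Bb' E']]]].
- by exists 1, 0; split; [exact: denoms1| |rewrite mulr0 rmorph0].
- exists d, (uh q * b); split=> //; first exact: Bu.
  by rewrite /ufrac -!/(Uf _) mulrA mulrA divrr ?Uf_unit // mul1r rmorphM.
- exists (d * d'), (uh d' * b - uh d * b'); split; first exact: denomsM.
    by apply: BB; exact: Bu.
  rewrite mulrBr {1}[d * d']mulrC !UfM -!mulrA E E' rmorphB !rmorphM.
  by [].
Qed.
End BarIdeal.

Local Notation Jbar := (@Jbar F m n Abar theta).
Local Notation Ibar := (@Ibar F m n Abar theta).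

(** The sum of a right ideal and a left ideal, hence just a subgroup; what survives on both sides is
    stability under left multiplication by fractions of U(h). *)
Definition JIbar mu : set Abar := gen_subgroup (Jbar `|` Ibar mu).

Lemma Jideal0 : @Jideal F m n 0. Proof. exact: gs0. Qed.
Lemma JidealB Y Z : Jideal Y -> Jideal Z -> Jideal (Y - Z). Proof. exact: gsB. Qed.
Lemma Iideal0 mu : @Iideal F m n mu 0. Proof. exact: gs0. Qed.
Lemma IidealB mu Y Z : Iideal mu Y -> Iideal mu Z -> Iideal mu (Y - Z).
Proof. exact: gsB. Qed.

Lemma Jbar_theta Y : Jideal Y -> Jbar (theta Y).
Proof. exact: bar_theta. Qed.
Lemma Jbar_Uf p w : Jbar w -> Jbar (Uf p * w).
Proof. exact: bar_Uf. Qed.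
Lemma Jbar_inv d w : denoms d -> Jbar w -> Jbar ((Uf d)^-1 * w).
Proof. exact: bar_inv. Qed.
Lemma Ibar_theta mu Y : Iideal mu Y -> Ibar mu (theta Y).
Proof. exact: bar_theta. Qed.

Lemma JIbar_J mu w : Jbar w -> JIbar mu w.
Proof. by move=> Jw; apply: gs_mem; left. Qed.
Lemma JIbar_I mu w : Ibar mu w -> JIbar mu w.
Proof. by move=> Iw; apply: gs_mem; right. Qed.
Lemma JIbar_Uf mu p w : JIbar mu w -> JIbar mu (Uf p * w).
Proof.
move: w; apply: (gs_morph (f := fun w => Uf p * w)); [exact: mulr0|exact: mulrBr|].
by move=> w [Jw|Iw]; apply: gs_mem; [left|right]; exact: bar_Uf.
Qed.
Lemma JIbar_inv mu d w : denoms d -> JIbar mu w -> JIbar mu ((Uf d)^-1 * w).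
Proof.
move=> dd; move: w.
apply: (gs_morph (f := fun w => (Uf d)^-1 * w)); [exact: mulr0|exact: mulrBr|].
by move=> w [Jw|Iw]; apply: gs_mem; [left|right]; exact: bar_inv.
Qed.

Lemma JIbar_clear mu w : JIbar mu w -> exists d j i,
  [/\ denoms d, Jideal j, Iideal mu i & Uf d * w = theta (j + i)].
Proof.
elim=> [|x [/(bar_clear Jideal0 JidealB (@uh_Jideal _ _ _))[d [j [dd Jj E]]]|
        /(bar_clear (@Iideal0 mu) (@IidealB mu) (fun p => Iideal_mul (uh p)))[d [i [dd Ii E]]]]|
        x y _ [d [j [i [dd Jj Ii E]]]] _ [d' [j' [i' [dd' Jj' Ii' E']]]]].
- exists 1, 0, 0; rewrite mulr0 addr0 rmorph0; split=> //; last exact: Iideal0.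
    exact: denoms1.
  exact: Jideal0.
- by exists d, j, 0; rewrite addr0; split=> //; exact: Iideal0.
- by exists d, 0, i; rewrite add0r; split=> //; exact: Jideal0.
- exists (d * d'), (uh d' * j - uh d * j'), (uh d' * i - uh d * i'); split.
  + exact: denomsM.
  + by apply: JidealB; exact: uh_Jideal.
  + by apply: IidealB; exact: Iideal_mul.
  rewrite mulrBr {1}[d * d']mulrC !UfM -!mulrA E E' addrACA -opprD -!mulrDr.
  by rewrite rmorphB !rmorphM.
Qed.

Section Xi.
Variable c : 'I_m.-1.
Local Notation E := (Ec F n c).
Local Notation H := (Hc F n c).
Local Notation L := (cL c).
Local Notation R := (cR c).
Local Notation ad := (@adF F m n c).
Local Notation xi := (@xi F m n Abar theta c).

Definition hden s : {mpoly F[m]} :=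
  \prod_(0 <= j < s) ('X_L - 'X_R + (- (j%:R))%:MP).

Definition xicoef s : Abar :=
  (theta ((s`!)%:R * \prod_(0 <= j < s) (H - j%:R)))^-1.

Lemma HcE : H = uh ('X_L - 'X_R).
Proof. by rewrite uhB !uhX. Qed.

Lemma hden_denoms s : denoms (hden s).
Proof.
exists [seq (L, R, - (j%:Z)) | j <- index_iota 0 s]; split.
  by apply/allP => _ /mapP[j _ ->] /=; rewrite neq_cLR.
by rewrite big_map /hden; apply: eq_bigr => j _; rewrite /= mulrNz.
Qed.

Lemma Uf_hden s : Uf (hden s) \is a GRing.unit.
Proof. exact/Uf_unit/hden_denoms. Qed.

Lemma xicoefE s : xicoef s = (Uf (s`!%:R%:MP * hden s))^-1.
Proof.
congr (_^-1); rewrite /Uf uhM uhC scaler_nat (big_morph _ (@uhM F m n) (uh1 _ _ _)).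
congr (theta (_ * _)); apply: eq_bigr => j _.
by rewrite uhD uhC HcE scaleNr scaler_nat.
Qed.

Lemma fact_unit s : Uf (s`!%:R)%:MP \is a GRing.unit.
Proof. by apply: Uf_const_unit; rewrite pnatr_eq0 -lt0n fact_gt0. Qed.

Lemma xicoef0 : xicoef 0 = 1.
Proof. by rewrite /xicoef big_geq // fact0 mulr1 rmorph1 invr1. Qed.

Lemma xicoefS s : (xicoef s.+1 * (theta H - s%:R)) *+ s.+1 = xicoef s.
Proof.
have u k := unitrM_comm (Uf_commute (k`!%:R)%:MP (hden k)).
have uu k : Uf (k`!%:R%:MP * hden k) \is a GRing.unit.
  by rewrite UfM u fact_unit Uf_hden.
pose w := s.+1%:R%:MP * ('X_L - 'X_R + (- (s%:R))%:MP) : {mpoly F[m]}.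
have -> : (xicoef s.+1 * (theta H - s%:R)) *+ s.+1 = xicoef s.+1 * Uf w.
  rewrite /w /Uf uhM uhC scaler_nat mulr_natl uhD -HcE uhC scaleNr scaler_nat.
  by rewrite (rmorphMn theta) (rmorphB theta H) (rmorphMn theta) rmorph1 mulrnAr.
have hS : s.+1`!%:R%:MP * hden s.+1 = w * (s`!%:R%:MP * hden s).
  by rewrite /hden big_nat_recr //= factS natrM mpolyCM /w; ring.
apply: (mulIr (uu s)); rewrite !xicoefE mulVr // -mulrA -UfM -hS mulVr //.
Qed.

Lemma xicoef_Uf s p : xicoef s * Uf p = Uf p * xicoef s.
Proof. by rewrite xicoefE; apply/esym/commrV; rewrite /GRing.comm Uf_commute. Qed.

Lemma xicoef_split s : xicoef s = (Uf (hden s))^-1 * Uf ((s`!%:R)^-1)%:MP.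
Proof.
rewrite xicoefE Uf_invM ?fact_unit ?Uf_hden //.
rewrite [RHS]Uf_invC ?Uf_hden //; congr (_ * _).
apply: (mulIr (fact_unit s)); rewrite mulVr ?fact_unit // -UfM -mpolyCM mulVf ?mpolyC1 ?Uf1 //.
by rewrite pnatr_eq0 -lt0n fact_gt0.
Qed.

Lemma Jbar_xicoef s w : Jbar w -> Jbar (xicoef s * w).
Proof.
move=> Jw; rewrite xicoef_split -mulrA; apply/Jbar_inv/Jbar_Uf => //.
exact: hden_denoms.
Qed.

Lemma JIbar_xicoef mu s w : JIbar mu w -> JIbar mu (xicoef s * w).
Proof.
move=> Jw; rewrite xicoef_split -mulrA; apply/JIbar_inv/JIbar_Uf => //.
exact: hden_denoms.
Qed.

(** Any N with (ad F_c)^N Y = 0 may bound the sum, so the series of several elements can be compared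
    over one range. The leading Y is the term s = 0, because H^(0) = 1. *)
Lemma xiE N Y : iter N ad Y = 0 ->
  xi Y = \sum_(s < N) xicoef s * (theta E ^+ s * theta (iter s ad Y)).
Proof.
have xiS M : iter M.+1 ad Y = 0 ->
    xi Y = \sum_(s < M.+1) xicoef s * (theta E ^+ s * theta (iter s ad Y)).
  move=> YM; rewrite /xi (fsbigE (index_iota 1 M.+1)) ?iota_uniq //=; first last.
  - move=> s s1; rewrite mem_index_iota s1 /= -leqNgt => Ms.
    by rewrite (iter_adF_le Ms YM) mulr0 rmorph0 mulr0.
  - by move=> s /=; rewrite mem_index_iota => /andP[].
  rewrite -(big_mkord xpredT (fun s => xicoef s * (theta E ^+ s * theta (iter s ad Y)))).
  rewrite big_ltn // xicoef0 expr0 !mul1r /=; congr (_ + _).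
  rewrite big_seq_cond [RHS]big_seq; apply: eq_big => s.
    apply/andP/idP => [[]//|sr]; split=> //; apply/mem_set.
    by move: sr; rewrite mem_index_iota => /andP[].
  by move=> _; rewrite (rmorphM theta (E ^+ s)) rmorphXn.
case: N => [|N]; last exact: xiS.
move=> Y0; rewrite (xiS 0) ?big_ord1 ?big_ord0 /=; rewrite /= in Y0; rewrite Y0.
  by rewrite rmorph0 !mulr0.
exact: adF0.
Qed.

Lemma xi_eval Y : exists N, forall M, (N <= M)%N ->
  iter M ad Y = 0 /\
  xi Y = \sum_(s < M) xicoef s * (theta E ^+ s * theta (iter s ad Y)).
Proof.
have [N YN] := adF_nilpotent c Y; exists N => M NM.
have YM := iter_adF_le NM YN; split=> //; exact: xiE.
Qed.

Lemma xiB Y Z : xi (Y - Z) = xi Y - xi Z.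
Proof.
have [N HN] := xi_eval Y; have [M HM] := xi_eval Z.
have [YN ->] := HN (N + M)%N (leq_addr _ _); have [ZM ->] := HM (N + M)%N (leq_addl _ _).
rewrite (@xiE (N + M)); last by rewrite iter_adFB YN ZM subrr.
rewrite -sumrB; apply: eq_bigr => s _.
by rewrite iter_adFB rmorphB !mulrBr.
Qed.
Lemma xi0 : xi 0 = 0.
Proof. by rewrite -(subrr (0 : A)) xiB subrr. Qed.
Lemma xiD Y Z : xi (Y + Z) = xi Y + xi Z.
Proof. by have := xiB (Y + Z) Z; rewrite addrK => ->; rewrite subrK. Qed.
Lemma xiZ (k : F) Y : xi (k *: Y) = Uf k%:MP * xi Y.
Proof.
have [N HN] := xi_eval Y; have [YN ->] := HN N (leqnn _).
have iterZ s : iter s ad (k *: Y) = k *: iter s ad Y.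
  by elim: s => //= s ->; rewrite adFZ.
rewrite (@xiE N); last by rewrite iterZ YN scaler0.
rewrite mulr_sumr; apply: eq_bigr => s _.
rewrite iterZ theta_scale [_ ^+ _ * (_ * _)]mulrA -(Uf_central k (_ ^+ s)) -mulrA.
by rewrite [xicoef s * (_ * _)]mulrA -(Uf_central k (xicoef s)) -mulrA.
Qed.

End Xi.

End Fractions.

(** * Compatibility of xi_c with U(h) and with the two ideals *)

Section XiIdeals.
Variables (F : numFieldType) (m n : nat).
Variables (Abar : unitRingType) (theta : {rmorphism Aalg F m n -> Abar}).
Hypothesis fractions : ring_of_fractions theta (uh n @` @denoms F m).
Local Notation A := (Aalg F m n).
Local Notation uh := (@uh F m n).
Local Notation Uf := (@Uf F m n Abar theta).
Local Notation Jbar := (@Jbar F m n Abar theta).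
Local Notation JIbar := (@JIbar F m n Abar theta).
Implicit Types (p q d : {mpoly F[m]}) (Y Z : A) (w : Abar).

Variable c : 'I_m.-1.
Local Notation E := (Ec F n c).
Local Notation Fm := (Fc F n c).
Local Notation H := (Hc F n c).
Local Notation L := (cL c).
Local Notation R := (cR c).
Local Notation aE a b := (@aE F m n a b).
Local Notation ad := (@adF F m n c).
Local Notation ep := (eps F c).
Local Notation xi := (@xi F m n Abar theta c).
Local Notation a := (@xicoef F m n Abar theta c).
Local Notation y Y s := (theta (iter s ad Y)).
Let D w := exists Z : A, w = theta Z.

Lemma theta_lie Y Z : theta Y * theta Z - theta Z * theta Y = theta (lie Y Z).
Proof. by rewrite -!rmorphM -(rmorphB theta). Qed.
Lemma theta_EH : theta E * theta H - theta H * theta E = - (theta E *+ 2).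
Proof. by rewrite theta_lie lie_Ec_Hc (rmorphN theta) (rmorphMn theta). Qed.
Lemma theta_EF : theta E * theta Fm - theta Fm * theta E = theta H.
Proof. by rewrite theta_lie lie_Ec_Fc. Qed.
Lemma theta_range_E w : D w -> D (theta E * w).
Proof. by case=> Z ->; exists (E * Z); rewrite rmorphM. Qed.
Lemma theta_range_y Y s : D (y Y s).
Proof. by exists (iter s ad Y). Qed.
Lemma y_f Y s : y Y s * theta Fm = theta Fm * y Y s - y Y s.+1.
Proof. by rewrite -!rmorphM -(rmorphB theta) opprB addrC subrK. Qed.

Lemma Jideal_Fc Z : Jideal (Fm * Z).
Proof. by apply: gs_mem; exists Z, Fm; split=> //; exists R, L. Qed.

Lemma Jbar_aF s w : D w -> Jbar (a s * (theta Fm * w)).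
Proof.
case=> Z ->; apply: Jbar_xicoef => //; rewrite -rmorphM.
exact/Jbar_theta/Jideal_Fc.
Qed.

Lemma JIbar_aF mu s w : D w -> JIbar mu (a s * (theta Fm * w)).
Proof. by move=> /Jbar_aF Jw; exact: JIbar_J. Qed.

Lemma xi_cartan_mul k Y :
  Jbar (xi (aE k k * Y) - (theta (aE k k) + Uf (ep k)%:MP) * xi Y).
Proof.
have [N HN] := xi_eval theta c Y; have [YN ->] := HN N (leqnn _).
have Fg := lie_Fc_cartan F n c k.
have Eg : theta E * theta (aE k k) - theta (aE k k) * theta E = - (Uf (ep k)%:MP * theta E).
  by rewrite theta_lie lie_Ec_cartan (rmorphN theta) theta_scale.
have ag s : a s * theta (aE k k) = theta (aE k k) * a s.
  by have := xicoef_Uf theta c s 'X_k; rewrite UfX.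
have yN0 : y Y N = 0 by rewrite YN rmorph0.
have := sum_left_weight (xicoefS fractions c) theta_EH theta_EF theta_range_E
  Jbar_aF (theta_range_y Y) (Uf_central fractions (ep k))
  (fun z => Jbar_Uf fractions (ep k)%:MP (w := z)) yN0 Eg ag.
rewrite (@xiE _ _ _ _ _ _ N.+1); last first.
  have [YN1 _] := HN N.+1 (leqnSn _).
  by rewrite (iter_adF_left_weight _ _ Fg) YN1 /= YN !mulr0 scaler0 mul0rn addr0.
congr (Jbar (_ - _)); apply: eq_bigr => s _; congr (_ * (_ * _)).
rewrite (iter_adF_left_weight _ _ Fg) rmorphD rmorphMn.
by rewrite theta_scale !rmorphM.
Qed.

(** Consistency of the rule XY -> Z xi_c(Y): the shift by eps_c is acquired one variable at a
    time. *)
Lemma xi_uh p Y : Jbar (xi (uh p * Y) - Uf (uh_shift c p) * xi Y).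
Proof.
elim/mpoly_ring_ind: p Y => [k|p q IHp IHq|k p IH] Y.
- rewrite /uh_shift comp_mpolyC uhC ascaleAl mul1r xiZ // subrr; exact: gs0.
- rewrite uhD mulrDl xiD // /uh_shift comp_mpolyD UfD mulrDl opprD addrACA.
  exact: gsD (IHp Y) (IHq Y).
- rewrite uhXM uh_shiftM uh_shiftX UfM -!mulrA.
  set u := Uf ('X_k + _); have uE : u = theta (aE k k) + Uf (ep k)%:MP.
    by rewrite /u UfD UfX.
  rewrite -(subrKA (u * xi (uh p * Y))) -mulrBr; apply: gsD.
    rewrite uE; exact: xi_cartan_mul.
  exact/Jbar_Uf/IH.
Qed.

(** E_c = sigma_c F_c is the only image under sigma_c of a generator of n that leaves n, which is
    why it needs a telescoping sum. [xi_mul_Fc] plays the same role for n' and I_mu. *)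
Lemma xi_Ec_mul Y : Jbar (xi (E * Y)).
Proof.
have [N HN] := xi_eval theta c Y.
have [YN _] := HN N (leqnn _); have [YN1 _] := HN N.+1 (leqnSn _).
have := sum_left_e (N := N.+1) (xicoefS fractions c) theta_EH theta_EF theta_range_E
  Jbar_aF (theta_range_y Y).
rewrite YN1 /= YN rmorph0 => /(_ erefl erefl).
rewrite (@xiE _ _ _ _ _ _ N.+2); last first.
  have [YN2 _] := HN N.+2 (leqW (leqnSn _)).
  rewrite iter_adF_left_e YN2 [iter N.+2.-1 _ _]YN1 [iter N.+2.-2 _ _]YN.
  by rewrite !mulr0 !mul0rn !subr0.
congr (Jbar _); apply: eq_bigr => s _; congr (_ * (_ * _)).
by rewrite iter_adF_left_e (rmorphB theta (_ - _)) (rmorphB theta (E * _))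
  !(rmorphMn theta) !rmorphM.
Qed.

Lemma xi_mul_Fc mu Y : JIbar mu (xi (Y * Fm)).
Proof.
have [N HN] := xi_eval theta c Y.
have [YN _] := HN N.+1 (leqnSn _).
have yN0 : y Y N.+1 = 0 by rewrite YN rmorph0.
have := sum_right_f (xicoefS fractions c) theta_EH theta_EF theta_range_E
  (@JIbar_aF mu) (theta_range_y Y) yN0 (y_f Y).
rewrite (@xiE _ _ _ _ _ _ N.+1); last by rewrite iter_adF_right_f YN mul0r.
congr (JIbar mu _); apply: eq_bigr => s _; congr (_ * (_ * _)).
by rewrite iter_adF_right_f rmorphM.
Qed.

(** The shift by eps_c picked up on the right is the difference between sigma_c(mu) and the dot
    action, see [wdot_srefl]. *)
Lemma xi_mul_cartan mu k Y :
  JIbar mu (xi (Y * (aE k k - (mu k + ep k) *: (1 : A)))).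
Proof.
have [N HN] := xi_eval theta c Y; have [YN _] := HN N (leqnn _).
have [YN1 _] := HN N.+1 (leqnSn _).
pose x : A := aE k k - mu k *: (1 : A).
have ax s : JIbar mu (a s * (theta E ^+ s * (y Y s * theta x))).
  apply: JIbar_xicoef => //; apply: JIbar_I; rewrite -rmorphXn -!rmorphM.
  apply: Ibar_theta; rewrite mulrA; apply: gs_mem; exists (E ^+ s * iter s ad Y), x.
  by split=> //; left; right; exists k.
have yN0 : y Y N = 0 by rewrite YN rmorph0.
have := sum_right_weight (xicoefS fractions c) theta_EH theta_EF theta_range_E
  (@JIbar_aF mu) (theta_range_y Y) (Uf_central fractions (ep k))
  (fun z => JIbar_Uf fractions (ep k)%:MP (w := z)) yN0 (y_f Y) ax.
have Fx : lie Fm (aE k k - (mu k + ep k) *: (1 : A)) = ep k *: Fm.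
  rewrite lieBr lie_Fc_cartan.
  by rewrite /lie ascaleAr ascaleAl mulr1 mul1r subrr subr0.
rewrite (@xiE _ _ _ _ _ _ N.+1); last first.
  by rewrite (iter_adF_right_weight _ _ Fx) YN1 /= YN !mul0r scaler0 mul0rn addr0.
congr (JIbar mu _); apply: eq_bigr => s _; congr (_ * (_ * _)).
rewrite (iter_adF_right_weight _ _ Fx) (rmorphD theta (_ * _)) (rmorphMn theta).
rewrite theta_scale (rmorphM theta (iter s.-1 _ _)); congr (_ + _).
rewrite -theta_scale -rmorphM -(rmorphB theta); congr (theta _).
rewrite /x scalerDl opprD addrA [in RHS]mulrBr; congr (_ - _).
by rewrite ascaleAr mulr1.
Qed.

(** For the root vectors other than E_c and F_c each term of the series already lies in the ideal,
    so no cancellation between terms is involved. *)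
Lemma xi_stable (B : set A) (K : set Abar) Y :
  (forall Z, B Z -> B (ad Z)) -> (forall Z, B Z -> B (E * Z)) ->
  (forall Z, B Z -> gen_subgroup K (theta Z)) ->
  (forall s w, gen_subgroup K w -> gen_subgroup K (a s * w)) ->
  B Y -> gen_subgroup K (xi Y).
Proof.
move=> Bad BE BK Ka BY.
have [N HN] := xi_eval theta c Y; have [_ ->] := HN N (leqnn _).
apply: gs_sum => s _; apply: Ka; rewrite -rmorphXn -rmorphM; apply: BK.
have By : B (iter s ad Y) by elim: (s : nat) => //= k; exact: Bad.
elim: (s : nat) (iter s ad Y) By => [|k IH] Z BZ; first by rewrite expr0 mul1r.
by rewrite exprSr -mulrA; exact/IH/BE.
Qed.

(** The root vectors of n other than F_c span the nilradical of a parabolic subalgebra whose Levi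
    part contains E_c and F_c; it is normalized by both and preserved by sigma_c. [upper_rest] is
    the counterpart for I_mu, with the derivations added. *)
Definition lower_rest : set A := [set Y | exists i j : 'I_m,
  [/\ (j < i)%N, ~~ ((i == R) && (j == L)) & Y = aE i j]].
Definition upper_rest : set A :=
  [set Y | exists i j : 'I_m, [/\ (i < j)%N, ~~ ((i == L) && (j == R)) & Y = aE i j]] `|`
  [set Y | exists b k, Y = aD F b k].

Lemma rmults_gen (S : set A) (X Z : A) : S X -> gen_subgroup (rmults S) (X * Z).
Proof. by move=> SX; apply: gs_mem; exists Z, X. Qed.
Lemma lmults_gen (S : set A) (X Z : A) : S X -> gen_subgroup (lmults S) (Z * X).
Proof. by move=> SX; apply: gs_mem; exists Z, X. Qed.

Lemma lower_rest_lie (X Z : A) (i j : 'I_m) : (X = E) \/ (X = Fm) ->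
  (j < i)%N -> ~~ ((i == R) && (j == L)) ->
  gen_subgroup (rmults lower_rest) (lie X (aE i j) * Z).
Proof.
have gen (k l : 'I_m) (b : bool) : (b -> (l < k)%N /\ ~~ ((k == R) && (l == L))) ->
    gen_subgroup (rmults lower_rest) ((aE k l *+ b) * Z).
  case: b => [/(_ isT)[lk kl]|_]; last by rewrite mulr0n mul0r; exact: gs0.
  by rewrite mulr1n; apply: rmults_gen; exists k, l.
move=> X_EF ij nij; case: X_EF => ->; rewrite aE_com mulrBl; apply: gsB; apply: gen;
  move=> /eqP/(congr1 val) /= e; move: ij nij; rewrite -!val_eqE /=; lia.
Qed.

Lemma lower_rest_lmul (X Y : A) : (X = E) \/ (X = Fm) ->
  gen_subgroup (rmults lower_rest) Y -> gen_subgroup (rmults lower_rest) (X * Y).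
Proof.
move=> X_EF; move: Y; apply: gs_morph; [exact: mulr0|exact: mulrBr|].
move=> _ [Z [_ [[i [j [ij nij ->]]] ->]]].
rewrite mulrA (lie_eq (erefl (lie X (aE i j)))) mulrDl -mulrA; apply: gsD.
  by apply: rmults_gen; exists i, j.
exact: lower_rest_lie.
Qed.

Lemma rmults_mulr (S : set A) (X Y : A) :
  gen_subgroup (rmults S) Y -> gen_subgroup (rmults S) (Y * X).
Proof.
move: Y; apply: (gs_morph (f := fun Y => Y * X)).
- exact: mul0r.
- by move=> v w; exact: mulrBl.
by move=> _ [Z [s [Ss ->]]]; rewrite -mulrA; exact: rmults_gen.
Qed.

Lemma lower_rest_adF Y : gen_subgroup (rmults lower_rest) Y ->
  gen_subgroup (rmults lower_rest) (ad Y).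
Proof.
by move=> BY; apply: gsB; [apply: lower_rest_lmul => //; right|exact: rmults_mulr].
Qed.

Lemma xi_lower_rest Y : gen_subgroup (rmults lower_rest) Y -> Jbar (xi Y).
Proof.
apply: xi_stable.
- exact: lower_rest_adF.
- by move=> Z; apply: lower_rest_lmul; left.
- move=> Z BZ; apply/(Jbar_theta theta).
  move: Z BZ; apply: gs_sub => _ [Z [_ [[i [j [ij _ ->]]] ->]]].
  by apply: gs_mem; exists Z, (aE i j); split=> //; exists i, j.
- by move=> s w; exact: Jbar_xicoef.
Qed.

Lemma srefl_lt (i j : 'I_m) : (j < i)%N -> ~~ ((i == R) && (j == L)) ->
  (tperm L R j < tperm L R i)%N /\ ~~ ((tperm L R i == R) && (tperm L R j == L)).
Proof.
rewrite -!val_eqE /=.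
by case: tpermP => [->|->|/eqP + /eqP +]; case: tpermP => [->|->|/eqP + /eqP +];
  rewrite -?val_eqE /=; lia.
Qed.

Lemma xi_Jideal Y : Jideal Y -> Jbar (xi (alg_perm (srefl c) Y)).
Proof.
move: Y; apply: gs_morph => [|Y Z|_ [Z [_ [[i [j [ij ->]]] ->]]]].
- by rewrite alg_perm0 xi0.
- by rewrite alg_permB xiB.
rewrite alg_permM alg_perm_aE /srefl.
have [/andP[/eqP-> /eqP->]|nij] := boolP ((i == R) && (j == L)).
  rewrite tpermL tpermR; exact: xi_Ec_mul.
apply: xi_lower_rest; apply: rmults_gen; exists (tperm L R i), (tperm L R j).
by have [] := srefl_lt ij nij.
Qed.

Lemma upper_rest_lie (i j : 'I_m) (Z : A) :
  (i < j)%N -> ~~ ((i == L) && (j == R)) ->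
  gen_subgroup (lmults upper_rest) (Z * ad (aE i j)).
Proof.
have gen (k l : 'I_m) (b : bool) : (b -> (k < l)%N /\ ~~ ((k == L) && (l == R))) ->
    gen_subgroup (lmults upper_rest) (Z * (aE k l *+ b)).
  case: b => [/(_ isT)[kl nkl]|_]; last by rewrite mulr0n mulr0; exact: gs0.
  by rewrite mulr1n; apply: lmults_gen; left; exists k, l.
move=> ij nij; rewrite adF_aE mulrBr; apply: gsB; apply: gen;
  move=> /eqP/(congr1 val) /= e; move: ij nij; rewrite -!val_eqE /=; lia.
Qed.

Lemma upper_rest_adF Y : gen_subgroup (lmults upper_rest) Y ->
  gen_subgroup (lmults upper_rest) (ad Y).
Proof.
move: Y; apply: gs_morph; [exact: adF0|exact: adFB|].
move=> _ [Z [X [X_gen ->]]]; rewrite adFM; apply: gsD; first exact: lmults_gen.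
case: X_gen => [[i [j [ij nij ->]]]|[b [k ->]]]; first exact: upper_rest_lie.
rewrite adF_aD mulrN mulrnAr; apply/gsN/gsMn/lmults_gen.
by right; exists L, k.
Qed.

Lemma xi_upper_rest mu Y : gen_subgroup (lmults upper_rest) Y -> JIbar mu (xi Y).
Proof.
apply: xi_stable.
- exact: upper_rest_adF.
- by move=> Z; exact: (lideal_mul (rel := @Arel F m n)).
- move=> Z BZ; apply/JIbar_I/(Ibar_theta theta).
  move: Z BZ; apply: gs_sub => _ [Z [X [X_gen ->]]].
  apply: gs_mem; exists Z, X; split=> //.
  by case: X_gen => [[i [j [ij _ ->]]]|[b [k ->]]]; [left; left; exists i, j|right; exists b, k].
- by move=> s w; exact: JIbar_xicoef.
Qed.

(** The rho-shift of a simple reflection amounts to eps_c, exactly the shift produced by xi_c; hence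
    the target weight is the dot reflection of mu. *)
Lemma wdot_srefl mu k : wdot (srefl c) mu (srefl c k) = mu k - ep (srefl c k).
Proof.
rewrite /wdot /wperm /rho /eps !ffunE permK /srefl.
have RL : (R : nat)%:R = (L : nat)%:R + 1 :> F by rewrite natr1.
case: tpermP => [->|->|/eqP kL /eqP kR].
- by rewrite eqxx eq_sym neq_cLR /= RL; ring.
- by rewrite eqxx neq_cLR /= RL; ring.
- by rewrite (negbTE kL) (negbTE kR) subrr subr0 addrK.
Qed.

Lemma xi_Iideal mu Y : Iideal mu Y ->
  JIbar (wdot (srefl c) mu) (xi (alg_perm (srefl c) Y)).
Proof.
move: Y; apply: gs_morph => [|Y Z|_ [Z [X [X_gen ->]]]].
- by rewrite alg_perm0 xi0.
- by rewrite alg_permB xiB.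
rewrite alg_permM; case: X_gen => [[[i [j [ij ->]]]|[k ->]]|[b [k ->]]].
- rewrite alg_perm_aE /srefl.
  have [/andP[/eqP-> /eqP->]|nij] := boolP ((i == L) && (j == R)).
    rewrite tpermL tpermR; exact: xi_mul_Fc.
  apply: xi_upper_rest; apply: lmults_gen; left; exists (tperm L R i), (tperm L R j).
  by rewrite andbC in nij; have [? nji] := srefl_lt ij nij; split=> //; rewrite andbC.
- rewrite alg_permB alg_perm_aE alg_permC.
  have -> : mu k = wdot (srefl c) mu (srefl c k) + ep (srefl c k).
    by rewrite wdot_srefl subrK.
  exact: xi_mul_cartan.
- rewrite alg_perm_aD; apply: xi_upper_rest; apply: lmults_gen.
  by right; exists (srefl c b), k.
Qed.

End XiIdeals.

Lemma wdotE (F : fieldType) (m : nat) (s : 'S_m) (mu : weight F m) a :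
  wdot s mu a = mu ((s^-1)%g a) - ((s^-1)%g a : nat)%:R + (a : nat)%:R.
Proof. by rewrite !ffunE opprK. Qed.

Lemma wdot_generic (F : fieldType) (m : nat) (s : 'S_m) (mu : weight F m) :
  generic_weight mu -> generic_weight (wdot s mu).
Proof.
move=> mug a b ab z; rewrite !wdotE => E.
have : (s^-1)%g a != (s^-1)%g b by rewrite (inj_eq perm_inj).
move=> /mug /(_ (z + ((s^-1)%g a : nat)%:Z - a%:Z - ((s^-1)%g b : nat)%:Z + b%:Z)); apply.
rewrite !(rmorphD, rmorphN) /= -E -!pmulrn; ring.
Qed.

(** * Independence of the choices in I_c *)

Section Evaluation.
Variables (F : numFieldType) (m n : nat).
Variables (Abar : unitRingType) (theta : {rmorphism Aalg F m n -> Abar}).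
Hypothesis fractions : ring_of_fractions theta (uh n @` @denoms F m).
Local Notation A := (Aalg F m n).
Local Notation uh := (@uh F m n).
Local Notation denoms := (@denoms F m).
Local Notation Uf := (@Uf F m n Abar theta).
Local Notation Jbar := (@Jbar F m n Abar theta).
Local Notation Ibar := (@Ibar F m n Abar theta).
Local Notation JIbar := (@JIbar F m n Abar theta).
Implicit Types (p q d : {mpoly F[m]}) (X Y Z : A) (w : Abar).

Lemma UfE p : Uf p = theta (uh p). Proof. by []. Qed.

Lemma theta_eq X Y : theta X = theta Y -> exists2 d, denoms d & uh d * X = uh d * Y.
Proof.
move=> XY; have : theta (X - Y) = 0 by rewrite (rmorphB theta) XY subrr.
move=> /(theta_eq0 fractions)[d dd E]; exists d => //.
by apply/eqP; rewrite -subr_eq0 -mulrBr; apply/eqP.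
Qed.

Lemma JIbar_theta mu Y : JIbar mu (theta Y) ->
  exists d j i, [/\ denoms d, Jideal j, Iideal mu i & uh d * Y = j + i].
Proof.
move=> /(JIbar_clear fractions)[d [j [i [dd Jj Ii]]]].
rewrite UfE -rmorphM => /theta_eq[t dt E].
exists (t * d), (uh t * j), (uh t * i); split; first exact: denomsM.
- exact: uh_Jideal.
- exact: Iideal_mul.
- by rewrite uhM -mulrA E mulrDr.
Qed.

Lemma coinv_of_eq mu Y Z : coinv_of mu Y = coinv_of mu Z -> JIbar mu (theta Y - theta Z).
Proof.
move=> E; have : coinv_of mu (Y - Z) = 0.
  by rewrite (linear_funB (coinv_of_linear mu)) E subrr.
move=> /coinv_of_eq0[j [i [Jj Ii YZ]]]; rewrite -(rmorphB theta) YZ rmorphD.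
by apply: gsD; [exact/JIbar_J/Jbar_theta|exact/JIbar_I/Ibar_theta].
Qed.

(** The chosen preimage differs from Z by an element of A that a denominator moves into J + I_mu; by
    genericity that denominator cancels on coinvariants. *)
Lemma of_double_theta mu Z : generic_weight mu ->
  of_double (qz (Jbar `|` Ibar mu) (theta Z) : JAI theta mu) = coinv_of mu Z.
Proof.
move=> mug; rewrite /of_double.
set P := [set Y | _]; have PZ : P Z by [].
have PY : P (xget 0 P) := xgetPex 0 (ex_intro _ Z PZ).
set Y := xget 0 P in PY *; have /qz_eq : qz (Jbar `|` Ibar mu) (theta Y) = qz _ (theta Z) := PY.
rewrite -(rmorphB theta) => /JIbar_theta[d [j [i [dd Jj Ii E]]]].
apply/eqP; rewrite -subr_eq0 -(linear_funB (coinv_of_linear mu)); apply/eqP.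
by apply: (coinv_of_denom_eq0 mug dd); exists j, i.
Qed.

Variable c : 'I_m.-1.
Local Notation sg := (srefl c).
Local Notation sact := (@alg_perm F m n sg).
Local Notation xi := (@xi F m n Abar theta c).

(** Exposes the unknown fraction selected by [xget]; [xibarP] does the same for xi-bar. Their
    agreement with other choices is settled in [xicheck_JI]. *)
Lemma abar_permP w : exists d Y, [/\ denoms d, w = (Uf d)^-1 * theta Y &
  abar_perm theta sg w = (Uf (hperm sg d))^-1 * theta (sact Y)].
Proof.
have [d [Y [dd wE]]] := fracP fractions w; rewrite /abar_perm.
set P := [set z | _].
have PY : P ((theta (sact (uh d)))^-1 * theta (sact Y)) by exists d, Y.
have [d' [Y' [dd' wE' E]]] : P (xget 0 P) := xgetPex 0 (ex_intro _ _ PY).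
by exists d', Y'; split=> //; rewrite E alg_perm_uh.
Qed.

Lemma xibarP d X : denoms d -> exists p s Y,
  [/\ denoms s, (Uf d)^-1 * theta X = (Uf s)^-1 * Uf p * theta Y &
    xibar theta c ((Uf d)^-1 * theta X) =
    qz Jbar ((Uf (uh_shift c s))^-1 * Uf (uh_shift c p) * xi Y) :> JA theta].
Proof.
move=> dd; rewrite /xibar; set P := [set w | _].
have PX : P (qz Jbar (ufrac theta (uh_shift c 1) (uh_shift c d) * xi X)).
  by exists 1, d, X; split=> //; rewrite /ufrac uh1 rmorph1 mulr1.
have [p [s [Y [ds E E']]]] : P (xget 0 P) := xgetPex 0 (ex_intro _ _ PX).
by exists p, s, Y.
Qed.

Lemma xi_uh_JI mu p Y : JIbar mu (xi (uh p * Y) - Uf (uh_shift c p) * xi Y).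
Proof. by apply: JIbar_J; exact: xi_uh. Qed.

Lemma JIbar_trans mu w w' w'' :
  JIbar mu (w - w') -> JIbar mu (w' - w'') -> JIbar mu (w - w'').
Proof. by move=> H H'; rewrite -(subrKA w'); exact: gsD. Qed.

Lemma JIbar_sym mu w w' : JIbar mu (w - w') -> JIbar mu (w' - w).
Proof. by move=> H; rewrite -opprB; exact: gsN. Qed.

(** Two unknown fractions occur, one for w and one for its image under sigma_c. Each is related to
    known elements by an identity in A after multiplication by a denominator; xi_c is applied to
    these identities, and the shifted denominators, still units, are cancelled. *)
Lemma xicheck_JI mu w Y : JIbar mu (w - theta Y) ->
  exists2 w', xibar theta c (abar_perm theta sg w) = qz Jbar w' :> JA theta &
    JIbar (wdot sg mu) (w' - xi (sact Y)).
Proof.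
move=> wY; have [d [Y' [dd wE ->]]] := abar_permP w.
have [p [s [X [ds XE ->]]]] := xibarP (sact Y') (denoms_hperm sg dd).
eexists; first by [].
set d' := hperm sg d in XE; set mu' := wdot sg mu.
have dd' : denoms d' by exact: denoms_hperm.
(* Equality of the two fractions of sigma_c w, brought back to A; t is the denominator that kills
   the difference in the kernel of [theta]. *)
have [t dt tE] : exists2 t, denoms t & uh (t * s) * sact Y' = uh (t * (d' * p)) * X.
  have : theta (uh s * sact Y') = theta (uh (d' * p) * X).
    rewrite !rmorphM -/(Uf s) -/(Uf (d' * p)) UfM.
    have -> : theta (sact Y') = Uf d' * ((Uf d')^-1 * theta (sact Y')).
      by rewrite mulrA divrr ?mul1r // Uf_unit.
    rewrite XE !mulrA [Uf s * _]Uf_commute -[_ * Uf s / _]mulrA divrr ?Uf_unit //.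
    by rewrite mulr1.
  by move=> /theta_eq[t dt E]; exists t => //; rewrite !uhM -!mulrA in E *.
(* The congruence between w and Y, brought back to A by clearing denominators with e. *)
have [e [j [i [de Jj Ii eE]]]] : exists e j i, [/\ denoms e, Jideal j, Iideal mu i &
    uh e * Y' = uh (e * d) * Y + (j + i)].
  have : JIbar mu (theta (Y' - uh d * Y)).
    have -> : theta (Y' - uh d * Y) = Uf d * (w - theta Y).
      by rewrite wE mulrBr mulrA divrr ?Uf_unit // mul1r (rmorphB theta) rmorphM.
    exact: JIbar_Uf.
  move=> /JIbar_theta[e [j [i [de Jj Ii E]]]]; exists e, j, i; split=> //.
  by rewrite -E mulrBr uhM mulrA addrC subrK.
pose e' := hperm sg e.
have de' : denoms e' by exact: denoms_hperm.
have e'E : uh e' * sact Y' = uh (e' * d') * sact Y + (sact j + sact i).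
  rewrite -[uh e']alg_perm_uh -alg_permM eE !alg_permD alg_permM alg_perm_uh.
  by rewrite /hperm rmorphM.
(* Abstracting the shifted polynomials to a commuting multiplicative family with units keeps the
   rearrangements below purely formal. *)
have [V [VE VM VC Vu]] : exists V : {mpoly F[m]} -> Abar,
    [/\ forall r, Uf (uh_shift c r) = V r, forall r r', V (r * r') = V r * V r',
        forall r r', V r * V r' = V r' * V r & forall r, denoms r -> V r \is a GRing.unit].
  exists (fun r => Uf (uh_shift c r)); split=> [//|r r'|r r'|r dr].
  - by rewrite uh_shiftM UfM.
  - exact: Uf_commute.
  - exact/Uf_unit/denoms_shift.
have JV r w1 w2 : JIbar mu' (w1 - w2) -> JIbar mu' (V r * w1 - V r * w2).
  by rewrite -mulrBr -VE; exact: JIbar_Uf.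
have xiV r Y1 : JIbar mu' (xi (uh r * Y1) - V r * xi Y1).
  by rewrite -VE; exact: xi_uh_JI.
have ts_unit : denoms (t * s) by exact: denomsM.
have ed_unit : denoms (e' * d') by exact: denomsM.
have cancel w1 : JIbar mu' (V (t * s) * (V (e' * d') * w1)) -> JIbar mu' w1.
  move=> H.
  have H1 := JIbar_inv fractions (denoms_shift c ts_unit) H.
  rewrite VE mulKr in H1; last exact: Vu.
  have H2 := JIbar_inv fractions (denoms_shift c ed_unit) H1.
  by rewrite VE mulKr in H2; last exact: Vu.
apply: cancel; rewrite !VE mulrBr mulrBr.
have -> : V (t * s) * (V (e' * d') * ((V s)^-1 * V p * xi X)) =
    V e' * (V (t * (d' * p)) * xi X).
  rewrite -mulrA; have -> : V (e' * d') * ((V s)^-1 * (V p * xi X)) =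
      (V s)^-1 * (V (e' * d') * (V p * xi X)).
    by rewrite !mulrA; congr (_ * _ * _); apply: commrV; exact: VC.
  rewrite VM [V t * _]VC -mulrA [V t * (_ * _)]mulrA [V t * _]commrV; last exact: VC.
  rewrite -mulrA mulVKr; last exact: Vu.
  by rewrite !VM -!mulrA mulrA [V t * V _]VC -mulrA.
(* Both sides are compared with xi_c of multiples of sigma_c Y': [tE] connects it with X, and [e'E]
   with sigma_c Y up to sigma_c(j) and sigma_c(i). *)
apply: (@JIbar_trans _ _ (V e' * xi (uh (t * (d' * p)) * X))).
  by apply: JV; exact/JIbar_sym/xiV.
rewrite -tE.
apply: (@JIbar_trans _ _ (V e' * (V (t * s) * xi (sact Y')))); first exact/JV/xiV.
rewrite mulrA VC -mulrA; apply: JV.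
apply: (@JIbar_trans _ _ (xi (uh e' * sact Y'))); first exact/JIbar_sym/xiV.
rewrite e'E xiD // addrAC; apply: gsD; first exact: xiV.
by rewrite xiD //; apply: gsD; [apply: JIbar_J; exact: xi_Jideal|exact: xi_Iideal].
Qed.

(** The interface to I_c for the rest of the proof: the hypothesis is a congruence in which no
    chosen representative appears. *)
Lemma Iop_coinv_of mu Y Z : generic_weight mu ->
  JIbar (wdot sg mu) (xi (sact Y) - theta Z) ->
  Iop theta c (coinv_of mu Y) = coinv_of (wdot sg mu) Z.
Proof.
move=> mug YZ; rewrite -(of_double_theta Z (wdot_generic (s := sg) mug)) /Iop; congr of_double.
rewrite /xidouble /to_double.
set P := [set Y' | _]; have PY : P Y by [].
have /coinv_of_eq YY0 : P (xget 0 P) := xgetPex 0 (ex_intro _ Y PY).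
set Y0 := xget 0 P in YY0 *.
set S := Jbar `|` Ibar mu; set S' := Jbar `|` Ibar (wdot sg mu).
pose y1 := repr (qz S (theta Y0)).
have y1Y : JIbar mu (y1 - theta Y) by apply: JIbar_trans (qz_repr S _) YY0.
pose y2 := repr (qz Jbar y1).
have y2Y : JIbar mu (y2 - theta Y).
  apply: JIbar_trans y1Y; apply: JIbar_J.
  by apply: gs_sub (qz_repr Jbar y1).
have [w' w'E w'Y] := xicheck_JI y2Y.
rewrite -[LHS]/(qz S' (repr (xicheck c (qz Jbar y1 : JA theta)))) /xicheck -/y2 w'E.
apply/qz_eq; apply: JIbar_trans YZ; apply: JIbar_trans w'Y; apply: JIbar_J.
by apply: gs_sub (qz_repr Jbar w').
Qed.

End Evaluation.

(** * The vectors v *)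

Section Lie.
Variable R : pzRingType.
Implicit Types x y z : R.

Lemma lie_jacobi x y z : lie x (lie y z) = lie (lie x y) z + lie y (lie x z).
Proof.
rewrite -[lie y z]/(y * z - z * y) lieBr !lieMr -[lie (lie x y) z]/(_ - _).
rewrite -[lie y (lie x z)]/(y * lie x z - lie x z * y).
by rewrite [lie x z * y + _]addrC opprD addrACA.
Qed.

Lemma lie_prod_weight I (r : seq I) (f : I -> R) (w : I -> nat) x :
  (forall i, lie x (f i) = f i *+ w i) ->
  lie x (\prod_(i <- r) f i) = (\prod_(i <- r) f i) *+ (\sum_(i <- r) w i).
Proof.
move=> xf; elim: r => [|i r IH]; first by rewrite !big_nil lie1r.
by rewrite !big_cons lieMr IH xf mulrnAl mulrnAr -mulrnDr.
Qed.

Lemma lie_prod0 (I : eqType) (r : seq I) (f : I -> R) x :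
  (forall i, i \in r -> lie x (f i) = 0) -> lie x (\prod_(i <- r) f i) = 0.
Proof.
elim: r => [|i r IH] xf; first by rewrite big_nil lie1r.
rewrite big_cons lieMr xf ?mem_head // mul0r add0r IH ?mulr0 // => j jr.
by apply: xf; rewrite in_cons jr orbT.
Qed.
End Lie.

(** With t_s the s-th product, (h - d + 1) times the sum of t_s over s < M is (h + 1) - (h - M + 1)
    t_M, and t_M contains the factor d - d once M > d. *)
Lemma sum_falling_ratio (F : fieldType) (d : nat) (h : F) M :
  (forall j : nat, h - j%:R != 0) -> h - d%:R + 1 != 0 -> (d < M)%N ->
  \sum_(s < M) \prod_(0 <= j < s) ((d%:R - j%:R) / (h - j%:R)) = (h + 1) / (h - d%:R + 1).
Proof.
move=> hj hd dM; apply: (mulIf hd); rewrite divfK // mulr_suml.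
pose t s : F := \prod_(0 <= j < s) ((d%:R - j%:R) / (h - j%:R)).
have tM : t M = 0.
  rewrite /t big_mkord (bigD1 (Ordinal dM)) //= subrr mul0r mul0r.
  by [].
have -> : h + 1 = (h - 0%:R + 1) * t 0%N - (h - M%:R + 1) * t M.
  by rewrite tM mulr0 subr0 /t big_geq // mulr1 subr0.
elim: M {dM tM} => [|M IH]; first by rewrite big_ord0 subrr.
rewrite big_ord_recr /= IH -/(t M).
have -> : t M.+1 = t M * ((d%:R - M%:R) / (h - M%:R)) by rewrite /t big_nat_recr.
rewrite -natr1; field.
exact: hj.
Qed.

(** * Products of anticommuting elements *)

Section Anticommuting.
Variables (R : pzRingType) (I : Type) (x : I -> R).
Hypothesis xx : forall i j, x i * x j = - (x j * x i).
Local Notation P r := (\prod_(i <- r) x i).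

Lemma anti_prod_l i r : x i * P r = (-1) ^+ size r * (P r * x i).
Proof.
elim: r => [|j r IH]; first by rewrite !big_nil mulr1 !mul1r.
rewrite big_cons mulrA xx mulNr -mulrA IH exprS -!mulrA mulN1r; congr (- _).
by rewrite !mulrA; congr (_ * _ * _); exact: commr_sign.
Qed.

Lemma anti_prod r r' : P r * P r' = (-1) ^+ (size r * size r') * (P r' * P r).
Proof.
elim: r => [|i r IH]; first by rewrite !big_nil mul1r mulr1 mul1r.
rewrite !big_cons -mulrA IH /= mulSn exprD [x i * _]mulrA commr_sign -!mulrA.
rewrite [x i * _]mulrA anti_prod_l -!mulrA mulrA [RHS]mulrA.
by rewrite -!exprD addnC.
Qed.
End Anticommuting.

Section AnticommutingEq.
Variables (R : pzRingType) (I : eqType) (x : I -> R).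
Hypothesis xx : forall i j, x i * x j = - (x j * x i).
Hypothesis xsq : forall i, x i * x i = 0.
Local Notation P r := (\prod_(i <- r) x i).

Lemma mul_anti_prod_mem (r : seq I) i : i \in r -> x i * P r = 0.
Proof.
case/splitPr => r1 r2; rewrite big_cat big_cons /= mulrA anti_prod_l //.
by rewrite -!mulrA [x i * (x i * _)]mulrA xsq mul0r !mulr0.
Qed.

Lemma anti_prod_mul_mem (r : seq I) i : i \in r -> P r * x i = 0.
Proof.
move=> ir; have := mul_anti_prod_mem ir; rewrite anti_prod_l //.
move=> /(congr1 (fun z => (-1) ^+ size r * z)).
by rewrite mulrA -expr2 sqrr_sign mul1r mulr0.
Qed.
End AnticommutingEq.

(** * The blocks of w_nu under sigma_c, ad E_c and ad F_c *)

Section Blocks.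
Variables (F : numFieldType) (m n : nat).
Local Notation A := (Aalg F m n).
Local Notation aE a b := (@aE F m n a b).
Local Notation xv := (fun i : 'I_m * 'I_n => @aX F m n i.1 i.2).
Implicit Types (nu : 'I_m -> nat).

Definition bseq (a : 'I_m) p : seq ('I_m * 'I_n) :=
  [seq (a, k) | k <- enum [pred k : 'I_n | (k < p)%N]].

Lemma size_bseq a p : (p <= n)%N -> size (bseq a p) = p.
Proof.
move=> pn; rewrite size_map -cardE -[RHS]card_ord.
rewrite -(card_imset _ (f := widen_ord pn)); last by move=> i j /(congr1 val) /= /val_inj.
apply: eq_card => k; rewrite inE /=; apply/idP/imsetP => [kp|[i _ ->]].
  by exists (Ordinal kp) => //; exact: val_inj.
exact: (ltn_ord i).
Qed.

Lemma mem_bseq a p i : (i \in bseq a p) = (i.1 == a) && (i.2 < p)%N.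
Proof.
case: i => b k /=; apply/mapP/andP => [[k' + [-> ->]]|[/eqP-> kp]].
  by rewrite mem_enum inE eqxx.
by exists k => //; rewrite mem_enum.
Qed.

Definition block a p : A := \prod_(i <- bseq a p) xv i.
(** A lift of w_nu to A, where sigma_c and the derivations ad E_c and ad F_c can act on it. *)
Definition aW nu : A := \prod_(a <- enum 'I_m) block a (nu a).

Lemma xv_anti i j : xv i * xv j = - (xv j * xv i).
Proof. exact: aXX. Qed.

Lemma xv_sq i : xv i * xv i = 0.
Proof.
have /eqP := xv_anti i i; rewrite -addr_eq0 -mulr2n -scaler_nat scaler_eq0 pnatr_eq0.
by move=> /eqP.
Qed.

Lemma aact_prod_xv mu (r : seq ('I_m * 'I_n)) :
  aact (\prod_(i <- r) xv i) (tens (verma1 mu) (gone F m n)) =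
  tens (verma1 mu) (foldr (@gmul F m n) (gone F m n) [seq gvar F i.1 i.2 | i <- r]).
Proof.
elim: r => [|i r IH]; first by rewrite big_nil -[1]scale1r aactC scale1r.
rewrite big_cons aactM IH (aact_cls (Gen (AG (GX i.1 i.2)))) /=.
by rewrite tens_tensr //; exact: (xop_linear i).
Qed.

Lemma aWE nu : aW nu = \prod_(i <- flatten [seq bseq a (nu a) | a <- enum 'I_m]) xv i.
Proof. by rewrite big_flatten big_map. Qed.

Lemma vvecE mu lambda :
  vvec n mu lambda = coinv_of mu (aW (fun a => nat_label (lambda a - mu a))).
Proof.
rewrite coinv_ofE aWE aact_prod_xv /vvec /wvec; congr (qcls _ (tens _ (foldr _ _ _))).
rewrite map_flatten -map_comp; congr flatten; apply: eq_map => a /=.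
by rewrite /bseq -map_comp.
Qed.

Lemma lie_aE_xv a b i : lie (aE a b) (xv i) = @aX F m n a i.2 *+ (b == i.1).
Proof. exact: aE_X. Qed.

Lemma lie_aE_block a b d p : b != d -> lie (aE a b) (block d p) = 0.
Proof.
move=> bd; apply: lie_prod0 => i; rewrite mem_bseq lie_aE_xv => /andP[/eqP-> _].
by rewrite (negbTE bd) mulr0n.
Qed.

Lemma lie_cartan_aW a nu : (nu a <= n)%N -> lie (aE a a) (aW nu) = aW nu *+ nu a.
Proof.
move=> nua; rewrite aWE (@lie_prod_weight _ _ _ _ (fun i => a == i.1 : nat)) => [|i].
  congr (_ *+ _); rewrite big_flatten big_map.
  rewrite (eq_bigr (fun b => size (bseq b (nu b)) * (a == b)))%N => [|b _].
    rewrite big_enum (bigD1 a) //= big1 ?addn0 ?eqxx ?muln1 ?size_bseq // => b ba.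
    by rewrite eq_sym (negbTE ba) muln0.
  rewrite /bseq big_map /= big_const_seq count_predT size_map iter_addn_0.
  by rewrite mulnC.
by rewrite lie_aE_xv; case: eqVneq => [->|].
Qed.

Lemma anti_block a p b q : (p <= n)%N -> (q <= n)%N ->
  block a p * block b q = (-1) ^+ (p * q) * (block b q * block a p).
Proof. by move=> pn qn; rewrite /block (anti_prod xv_anti) !size_bseq. Qed.

Section Transposition.
Variable c : 'I_m.-1.
Local Notation L := (cL c).
Local Notation R := (cR c).

Definition outer_l := take L (enum 'I_m).
Definition outer_r := drop L.+2 (enum 'I_m).

Lemma enum_split : enum 'I_m = outer_l ++ L :: R :: outer_r.
Proof.
rewrite -[LHS](cat_take_drop L); congr (_ ++ _).
have szL : (L < size (enum 'I_m))%N by rewrite size_enum_ord.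
have szR : (L.+1 < size (enum 'I_m))%N by rewrite size_enum_ord (ltn_ord R).
rewrite (drop_nth L szL) nth_ord_enum (drop_nth R szR).
by rewrite (nth_ord_enum R R).
Qed.

Lemma outer_notin a : a \in outer_l ++ outer_r -> (a != L) && (a != R).
Proof.
have := enum_uniq 'I_m; rewrite enum_split => u ao.
have : uniq (L :: R :: (outer_l ++ outer_r)).
  by rewrite -[_ :: _ :: _]/([:: L; R] ++ (outer_l ++ outer_r)) uniq_catCA.
rewrite /= inE negb_or -andbA => /and4P[_ Lo Ro _].
by apply/andP; split; [apply: contraNneq Lo|apply: contraNneq Ro] => <-.
Qed.

Definition outer nu (r : seq 'I_m) : A := \prod_(a <- r) block a (nu a).

Lemma aW_split nu : aW nu =
  outer nu outer_l * (block L (nu L) * block R (nu R)) * outer nu outer_r.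
Proof. by rewrite /aW enum_split big_cat /= !big_cons !mulrA. Qed.

Lemma lie_outer a b nu r : (b == L) || (b == R) -> {subset r <= outer_l ++ outer_r} ->
  lie (aE a b) (outer nu r) = 0.
Proof.
move=> bLR ro; apply: lie_prod0 => d /ro/outer_notin/andP[dL dR].
apply: lie_aE_block; apply: contraTneq bLR => ->.
by rewrite negb_or dL.
Qed.

Lemma lie_aW a b nu : (b == L) || (b == R) -> lie (aE a b) (aW nu) =
  outer nu outer_l * lie (aE a b) (block L (nu L) * block R (nu R)) * outer nu outer_r.
Proof.
move=> bLR; rewrite aW_split !lieMr !lie_outer // => [|d dr|d dl]; last first.
- by rewrite mem_cat dl.
- by rewrite mem_cat dr orbT.
by rewrite mul0r add0r mulr0 addr0.
Qed.

(** ad E_c replaces one variable of row c+1 by the variable of row c in the same column; as nu_(c+1)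
    <= nu_c, that variable already occurs in block c and its square is 0. [lie_Fc_aW] is the mirror
    case. *)
Lemma lie_Ec_aW nu : (nu R <= nu L)%N -> lie (Ec F n c) (aW nu) = 0.
Proof.
move=> RL; rewrite lie_aW ?eqxx ?orbT // lieMr lie_aE_block ?mul0r ?add0r; last first.
  by rewrite eq_sym neq_cLR.
suff -> : block L (nu L) * lie (aE L R) (block R (nu R)) = 0 by rewrite mulr0 mul0r.
rewrite /block; have : {subset bseq R (nu R) <= [pred i | (i.1 == R) && ((L, i.2) \in bseq L (nu L))]}.
  move=> i; rewrite mem_bseq inE mem_bseq eqxx /= => /andP[-> /=] iR.
  exact: leq_trans RL.
elim: (bseq R (nu R)) => [|i r IH] sub; first by rewrite big_nil lie1r mulr0.
have /andP[/eqP i1 iL] := sub i (mem_head _ _).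
rewrite big_cons lieMr lie_aE_xv i1 eqxx mulr1n mulrDr mulrA.
rewrite -[aX _ _ _]/(xv (L, i.2)) (anti_prod_mul_mem xv_anti xv_sq iL) mul0r add0r mulrA.
have -> : (\prod_(j <- bseq L (nu L)) xv j) * xv (R, i.2) =
    (-1) ^+ size (bseq L (nu L)) * (xv (R, i.2) * \prod_(j <- bseq L (nu L)) xv j).
  by rewrite (anti_prod_l xv_anti) mulrA -expr2 sqrr_sign mul1r.
rewrite -!mulrA IH ?mulr0 // => j jr.
by apply: sub; rewrite in_cons jr orbT.
Qed.

Lemma lie_Fc_aW nu : (nu L <= nu R)%N -> lie (Fc F n c) (aW nu) = 0.
Proof.
move=> LR; rewrite lie_aW ?eqxx // lieMr [lie _ (block R _)]lie_aE_block ?mulr0 ?addr0; last first.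
  by rewrite neq_cLR.
suff -> : lie (aE R L) (block L (nu L)) * block R (nu R) = 0 by rewrite mulr0 mul0r.
rewrite /block; have : {subset bseq L (nu L) <= [pred i | (i.1 == L) && ((R, i.2) \in bseq R (nu R))]}.
  move=> i; rewrite mem_bseq inE mem_bseq eqxx /= => /andP[-> /=] iL.
  exact: leq_trans LR.
elim: (bseq L (nu L)) => [|i r IH] sub; first by rewrite big_nil lie1r mul0r.
have /andP[/eqP i1 iR] := sub i (mem_head _ _).
rewrite big_cons lieMr lie_aE_xv i1 eqxx mulr1n mulrDl -[X in _ + X]mulrA IH; last first.
  by move=> j jr; apply: sub; rewrite in_cons jr orbT.
rewrite mulr0 addr0 -[aX _ _ _]/(xv (R, i.2)) (anti_prod_l xv_anti) -!mulrA.
by rewrite (mul_anti_prod_mem xv_anti xv_sq iR) !mulr0.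
Qed.

Lemma alg_perm_block (s : 'S_m) a p : alg_perm s (block a p) = block (s a) p.
Proof.
rewrite /block alg_perm_prod /bseq !big_map; apply: eq_bigr => k _.
by rewrite alg_perm_aX.
Qed.

Lemma alg_perm_aW nu nu' : (nu L <= n)%N -> (nu R <= n)%N ->
  (forall a, nu' (srefl c a) = nu a) ->
  alg_perm (srefl c) (aW nu) = (-1) ^+ (nu L * nu R) *: aW nu'.
Proof.
move=> nL nR nuE; rewrite {1}/aW alg_perm_prod enum_split big_cat /= !big_cons.
under eq_bigr => a _ do rewrite alg_perm_block.
under [X in _ * (_ * (_ * X))]eq_bigr => a _ do rewrite alg_perm_block.
have out r : {subset r <= outer_l ++ outer_r} ->
    \prod_(a <- r) block (srefl c a) (nu a) = outer nu' r.
  move=> ro; rewrite [LHS]big_seq /outer [RHS]big_seq; apply: eq_bigr => a /ro/outer_notin.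
  case/andP=> aL aR; have sa : srefl c a = a by rewrite /srefl tpermD // eq_sym.
  by rewrite sa -(nuE a) sa.
rewrite !out => [|d dr|d dl]; last first.
- by rewrite mem_cat dl.
- by rewrite mem_cat dr orbT.
rewrite !alg_perm_block /srefl tpermL tpermR.
have nuL : nu' L = nu R by rewrite -(nuE R) /srefl tpermR.
have nuR : nu' R = nu L by rewrite -(nuE L) /srefl tpermL.
rewrite aW_split nuL nuR [block R _ * (_ * _)]mulrA anti_block //.
(* One sign is a power in A, the other a power in F; reducing the exponent to its parity makes them
   comparable. *)
rewrite -[in LHS]signr_odd -[in RHS]signr_odd.
case: (odd _); rewrite ?expr1 ?expr0 ?scale1r ?scaleN1r ?mul1r ?mulN1r.
  by rewrite mulNr mulrN !mulrA.
by rewrite !mulrA.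
Qed.

End Transposition.

End Blocks.

Lemma nat_labelK (F : numFieldType) (k : nat) : nat_label (k%:R : F) = k.
Proof.
rewrite /nat_label; set P := [set j | _].
have Pk : P k by [].
by have /eqP : P (xget 0%N P) := xgetPex 0%N (ex_intro _ k Pk); rewrite eqr_nat => /eqP.
Qed.

(** * xi_c on highest weight vectors, and I_c on the vectors v *)

Section Intertwining.
Variables (F : numFieldType) (m n : nat).
Variables (Abar : unitRingType) (theta : {rmorphism Aalg F m n -> Abar}).
Hypothesis fractions : ring_of_fractions theta (uh n @` @denoms F m).
Local Notation A := (Aalg F m n).
Local Notation uh := (@uh F m n).
Local Notation Uf := (@Uf F m n Abar theta).
Local Notation JIbar := (@JIbar F m n Abar theta).
Variable c : 'I_m.-1.
Local Notation E := (Ec F n c).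
Local Notation Fm := (Fc F n c).
Local Notation H := (Hc F n c).
Local Notation L := (cL c).
Local Notation R := (cR c).
Local Notation aE a b := (@aE F m n a b).
Local Notation ad := (@adF F m n c).
Local Notation adE := (@lie A E).
Local Notation xi := (@xi F m n Abar theta c).
Implicit Types (mu lambda : weight F m).

Lemma iter_adE_Z s (k : F) (Y : A) : iter s adE (k *: Y) = k *: iter s adE Y.
Proof. by elim: s => //= s ->; rewrite /lie ascaleAl ascaleAr scalerBr. Qed.

(** A right factor E_c lies in I_mu, so modulo I_mu left multiplication by E_c may be replaced by ad
    E_c. *)
Lemma Ec_pow_mul s (Y : A) : exists Z, E ^+ s * Y = iter s adE Y + Z * E.
Proof.
elim: s => [|s [Z EZ]]; first by exists 0; rewrite mul0r addr0 mul1r.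
exists (iter s adE Y + E * Z); rewrite exprS -mulrA EZ mulrDr mulrA iterS.
by rewrite (lie_eq (erefl (adE (iter s adE Y)))) mulrDl [_ * E + lie _ _]addrC -addrA.
Qed.

Section HighestWeight.
Variables (d : nat) (W : A).
Hypothesis EW : adE W = 0.
Hypothesis HW : lie H W = W *+ d.

Lemma lie_Hc_iter s : lie H (iter s ad W) = (d%:R - (2 * s)%:R) *: iter s ad W.
Proof.
elim: s => [|s IH]; first by rewrite muln0 subr0 scaler_nat.
rewrite iterS adFE lie_jacobi IH [lie H Fm]lieC lie_Fc_Hc.
have -> : lie (- (Fm *+ 2)) (iter s ad W) = - (lie Fm (iter s ad W) *+ 2).
  by rewrite /lie mulNr mulrN -opprD mulrnAl mulrnAr mulrnBl.
rewrite -[lie Fm (_ *: _)]/(ad _) adFZ adFE -scaler_nat -scaleNr -scalerDl.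
by congr (_ *: _); rewrite mulnS natrD; ring.
Qed.

Lemma lie_Ec_iter s : adE (iter s.+1 ad W) = (s.+1%:R * (d%:R - s%:R)) *: iter s ad W.
Proof.
elim: s => [|s IH].
  rewrite iterS adFE lie_jacobi EW lie_Ec_Fc HW /= lie0r addr0 mul1r subr0.
  by rewrite scaler_nat.
rewrite iterS adFE lie_jacobi IH lie_Ec_Fc lie_Hc_iter -[lie Fm (_ *: _)]/(ad _) adFZ.
rewrite -iterS -scalerDl; congr (_ *: _).
by rewrite mulnS mul2n -addnn !natrD -!natr1; ring.
Qed.

Lemma iter_adE_adF s : iter s adE (iter s ad W) =
  ((s`!)%:R * \prod_(0 <= j < s) (d%:R - j%:R)) *: W.
Proof.
elim: s => [|s IH]; first by rewrite big_geq // mulr1 scale1r.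
rewrite iterSr lie_Ec_iter iter_adE_Z IH scalerA; congr (_ *: _).
by rewrite factS natrM big_nat_recr //=; ring.
Qed.

Variables (mu wt : weight F m).
Hypothesis mu_generic : generic_weight mu.
Hypothesis Wwt : forall a, Iideal mu (aE a a * W - wt a *: W).
Hypothesis wtLR : wt L - wt R = mu L - mu R + d%:R.

Lemma uh_mul_weight p : Iideal mu (uh p * W - p.@[wt] *: W).
Proof.
elim/mpoly_ring_ind: p => [k|p q IHp IHq|a p IH].
- by rewrite uhC mevalC ascaleAl mul1r subrr; exact: gs0.
- by rewrite uhD mevalD mulrDl scalerDl opprD addrACA; exact: gsD.
- rewrite uhXM mevalM mevalXU -mulrA -(subrKA (p.@[wt] *: (aE a a * W))).
  apply: gsD; first by rewrite -ascaleAr -mulrBr; exact: Iideal_mul.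
  rewrite [wt a * _]mulrC -scalerA -scalerBr -[_ - _]mul1r -ascaleAl.
  exact: Iideal_mul.
Qed.

Lemma weight_gap_neq j : wt L - wt R - j%:R != 0 :> F.
Proof.
rewrite wtLR; apply/eqP => E0; apply: (mu_generic (a := L) (b := R) _ (z := j%:Z - d%:Z)).
  by rewrite neq_cLR.
rewrite rmorphB /= -!pmulrn; apply/eqP; rewrite -subr_eq0 -[X in _ == X]E0; apply/eqP.
ring.
Qed.

Lemma weight_gap_neqS : wt L - wt R - d%:R + 1 != 0 :> F.
Proof.
rewrite wtLR; apply/eqP => E0; apply: (mu_generic (a := L) (b := R) _ (z := - 1)).
  by rewrite neq_cLR.
rewrite rmorphN rmorph1; apply/eqP; rewrite -subr_eq0 -[X in _ == X]E0; apply/eqP.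
ring.
Qed.

(** Modulo I_mu a polynomial in h acts on W by its value at the weight of W. By genericity this
    value is nonzero, so the same holds for the inverse. *)
Lemma xicoef_weight s : JIbar mu (xicoef theta c s * theta W -
  Uf ((s`!%:R * \prod_(0 <= j < s) (wt L - wt R - j%:R))^-1)%:MP * theta W).
Proof.
set k := s`!%:R * _; have k0 : k != 0.
  rewrite mulf_neq0 ?pnatr_eq0 -?lt0n ?fact_gt0 // prodf_seq_neq0.
  by apply/allP => j _; exact: weight_gap_neq.
set p := (s`!%:R)%:MP * hden F c s : {mpoly F[m]}.
have pE : p.@[wt] = k.
  rewrite /p mevalM mevalC /hden rmorph_prod; congr (_ * _); apply: eq_bigr => j _ /=.
  by rewrite mevalD mevalB !mevalXU mevalC.
have pu : Uf p \is a GRing.unit.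
  by rewrite /p UfM unitrM_comm ?fact_unit ?Uf_hden //; exact: Uf_commute.
have H1 : JIbar mu (Uf p * theta W - Uf k%:MP * theta W).
  rewrite -theta_scale -pE -[Uf p]/(theta _) -rmorphM -(rmorphB theta).
  exact/JIbar_I/Ibar_theta/uh_mul_weight.
have H2 := JIbar_Uf fractions (k^-1)%:MP (JIbar_xicoef fractions c s H1).
rewrite mulrBr xicoefE -/p mulKr // mulrA in H2.
rewrite -(Uf_central fractions) -!mulrA mulrBr [Uf _ * (Uf _ * _)]mulrA in H2.
rewrite -UfM -mpolyCM mulVf // mpolyC1 Uf1 mul1r in H2.
by rewrite xicoefE -opprB; apply: gsN.
Qed.

Lemma JIbar_mul_Ec (Y : A) : JIbar mu (theta (Y * E)).
Proof.
by apply/JIbar_I/Ibar_theta/gs_mem; exists Y, E; split=> //; left; left; exists L, R.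
Qed.

Lemma xi_highest_weight : JIbar mu (xi W -
  theta (((wt L - wt R + 1) / (wt L - wt R - d%:R + 1)) *: W)).
Proof.
have [N HN] := xi_eval theta c W.
(* The range must be long enough both for the series of xi_c to be complete and for the closed form
   of the scalar sum. *)
have dM : (d < maxn N d.+1)%N by rewrite leq_max leqnn orbT.
have [_ ->] := HN _ (leq_maxl N d.+1).
rewrite -(sum_falling_ratio weight_gap_neq weight_gap_neqS dM) scaler_suml.
rewrite (rmorph_sum theta) -sumrB; apply: gs_sum => s _.
have [Z EZ] := Ec_pow_mul s (iter s ad W).
rewrite -rmorphXn -rmorphM EZ iter_adE_adF rmorphD mulrDr addrAC.
apply: gsD; last exact/(JIbar_xicoef fractions)/JIbar_mul_Ec.
rewrite !theta_scale mulrA -(Uf_central fractions) -mulrA.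
set x := s`!%:R * _.
have -> : \prod_(0 <= j < s) ((d%:R - j%:R) / (wt L - wt R - j%:R)) =
    x * (s`!%:R * \prod_(0 <= j < s) (wt L - wt R - j%:R))^-1.
  rewrite big_split /= prodfV /x invfM mulrACA divff ?mul1r //.
  by rewrite pnatr_eq0 -lt0n fact_gt0.
rewrite [(x / _)%:MP]mpolyCM [X in _ - X * _]UfM -[X in _ - X]mulrA.
by have := JIbar_Uf fractions x%:MP (xicoef_weight s); rewrite mulrBr.
Qed.

End HighestWeight.

Lemma wdot_srefl_LR mu :
  (wdot (srefl c) mu L = mu R - 1) * (wdot (srefl c) mu R = mu L + 1).
Proof. by split; rewrite wdotE /srefl tpermV ?tpermL ?tpermR -[(R : nat)%:R]natr1; ring. Qed.

Lemma Iop_vvec mu lambda (k : F) : generic_weight mu ->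
  (forall a : 'I_m, exists j : nat, (j <= n)%N /\ lambda a - mu a = j%:R) ->
  Iop theta c (k *: vvec n mu lambda) =
  (k * ((-1) ^+ (nat_label (lambda L - mu L) * nat_label (lambda R - mu R)) *
        kappa mu lambda L R)) *: vvec n (wdot (srefl c) mu) (wdot (srefl c) lambda).
Proof.
move=> mug labels; pose nu a := nat_label (lambda a - mu a).
have nuP a : (nu a <= n)%N /\ lambda a = mu a + (nu a)%:R.
  by have [j [jn E0]] := labels a; rewrite /nu E0 nat_labelK -E0 addrC subrK.
set mu' := wdot _ mu; set lambda' := wdot _ lambda.
pose nu' a := nat_label (lambda' a - mu' a).
have nuE a : nu' (srefl c a) = nu a.
  by rewrite /nu' /nu /lambda' /mu' !wdotE permK; congr nat_label; ring.
have [nuL nuR] : nu' L = nu R /\ nu' R = nu L.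
  by rewrite -(nuE R) -(nuE L) /srefl tpermL tpermR.
have mug' : generic_weight mu' by exact: wdot_generic.
have nu'n a : (nu' a <= n)%N.
  by rewrite -(permKV (srefl c) a) nuE; case: (nuP ((srefl c)^-1%g a)).
rewrite !vvecE -/nu -/nu' -!(linear_funZ (coinv_of_linear _)).
apply: (Iop_coinv_of fractions mug).
rewrite alg_permZ xiZ // (alg_perm_aW F (proj1 (nuP L)) (proj1 (nuP R)) nuE).
rewrite xiZ // -/(nu L) -/(nu R) -!scalerA !theta_scale -!mulrBr.
do 2!apply: JIbar_Uf => //.
rewrite -theta_scale /kappa -/(nu L) -/(nu R).
have [RL|LR] := ltnP (nu L) (nu R); last first.
  have F0 : ad (aW F n nu') = 0 by apply: lie_Fc_aW; rewrite nuL nuR.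
  rewrite (@xiE _ _ _ _ _ _ 1) // big_ord1 xicoef0 expr0 !mul1r scale1r subrr.
  exact: gs0.
pose wt : weight F m := [ffun a => mu' a + (nu' a)%:R].
have wtE a : wt a = mu' a + (nu' a)%:R by rewrite ffunE.
have EW : adE (aW F n nu') = 0 by apply: lie_Ec_aW; rewrite nuL nuR ltnW.
have HW : lie H (aW F n nu') = aW F n nu' *+ (nu R - nu L).
  by rewrite lieBl !lie_cartan_aW // nuL nuR mulrnBr // ltnW.
have Wwt a : Iideal mu' (aE a a * aW F n nu' - wt a *: aW F n nu').
  rewrite (lie_eq (lie_cartan_aW F (nu'n a))) wtE scalerDl -scaler_nat.
  rewrite opprD addrACA subrr addr0.
  apply: gs_mem; exists (aW F n nu'), (aE a a - mu' a *: (1 : A)); split.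
    by left; right; exists a.
  by rewrite mulrBr ascaleAr mulr1.
have wtLR : wt L - wt R = mu' L - mu' R + (nu R - nu L)%:R.
  by rewrite !wtE nuL nuR natrB ?opprD 1?addrACA // ltnW.
have := xi_highest_weight EW HW mug' Wwt wtLR.
have -> // : (wt L - wt R + 1) / (wt L - wt R - (nu R - nu L)%:R + 1) =
  (lambda L - lambda R - (L : nat)%:R + (R : nat)%:R) /
  (mu L - mu R - (L : nat)%:R + (R : nat)%:R).
have RLE : (R : nat)%:R = (L : nat)%:R + 1 :> F by rewrite natr1.
have [_ lamL] := nuP L; have [_ lamR] := nuP R.
rewrite wtLR addrK lamL lamR RLE !wdot_srefl_LR (natrB F (ltnW RL)).
move: (mu L) (mu R) (nu L)%:R (nu R)%:R (L : nat)%:R => x y p q l; clear.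
(* The dot reflection interchanges the two rho-shifted labels, so numerator and denominator both
   come out negated; hence the factor -1 / -1. *)
rewrite -[RHS]mulr1 -(divff (x := -1 : F)) ?oppr_eq0 ?oner_eq0 // mulf_div !mulrN1.
by congr (_ / _); ring.
Qed.

End Intertwining.

(** * Reduced words *)

Section Inversions.
Variable m : nat.
Implicit Types (s t : 'S_m) (cs : seq 'I_m.-1).
Local Open Scope group_scope.

Definition inversions s : {set 'I_m * 'I_m} :=
  finset (fun p : 'I_m * 'I_m => (p.1 < p.2) && (s p.2 < s p.1))%N.

Lemma srefl_val (c : 'I_m.-1) (a : 'I_m) :
  srefl c a =
    (if a == c :> nat then c.+1 else if a == c.+1 :> nat then c : nat else a) :> nat.
Proof.
rewrite /srefl; case: tpermP => [->|->|/eqP aL /eqP aR] /=; rewrite ?eqxx //.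
  by rewrite gtn_eqF.
by rewrite -[a == _ :> nat]/(a == cL c) -[a == c.+1 :> nat]/(a == cR c) (negbTE aL) (negbTE aR).
Qed.

(** Products of permutations compose from left to right, so [s * srefl c] exchanges the values c and
    c+1 of s. Only the pair of positions carrying these two values changes its order. *)
Lemma inversions_srefl s c : (s^-1 (cL c) < s^-1 (cR c))%N ->
  inversions (s * srefl c) = (s^-1 (cL c), s^-1 (cR c)) |: inversions s.
Proof.
move=> ab; apply/setP => -[x y]; rewrite !inE /= !permM xpair_eqE !srefl_val.
have eqV (z d : 'I_m) : (z == s^-1 d) = (s z == d :> nat).
  by rewrite -(inj_eq (@perm_inj _ s)) permKV.
rewrite !eqV /=.
have xy : s x = c :> nat -> s y = c.+1 :> nat -> (x < y)%N.
  move=> sx sy; have -> : x = s^-1 (cL c) by apply/eqP; rewrite eqV sx.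
  by have -> : y = s^-1 (cR c) by apply/eqP; rewrite eqV sy.
have yx : s x = c.+1 :> nat -> s y = c :> nat -> (y < x)%N.
  move=> sx sy; have -> : x = s^-1 (cR c) by apply/eqP; rewrite eqV sx.
  by have -> : y = s^-1 (cL c) by apply/eqP; rewrite eqV sy.
move: xy yx; move: (nat_of_ord (s x)) (nat_of_ord (s y)) (nat_of_ord x) (nat_of_ord y).
by move: (nat_of_ord c) => d u v p q; clear; do !case: eqP => ? /=; lia.
Qed.

Lemma inversions_srefl_notin s c :
  (s^-1 (cL c), s^-1 (cR c)) \notin inversions s.
Proof. by rewrite inE /= !permKV andbC /= ltnNge leqnSn. Qed.

Lemma inversions_asc s c : (s^-1 (cL c) < s^-1 (cR c))%N ->
  #|inversions (s * srefl c)| = #|inversions s|.+1.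
Proof. by move=> ab; rewrite inversions_srefl // cardsU1 inversions_srefl_notin. Qed.

Lemma inversions_desc s c : (s^-1 (cR c) < s^-1 (cL c))%N ->
  #|inversions s| = #|inversions (s * srefl c)|.+1.
Proof.
move=> ab; rewrite -(@inversions_asc _ c); first by rewrite -mulgA tperm2 mulg1.
by rewrite invMg !permM /srefl tpermV tpermL tpermR.
Qed.

Lemma word_perm_cons c cs : word_perm (c :: cs) = word_perm cs * srefl c.
Proof. by rewrite /word_perm rev_cons big_rcons. Qed.

Lemma card_inversions_word cs : (#|inversions (word_perm cs)| <= size cs)%N.
Proof.
elim: cs => [|c cs IH].
  rewrite /word_perm big_nil leqn0 cards_eq0; apply/eqP/setP => p.
  by rewrite !inE !perm1; apply/negP => /andP[/ltnW]; rewrite leqNgt => /negP.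
rewrite word_perm_cons /=.
case: (ltngtP ((word_perm cs)^-1 (cL c)) ((word_perm cs)^-1 (cR c))) => [ab|ba|/val_inj/perm_inj].
- by rewrite inversions_asc.
- by apply: leq_trans (leqnSn _) _; rewrite -inversions_desc // leqW.
- by move/eqP; rewrite neq_cLR.
Qed.

(** The values of t form a sorted rearrangement of 0, ..., m - 1, and a strictly sorted sequence is
    determined by its elements. *)
Lemma increasing_perm t :
  (forall c : 'I_m.-1, t (cL c) < t (cR c))%N -> t = 1.
Proof.
move=> tinc; apply/permP => a; rewrite perm1.
have nthE (j : 'I_m) : nth 0%N [seq val (t i) | i <- enum 'I_m] j = t j.
  by rewrite (nth_map j) ?size_enum_ord // nth_ord_enum.
have E : [seq val (t i) | i <- enum 'I_m] = [seq val i | i <- enum 'I_m].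
  apply: (irr_sorted_eq ltn_trans ltnn).
  - apply/(sortedP 0%N) => i; rewrite size_map size_enum_ord => im.
    have ic : (i < m.-1)%N by rewrite -ltnS prednK // (leq_ltn_trans _ im).
    by rewrite (nthE (cL (Ordinal ic))) (nthE (cR (Ordinal ic))).
  - by rewrite val_enum_ord iota_ltn_sorted.
  - move=> k; apply/mapP/mapP => -[i _ ->]; first by exists (t i) => //; rewrite mem_enum.
    by exists (t^-1 i); rewrite ?permKV // mem_enum.
have := congr1 (nth 0%N ^~ a) E.
by rewrite /= nthE val_enum_ord nth_iota // add0n => /val_inj.
Qed.

(** Bubble sort: a descent of the inverse yields a simple reflection that removes one inversion, and
    without descents s is the identity. *)
Lemma shortest_word s : exists cs, word_perm cs = s /\ size cs = #|inversions s|.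
Proof.
have [k] := ubnP #|inversions s|; elim: k s => // k IH s sk.
have [/existsP[c ba]|/existsPn inc] :=
  boolP [exists c : 'I_m.-1, (s^-1 (cR c) < s^-1 (cL c))%N].
  rewrite (inversions_desc ba) in sk *; have [cs [csE <-]] := IH _ sk.
  exists (c :: cs); split=> //; rewrite word_perm_cons csE.
  by rewrite -mulgA tperm2 mulg1.
have s1 : s^-1 = 1.
  apply: increasing_perm => c; rewrite ltn_neqAle leqNgt inc andbT.
  by rewrite val_eqE (inj_eq perm_inj) neq_cLR.
exists [::]; have -> : s = 1 by rewrite -[s]invgK s1 invg1.
split; first by rewrite /word_perm big_nil.
by apply/esym/eqP; rewrite -leqn0; have := card_inversions_word [::]; rewrite /word_perm big_nil.
Qed.

Lemma reduced_size cs s : reduced_decomposition cs s -> size cs = #|inversions s|.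
Proof.
move=> [csE csmin]; have [cs' [csE' sz]] := shortest_word s.
by apply/eqP; rewrite eqn_leq -{1}sz csmin //= -csE card_inversions_word.
Qed.

(** A letter changes the number of inversions by exactly one, and a word never has more inversions
    than letters. When the two numbers agree, the last applied letter must add an inversion and the
    tail inherits the equality. *)
Lemma size_inversions_cons c cs : size (c :: cs) = #|inversions (word_perm (c :: cs))| ->
  size cs = #|inversions (word_perm cs)| /\
  ((word_perm cs)^-1 (cL c) < (word_perm cs)^-1 (cR c))%N.
Proof.
rewrite word_perm_cons /=; have := card_inversions_word cs.
have [ab|ba|/val_inj/perm_inj/eqP] :=
  ltngtP ((word_perm cs)^-1 (cL c)) ((word_perm cs)^-1 (cR c)); last 1 first.
- by rewrite neq_cLR.
- by rewrite inversions_asc // => _ [->].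
- by rewrite (inversions_desc ba) => le E; rewrite -E ltnNge leqnSn in le.
Qed.

Lemma prod_inversions (F : fieldType) s (f : 'I_m -> 'I_m -> F) :
  (\prod_(a < m) \prod_(b < m | (a < b)%N && (s b < s a)%N) f a b =
   \prod_(p in inversions s) f p.1 p.2)%R.
Proof. by rewrite pair_big_dep; apply: eq_bigl => p; rewrite inE. Qed.

End Inversions.

Lemma wdotM (F : fieldType) m (s t : 'S_m) (mu : weight F m) :
  wdot (s * t)%g mu = wdot t (wdot s mu).
Proof. by apply/ffunP => a; rewrite !wdotE invMg permM addrK. Qed.

Lemma wdot1 (F : fieldType) m (mu : weight F m) : wdot 1%g mu = mu.
Proof. by apply/ffunP => a; rewrite wdotE invg1 perm1 subrK. Qed.

Lemma wdot_label (F : fieldType) m (s : 'S_m) (mu lambda : weight F m) a :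
  wdot s lambda a - wdot s mu a = lambda ((s^-1)%g a) - mu ((s^-1)%g a).
Proof. by rewrite !wdotE; ring. Qed.

(** * The product formula along a reduced word *)

Section Words.
Variables (F : numFieldType) (m n : nat).
Variables (Abar : unitRingType) (theta : {rmorphism Aalg F m n -> Abar}).
Hypothesis fractions : ring_of_fractions theta (uh n @` @denoms F m).
Variables (mu lambda : weight F m).
Hypothesis mu_generic : generic_weight mu.
Hypothesis labels : forall a : 'I_m,
  exists k : nat, (k <= n)%N /\ lambda a - mu a = k%:R.

Definition inversion_factor (a b : 'I_m) : F :=
  (-1) ^+ (nat_label (lambda a - mu a) * nat_label (lambda b - mu b)) *
  kappa mu lambda a b.

(** kappa involves lambda and mu only through nu and the rho-shifted labels lambda_a - a and mu_a -
    a, all of which the dot action merely permutes. *)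
Lemma kappa_wdot (s : 'S_m) (c : 'I_m.-1) :
  kappa (wdot s mu) (wdot s lambda) (cL c) (cR c) =
  kappa mu lambda ((s^-1)%g (cL c)) ((s^-1)%g (cR c)).
Proof.
rewrite /kappa !wdot_label; case: ifP => // _; rewrite !wdotE.
by congr (_ / _); ring.
Qed.

(** Minimality of the word is replaced by length equal to the number of inversions, a condition that
    passes directly to the tail. [Tagged] carries along the weight, which each letter changes. *)
Lemma Iword_vvec cs : size cs = #|inversions (word_perm cs)| ->
  Iword theta cs (Tagged (coinv n) (vvec n mu lambda)) =
  Tagged (coinv n) ((\prod_(p in inversions (word_perm cs)) inversion_factor p.1 p.2) *:
    vvec n (wdot (word_perm cs) mu) (wdot (word_perm cs) lambda)).
Proof.
elim: cs => [|c cs IH].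
  rewrite /word_perm big_nil !wdot1 => /esym/eqP; rewrite cards_eq0 => /eqP ->.
  by rewrite big_set0 scale1r.
case/size_inversions_cons => csE ab.
have labels' a : exists k : nat, (k <= n)%N /\
    wdot (word_perm cs) lambda a - wdot (word_perm cs) mu a = k%:R.
  by rewrite wdot_label.
rewrite [LHS]/= -/(Iword theta cs _) (IH csE) [tagged _]/=.
rewrite (Iop_vvec fractions c _ (wdot_generic mu_generic) labels').
rewrite word_perm_cons (inversions_srefl ab) (big_setU1 _ (inversions_srefl_notin _ _)) /=.
by rewrite !wdot_label kappa_wdot !wdotM mulrC.
Qed.

End Words.

Theorem proposition3p7 (R : realType) (m n : nat)
  (Abar : unitRingType) (theta : {rmorphism Aalg R[i] m n -> Abar})
  (mu lambda : weight R[i] m) (s : 'S_m) (cs : seq 'I_m.-1)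
  (m_gt0 : (0 < m)%N) (n_gt0 : (0 < n)%N)
  (Abar_fractions : ring_of_fractions theta (uh n @` @denoms R[i] m))
  (mu_generic : forall a b : 'I_m, a != b ->
     forall z : int, mu a - mu b <> z%:~R)
  (nu_labels : forall a : 'I_m,
     exists k : nat, (k <= n)%N /\ lambda a - mu a = k%:R)
  (cs_reduced : reduced_decomposition cs s) :
  Iword theta cs (Tagged (coinv n) (vvec n mu lambda)) =
  Tagged (coinv n)
    ((\prod_(a < m) \prod_(b < m | (a < b)%N && (s b < s a)%N)
        ((-1) ^+ (nat_label (lambda a - mu a) * nat_label (lambda b - mu b))
           * kappa mu lambda a b))
     *: vvec n (wdot s mu) (wdot s lambda)).
Proof.
have csE := reduced_size cs_reduced; case: cs_reduced => sE _.
rewrite -{s}sE in csE *; rewrite prod_inversions.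
exact: (Iword_vvec Abar_fractions mu_generic nu_labels csE).
Qed.
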